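(* Let $(x_n)$ be the AR($p$) process defined below, driven by i.i.d. noise $(\varepsilon_n)$ with $\mathbf{E}\varepsilon_1=0$ and $0<\mathbf{E}\varepsilon_1^2=\sigma^2<\infty$. For $h>0$ let $\tau(h)=\inf\{n\ge1:\operatorname{tr}M_n\ge h\sigma^2\}$ and let $\theta(\tau(h))=M_{\tau(h)}^{-1}\sum_{k=1}^{\tau(h)}X_{k-1}x_k$ be the sequential least squares estimate. Then for every compact set $K\subset\tilde\Lambda_p$, $$\lim_{h\to\infty}\sup_{\theta\in K}\sup_{t\in\mathbb{R}^p}\Big|\mathbf{P}_\theta\big(M_{\tau(h)}^{1/2}(\theta(\tau(h))-\theta)\le t\big)-\Phi_p(t/\sigma)\Big|=0,$$ where the inequality between vectors is componentwise, $M^{1/2}$ is the symmetric positive semidefinite square root, and $\Phi_p(t/\sigma)=\prod_{i=1}^p\Phi(t_i/\sigma)$ with $\Phi$ the standard normal distribution function.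
   Context: Model: $x_n=\theta_1x_{n-1}+\dots+\theta_px_{n-p}+\varepsilon_n$, $n\ge1$, with $x_0=x_{-1}=\dots=x_{1-p}=0$, where $(\varepsilon_n)_{n\ge1}$ are i.i.d. with $\mathbf{E}\varepsilon_1=0$, $0<\mathbf{E}\varepsilon_1^2=\sigma^2<\infty$ ($\sigma^2$ known), and $\theta=(\theta_1,\dots,\theta_p)'\in\mathbb{R}^p$ is unknown; $\mathbf{P}_\theta$ denotes the law of the process under parameter $\theta$ (the noise law does not depend on $\theta$). Set $X_n=(x_n,x_{n-1},\dots,x_{n-p+1})'$ and $M_n=\sum_{k=1}^nX_{k-1}X_{k-1}'$; $M_n^{-1}$ is the inverse if $\det M_n>0$ and $0$ otherwise. The characteristic polynomial is $\mathcal P(z)=z^p-\theta_1z^{p-1}-\dots-\theta_p$ with roots $z_i(\theta)$. Condition 1: all roots of $\mathcal P$ satisfy $|z_i(\theta)|\le1$. Condition 2: all roots of $\mathcal P$ of modulus one are simple. Condition 3: the linear system in $Y_1,\dots,Y_{p-1}$ $$Y_1-\sum_{l=2}^p\theta_lY_{l-1}=\theta_1,\qquad -\sum_{k=1}^{j-1}\theta_{j-k}Y_k+Y_j-\sum_{k=1}^{p-j}\theta_{k+j}Y_k=\theta_j\ (2\le j\le p-1)$$ has a unique solution $Y_i=\kappa_i(\theta)$, and the symmetric Toeplitz matrix $L(\theta)$ with entries $L_{ij}=\kappa_{|i-j|}(\theta)$ ($\kappa_0:=1$) is positive definite. $\tilde\Lambda_p$ is the set of $\theta$ satisfying Conditions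 1–3. *)

(* Defs.v *)
From mathcomp Require Import all_boot all_order all_algebra.
From mathcomp Require Import all_classical all_reals all_analysis.
From mathcomp Require Import complex.
Import Order.TTheory GRing.Theory Num.Theory.
Import numFieldNormedType.Exports.

Set Implicit Arguments.
Unset Strict Implicit.
Unset Printing Implicit Defensive.

Local Open Scope classical_set_scope.
Local Open Scope ring_scope.

Section AR.
Variable R : realType.

(* ---------- parameter  theta = (theta_1,...,theta_p)' as a column vector;
   thc th i = theta_i for 1 <= i <= p, and 0 otherwise ---------- *)
Definition thc (p : nat) (th : 'cV[R]_p) (i : nat) : R :=
  if i is i'.+1 then
    (if (insub i' : option 'I_p) is Some j then th j 0 else 0)
  else 0.

(* ---------- the AR(p) recursion ----------
   The noise is e : nat -> R with e k = eps_{k+1} (i.e. eps_n = e (n-1)).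
   ar_hist th e n = [:: x_n; x_{n-1}; ...; x_1]  (empty for n = 0);
   with x_m = 0 for m <= 0 this gives  x_{n-k} = nth 0 (ar_hist th e n) k
   for every k (the default 0 of nth accounts for the zero initial values). *)
Fixpoint ar_hist (p : nat) (th : 'cV[R]_p) (e : nat -> R) (n : nat) : seq R :=
  if n is n'.+1 then
    (\sum_(i < p) th i 0 * nth 0 (ar_hist th e n') i + e n')
      :: ar_hist th e n'
  else [::].

Definition ar_x (p : nat) (th : 'cV[R]_p) (e : nat -> R) (n : nat) : R :=
  nth 0 (ar_hist th e n) 0.

Definition ar_X (p : nat) (th : 'cV[R]_p) (e : nat -> R) (n : nat) : 'cV[R]_p :=
  \col_(i < p) nth 0 (ar_hist th e n) i.

Definition ar_M (p : nat) (th : 'cV[R]_p) (e : nat -> R) (n : nat) : 'M[R]_p :=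
  \sum_(k < n) (ar_X th e k *m (ar_X th e k)^T).

Definition gen_inv (p : nat) (M : 'M[R]_p) : 'M[R]_p :=
  if 0 < \det M then invmx M else 0.

Definition ls_est (p : nat) (th : 'cV[R]_p) (e : nat -> R) (n : nat) : 'cV[R]_p :=
  gen_inv (ar_M th e n) *m \sum_(k < n) (ar_x th e k.+1 *: ar_X th e k).

Definition is_tau (p : nat) (th : 'cV[R]_p) (e : nat -> R) (sigma h : R)
    (n : nat) : Prop :=
  [/\ (1 <= n)%N, h * sigma ^+ 2 <= \tr (ar_M th e n) &
      forall m : nat, (1 <= m < n)%N -> \tr (ar_M th e m) < h * sigma ^+ 2].

Definition psd (p : nat) (S : 'M[R]_p) : Prop :=
  S^T = S /\ forall v : 'cV[R]_p, 0 <= (v^T *m S *m v) 0 0.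

Definition is_psd_sqrt (p : nat) (S M : 'M[R]_p) : Prop := psd S /\ S *m S = M.

(* the symmetric PSD square root of M (chosen by description; it exists and
   is unique whenever M is symmetric PSD, which is the case for M_n) *)
Definition sqrtmx (p : nat) (M : 'M[R]_p) : 'M[R]_p :=
  xget 0 [set S | is_psd_sqrt S M].

Definition Phi (x : R) : R := fine (normal_prob 0 1 `]-oo, x]).

Definition Phi_p (p : nat) (t : 'cV[R]_p) (sigma : R) : R :=
  \prod_(i < p) Phi (t i 0 / sigma).

Definition char_poly (p : nat) (th : 'cV[R]_p) : {poly R[i]} :=
  'X^p - \sum_(i < p) ((th i 0)%:C)%C%:P * 'X^(p - i.+1).

Definition cond1 (p : nat) (th : 'cV[R]_p) : Prop :=
  forall z : R[i], root (char_poly th) z -> `|z| <= 1.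

Definition cond2 (p : nat) (th : 'cV[R]_p) : Prop :=
  forall z : R[i], root (char_poly th) z -> `|z| = 1 -> mup z (char_poly th) = 1%N.

(* Y : nat -> R, only Y_1..Y_{p-1} matter. For 1 <= j <= p-1:
   -sum_{k=1}^{j-1} th_{j-k} Y_k + Y_j - sum_{k=1}^{p-j} th_{k+j} Y_k = th_j
   (for j = 1 the first sum is empty and this is the first equation). *)
Definition yule_system (p : nat) (th : 'cV[R]_p) (Y : nat -> R) : Prop :=
  forall j : nat, (1 <= j <= p.-1)%N ->
    - (\sum_(1 <= k < j) thc th (j - k) * Y k) + Y j
    - (\sum_(1 <= k < (p - j).+1) thc th (k + j) * Y k) = thc th j.

Definition Lmat (p : nat) (kappa : nat -> R) : 'M[R]_p :=
  \matrix_(i < p, j < p)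
    (if `|(i : nat) - (j : nat)|%N == 0%N then 1 else kappa `|(i : nat) - (j : nat)|%N).

Definition posdef (p : nat) (L : 'M[R]_p) : Prop :=
  forall v : 'cV[R]_p, v != 0 -> 0 < (v^T *m L *m v) 0 0.

Definition cond3 (p : nat) (th : 'cV[R]_p) : Prop :=
  exists kappa : nat -> R,
    [/\ yule_system th kappa,
        (forall Y : nat -> R, yule_system th Y ->
           forall i : nat, (1 <= i <= p.-1)%N -> Y i = kappa i) &
        posdef (Lmat p kappa)].

Definition tLambda (p : nat) : set 'cV[R]_p :=
  [set th | cond1 th /\ cond2 th /\ cond3 th].

End AR.

Section Noise.
Variables (d : measure_display) (T : measurableType d) (R : realType).
Variable P : probability T R.

Definition mutually_independent (e : nat -> T -> R) : Prop :=
  forall (s : seq nat) (B : nat -> set R), uniq s ->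
    (forall i, i \in s -> measurable (B i)) ->
    P (\bigcap_(i in [set i | i \in s]) (e i @^-1` B i)) =
    (\prod_(i <- s) P (e i @^-1` B i))%E.

Definition identically_distributed (e : nat -> T -> R) : Prop :=
  forall (n : nat) (B : set R), measurable B ->
    P (e n @^-1` B) = P (e 0%N @^-1` B).

End Noise.

(* Main.v *)
Require Import Defs.
From mathcomp Require Import all_boot all_order all_algebra.
From mathcomp Require Import all_classical all_reals all_analysis.
From mathcomp Require Import complex.
From mathcomp Require Import measurable_realfun ring lra zify.
Import Order.TTheory GRing.Theory Num.Theory.
Import numFieldNormedType.Exports.
Local Open Scope classical_set_scope.
Local Open Scope ring_scope.

(** Stopping at [tr M_n >= h sigma^2] turns the estimation error into a whitened martingale with an
    almost deterministic bracket, uniformly over [K].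

    Let [A] be the companion matrix, so that [X_(k+1) = A X_k + e_k b] with [e_k = eps_(k+1)], and let
    [L] be the Toeplitz matrix built from the Yule system. Then [A L A^T + s b b^T = L] with [s >= 0]
    because the roots lie in the closed unit disc; hence [|A^k x| <= C |x|] uniformly over [K], by
    compactness. Let [S_n = sum_(k<n) e_k X_k]. With probability close to one the stopping time [tau]
    is at most a multiple of [h], all the noises up to it are small compared with [sqrt h], and [S_tau]
    is small compared with [h]. Stability then makes every [|X_k|^2], [k <= tau], small compared with
    [h]: otherwise many earlier states would be large and the trace would have crossed the level
    before. Consequently [M_tau / h] is almost Toeplitz and almost solves the Yule system, which
    identifies it as [Gamma = sigma^2 L / p].

    The predictable vectors [D_k = Gamma^(-1/2) X_k / (sigma sqrt h)], switched off from [tau] on,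
    satisfy [sigma^2 sum_k D_k D_k^T ~ 1], and a martingale central limit theorem applies to
    [W = sum_k D_k e_k]. It is proved by telescoping
    [exp (sigma^2 sum_(k<m) (u.D_k)^2 / 2) cos (u.W_m + c)], and by sandwiching orthants between
    trigonometric polynomials, which keeps all the bounds uniform in the parameter. Finally
    [M_tau^(1/2) (theta(tau) - theta) = M_tau^(-1/2) S_tau] differs little from [sigma W], since the
    square root is Lipschitz near the nondegenerate matrix [h Gamma]. *)

Set Implicit Arguments.
Unset Strict Implicit.
Unset Printing Implicit Defensive.

(** * Means and probabilities; independence of the past *)

(** With roots on the unit circle a normalized [M_n] may have a random limit at deterministic times,
    so no law of large numbers for it can be used. The trace rule fixes its size, and the exact
    shift identities of Gram matrices leave for its direction one linear system, uniquely solvable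
    by Condition 3; this works whatever the rate of growth. Nor is ergodicity needed for [S_tau]: it
    equals [sigma sqrt h Gamma^(1/2) W] with [W] tight, hence is of order [sqrt h]. The bound on
    [tau] is equally crude: squared innovations are controlled by the trace, and their sum grows
    linearly. To avoid extracting sequences of parameters, the central limit theorem is stated with
    a tolerance [zeta] that depends only on a bracket bound, the accuracy and the noise law. The
    bounds on increments and bracket hold on the whole space, and only the closeness of the bracket
    to 1 is allowed to fail on a rare event; so conditional expectations reduce to factoring
    [E (U g(e_k))] for [U] measurable with respect to the past. *)

Section RealExpectation.
Context d (T : measurableType d) (R : realType) (P : probability T R).
Implicit Types X Y U V : T -> R.

(** Means and probabilities live in [R], so that estimates are ordinary real inequalities. Since
    [fine] sends infinite values to 0, [mean] is meaningful only together with [has_mean]. *)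
Definition mean X : R := fine (\int[P]_x (X x)%:E).
Definition has_mean X : Prop := P.-integrable setT (EFin \o X).
Definition Pr (A : set T) : R := fine (P A).

Lemma has_mean_meas X : has_mean X -> measurable_fun setT X.
Proof. by move=> /measurable_int/measurable_EFinP. Qed.

Lemma mean_EFin X : has_mean X -> (\int[P]_x (X x)%:E)%E = (mean X)%:E.
Proof. by move=> hX; rewrite /mean fineK //; exact: integrable_fin_num. Qed.

Lemma has_mean_bounded X (C : R) : measurable_fun setT X ->
  (forall w, `|X w| <= C) -> has_mean X.
Proof.
move=> mX bX; apply: measurable_bounded_integrable => //.
  exact: le_lt_trans (probability_le1 P measurableT) (ltry _).
exists C; split; first by rewrite num_real.
by move=> M CM x _ /=; apply: le_trans (bX x) (ltW CM).
Qed.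

Lemma has_mean_cst (c : R) : has_mean (fun=> c).
Proof. by apply: (@has_mean_bounded _ `|c|) => //. Qed.

Lemma has_meanD X Y : has_mean X -> has_mean Y -> has_mean (fun w => X w + Y w).
Proof.
move=> hX hY; have := integrableD measurableT hX hY; apply: eq_integrable => //.
Qed.

Lemma has_meanZ (c : R) X : has_mean X -> has_mean (fun w => c * X w).
Proof.
move=> hX; have := integrableZl measurableT c hX; apply: eq_integrable => //.
Qed.

Lemma has_meanN X : has_mean X -> has_mean (fun w => - X w).
Proof.
by move=> /(has_meanZ (-1)); congr has_mean; apply/funext => w; rewrite mulN1r.
Qed.

Lemma has_meanB X Y : has_mean X -> has_mean Y -> has_mean (fun w => X w - Y w).
Proof. by move=> hX /has_meanN hY; exact: has_meanD. Qed.

Lemma has_mean_sum (I : Type) (s : seq I) (F : I -> T -> R) :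
  (forall i, has_mean (F i)) -> has_mean (fun w => \sum_(i <- s) F i w).
Proof.
move=> hF; elim: s => [|i s IH].
  by under [X in has_mean X]eq_fun do rewrite big_nil; exact: has_mean_cst.
by under [X in has_mean X]eq_fun do rewrite big_cons; exact: has_meanD.
Qed.

Lemma has_mean_bM U X (C : R) : measurable_fun setT U -> (forall w, `|U w| <= C) ->
  has_mean X -> has_mean (fun w => U w * X w).
Proof.
move=> mU bU hX.
have bd : [bounded U x | x in [set: T]].
  exists C; split; first by rewrite num_real.
  by move=> M CM x _ /=; apply: le_trans (bU x) (ltW CM).
have := integrableMr measurableT mU bd hX; apply: eq_integrable => //.
Qed.

Lemma has_mean_le X Y : measurable_fun setT X -> (forall w, `|X w| <= Y w) ->
  has_mean Y -> has_mean X.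
Proof.
move=> mX XY; apply: le_integrable => //; first exact/measurable_EFinP.
move=> w _ /=; rewrite lee_fin; apply: le_trans (XY w) _.
exact: ler_norm.
Qed.

Lemma meanD X Y : has_mean X -> has_mean Y ->
  mean (fun w => X w + Y w) = mean X + mean Y.
Proof. by move=> hX hY; exact: (RintegralD measurableT hX hY). Qed.

Lemma meanZ (c : R) X : has_mean X -> mean (fun w => c * X w) = c * mean X.
Proof. by move=> hX; by rewrite /mean -/(Rintegral P setT (fun w => c * X w)) RintegralZl. Qed.

Lemma meanB X Y : has_mean X -> has_mean Y ->
  mean (fun w => X w - Y w) = mean X - mean Y.
Proof. by move=> hX hY; exact: (RintegralB measurableT hX hY). Qed.

Lemma mean_cst (c : R) : mean (fun=> c) = c.
Proof.
have := @Rintegral_cst _ _ _ P setT measurableT c.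
by rewrite /Rintegral (_ : _ setT = 1%E) ?mulr1 //; exact: probability_setT.
Qed.

Lemma mean_sum (I : Type) (s : seq I) (F : I -> T -> R) :
  (forall i, has_mean (F i)) ->
  mean (fun w => \sum_(i <- s) F i w) = \sum_(i <- s) mean (F i).
Proof.
move=> hF; elim: s => [|i s IH].
  by under [X in mean X]eq_fun do rewrite big_nil; rewrite big_nil mean_cst.
under [X in mean X]eq_fun do rewrite big_cons; rewrite big_cons.
by rewrite meanD ?IH //; exact: has_mean_sum.
Qed.

Lemma mean_le X Y : has_mean X -> has_mean Y -> (forall w, X w <= Y w) ->
  mean X <= mean Y.
Proof. by move=> hX hY XY; apply: (le_Rintegral measurableT hX hY). Qed.

Lemma mean_ge0 X : (forall w, 0 <= X w) -> 0 <= mean X.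
Proof. by move=> X0; apply: Rintegral_ge0. Qed.

Lemma mean_norm X : has_mean X -> `|mean X| <= mean (fun w => `|X w|).
Proof. by move=> hX; exact: (le_normr_Rintegral measurableT hX). Qed.

Lemma has_mean_norm X : has_mean X -> has_mean (fun w => `|X w|).
Proof. by move=> hX; exact: integrable_norm. Qed.

Lemma mean_le_bound X (C : R) : has_mean X -> (forall w, X w <= C) -> mean X <= C.
Proof.
by move=> hX XC; rewrite -(mean_cst C); apply: mean_le => //; exact: has_mean_cst.
Qed.

Lemma Pr_EFin A : measurable A -> P A = (Pr A)%:E.
Proof. by move=> mA; rewrite /Pr fineK // fin_num_measure. Qed.

Lemma Pr_le A B : measurable A -> measurable B -> A `<=` B -> Pr A <= Pr B.
Proof.
move=> mA mB AB; rewrite -lee_fin -!Pr_EFin //.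
by apply: le_measure => //; rewrite inE.
Qed.

Lemma PrU A B : measurable A -> measurable B -> Pr (A `|` B) <= Pr A + Pr B.
Proof.
move=> mA mB; rewrite -lee_fin EFinD -!Pr_EFin //; last exact: measurableU.
exact: measureU2.
Qed.

Lemma has_mean_indic A : measurable A -> has_mean (\1_A).
Proof.
move=> mA; apply: (@has_mean_bounded _ 1); first exact: measurable_indic.
move=> w; rewrite indicE ger0_norm; by case: (_ \in _).
Qed.

Lemma mean_indic A : measurable A -> mean (\1_A) = Pr A.
Proof. by move=> mA; rewrite /mean /Pr integral_indic // setIT. Qed.

Lemma Pr_bigcup (I : Type) (s : seq I) (F : I -> set T) :
  (forall i, measurable (F i)) ->
  Pr (\big[setU/set0]_(i <- s) F i) <= \sum_(i <- s) Pr (F i).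
Proof.
move=> mF; elim: s => [|i s IH]; first by rewrite !big_nil /Pr measure0.
rewrite !big_cons; apply: le_trans (PrU _ _) _ => //.
  exact: bigsetU_measurable.
by rewrite lerD2l.
Qed.

Lemma markov_mean X A (a : R) : 0 < a -> has_mean X -> (forall w, 0 <= X w) ->
  measurable A -> (forall w, A w -> a <= X w) -> Pr A <= mean X / a.
Proof.
move=> a0 hX X0 mA aX; rewrite ler_pdivlMr // mulrC -mean_indic //.
rewrite -meanZ; last exact: has_mean_indic.
apply: mean_le => // [|w]; first by apply/has_meanZ/has_mean_indic.
rewrite indicE; case: (boolP (w \in A)) => [/set_mem/aX|_]; first by rewrite mulr1.
by rewrite mulr0.
Qed.

End RealExpectation.

Lemma iota_set n : [set i | i \in iota 0 n] = [set i | (i < n)%N].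
Proof. by apply/funext => i; rewrite /mkset mem_iota add0n. Qed.

Section Independence.
Context d (T : measurableType d) (R : realType) (P : probability T R).
Variable e : nat -> T -> R.
Hypothesis me : forall n, measurable_fun setT (e n).
Hypothesis ie : mutually_independent P e.

Local Open Scope ereal_scope.

(* Events depending on [e 0, ..., e (k - 1)] only. *)
Definition cylinders (k : nat) : set (set T) :=
  [set A | exists B : nat -> set R, (forall i, measurable (B i)) /\
     A = \bigcap_(i in [set i | i \in iota 0 k]) (e i @^-1` B i)].

(** The carrier is still [T], with a coarser sigma-algebra: depending only on the past is then plain
    measurability from [past k], and the usual closure lemmas apply. *)
Definition past (k : nat) := g_sigma_algebraType (cylinders k).

Lemma cylinders_setI k : setI_closed (cylinders k).
Proof.
move=> _ _ [B [mB ->]] [C [mC ->]]; exists (fun i => B i `&` C i); split.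
  by move=> i; exact: measurableI.
rewrite -bigcapI; apply: eq_bigcapr => i _.
by rewrite preimage_setI.
Qed.

Lemma cylinders_measurable k : cylinders k `<=` measurable.
Proof.
move=> _ [B [mB ->]]; apply: fin_bigcap_measurable => //.
by move=> i _; rewrite -[X in measurable X]setTI; exact: me.
Qed.

Lemma past_measurable_set k (A : set T) : <<s cylinders k >> A -> measurable A.
Proof.
exact: (smallest_sub (@sigma_algebra_measurable _ T) (@cylinders_measurable k)).
Qed.

Lemma past_measurable_fun k (U : T -> R) :
  measurable_fun setT (U : past k -> R) -> measurable_fun setT U.
Proof.
by move=> mU _ B mB; apply: (@past_measurable_set k); exact: (mU measurableT B mB).
Qed.

Lemma past_noise k i : (i < k)%N -> measurable_fun setT (e i : past k -> R).
Proof.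
move=> ik _ B mB; rewrite setTI; apply: sub_gen_smallest.
exists (fun j => if j == i then B else setT); split.
  by move=> j; case: ifP.
apply/seteqP; split => [w eB j _ /=|w /(_ i)/=].
  by case: ifPn => [/eqP ->|_].
by rewrite eqxx; apply; rewrite mem_iota add0n.
Qed.

(** As functions of [A] both sides are finite measures, [P] restricted to the event on [e k] and a
    multiple of [P]. They agree on the cylinders, which are stable under intersection and contain
    the whole space. *)
Lemma indep_past k (A : set T) (B : set R) : <<s cylinders k >> A -> measurable B ->
  P (A `&` e k @^-1` B) = P A * P (e k @^-1` B).
Proof.
move=> sA mB.
have mD : measurable (e k @^-1` B) by rewrite -[X in measurable X]setTI; exact: me.
have D0 : (0 <= fine (P (e k @^-1` B)))%R by rewrite fine_ge0.
pose m1 := mrestr P mD; pose m2 := mscale (NngNum D0) P.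
have PD : P (e k @^-1` B) = (fine (P (e k @^-1` B)))%:E by rewrite fineK ?fin_num_measure.
have -> : P A * P (e k @^-1` B) = m2 A.
  by rewrite muleC {1}PD.
change (m1 A = m2 A).
apply: (@g_sigma_algebra_measure_unique _ _ _ (cylinders k) _ (fun=> setT)) => //.
- exact: cylinders_measurable.
- move=> _; exists (fun=> setT); split => //.
  by apply/seteqP; split => // w _ i.
- by rewrite bigcup_const //; exists 0%N.
- exact: cylinders_setI.
- move=> _ [C [mC ->]]; transitivity (P (e k @^-1` B) * P (\bigcap_(i in [set i | i \in iota 0 k]) e i @^-1` C i)); last by rewrite {1}PD.
  rewrite /m1 /mrestr.
  (* Extending the cylinder by [B] at coordinate [k] turns the intersection into one product event,
     to which mutual independence applies. *)
  set C' := fun i => if (i < k)%N then C i else B.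
  have mC' i : measurable (C' i) by rewrite /C'; case: ifP.
  transitivity (P (\bigcap_(i in [set i | i \in iota 0 k.+1]) e i @^-1` C' i)).
    congr (P _); rewrite !iota_set; apply/seteqP; split => [w [Cw Bw] i|w Cw].
      rewrite /mkset ltnS leq_eqVlt => /predU1P[->|ik].
        by rewrite /C' ltnn.
      by rewrite /C' ik; exact: Cw.
    split=> [i ik|]; last first.
      by have := Cw k (ltnSn k); rewrite /C' ltnn.
    by have := Cw i (ltnW (ik : (i.+1 <= k)%N)); rewrite /C' (ik : (i < k)%N).
  rewrite ie ?iota_uniq // ie ?iota_uniq // -addn1 iotaD big_cat /= big_seq1.
  rewrite /C' add0n ltnn muleC; congr (_ * _).
  apply: eq_big_seq => i; rewrite mem_iota add0n /= => ik.
  by rewrite ik.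
- by move=> _; rewrite /m1 /mrestr; apply: le_lt_trans (probability_le1 _ _) (ltry _) => //; rewrite setTI.
Qed.

(** This takes the place of conditioning on the past. The law of the pair agrees with the product of
    the marginals on rectangles, hence everywhere, and Fubini splits the integral. *)
Lemma mean_past_mul k (U : T -> R) (g : R -> R) :
  measurable_fun setT (U : past k -> R) -> has_mean P U ->
  measurable_fun setT g -> has_mean P (g \o e k) ->
  has_mean P (fun w => U w * g (e k w))%R ->
  mean P (fun w => U w * g (e k w))%R = (mean P U * mean P (g \o e k))%R.
Proof.
move=> mU hU mg hV hUV; set V := g \o e k.
have mU' : measurable_fun setT U := past_measurable_fun mU.
have mV : measurable_fun setT V by apply: measurableT_comp.
pose X : {mfun T >-> R} := mfun_Sub (mem_set mU').
pose Y : {mfun T >-> R} := mfun_Sub (mem_set mV).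
have mXY : measurable_fun setT (fun w => (U w, V w)) by apply: measurable_fun_pair.
pose Z : {mfun T >-> (R * R)%type} := mfun_Sub (mem_set mXY).
pose pm : {measure set (R * R)%type -> \bar R} := distribution P X \x distribution P Y.
have law W : measurable W -> pm W = distribution P Z W.
  apply: product_measure_unique => A B mA mB.
  transitivity (P (U @^-1` A `&` e k @^-1` (g @^-1` B))); first by congr (P _).
  rewrite indep_past //.
    by have := mU measurableT A mA; rewrite setTI.
  by rewrite -[X in measurable X]setTI; exact: mg.
pose f (z : R * R) := (z.1 * z.2)%:E.
have mf : measurable_fun setT f.
  by apply/measurable_EFinP; apply: measurable_funM; [exact: measurable_fst|exact: measurable_snd].
have iZ : (distribution P Z).-integrable setT f.
  by apply: integrable_pushforward.
have if_ : pm.-integrable setT f.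
  apply/integrableP; split => //; move/integrableP : iZ => [_].
  by rewrite (@eq_measure_integral _ _ _ setT pm (distribution P Z)) // => A mA _; rewrite law.
apply/EFin_inj; rewrite -mean_EFin // EFinM -(mean_EFin hU) -(mean_EFin hV).
have -> : \int[P]_x (U x * g (e k x))%:E = \int[distribution P Z]_z f z.
  by rewrite integral_distribution.
rewrite -(@eq_measure_integral _ _ _ setT _ pm); last first.
  by move=> A mA _; rewrite law.
have hY : (distribution P Y).-integrable setT EFin.
  by apply: integrable_pushforward.
have hX : (distribution P X).-integrable setT EFin.
  by apply: integrable_pushforward.
have fY : \int[distribution P Y]_y y%:E = (mean P V)%:E.
  by rewrite integral_distribution // mean_EFin.
transitivity (\int[distribution P X]_x (x%:E * (mean P V)%:E)); last first.
  rewrite integralZr // integral_distribution // -fY.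
  by rewrite integral_distribution.
rewrite -(integral12_prod_meas1 if_); apply: eq_integral => x _.
by rewrite -fY -integralZl.
Qed.

End Independence.

Section Measurability.
Context d (T : measurableType d) (R : realType).
Implicit Types f g : T -> R.

Lemma measurable_set_lt f g : measurable_fun setT f -> measurable_fun setT g ->
  measurable [set w | f w < g w].
Proof.
move=> mf mg; have := measurable_fun_ltr mf mg.
by move=> /(_ measurableT [set true] I); rewrite setTI.
Qed.

Lemma measurable_set_le f g : measurable_fun setT f -> measurable_fun setT g ->
  measurable [set w | f w <= g w].
Proof.
move=> mf mg; have := measurable_fun_ler mf mg.
by move=> /(_ measurableT [set true] I); rewrite setTI.
Qed.

Lemma measurable_set_forall (I : finType) (A : I -> set T) :
  (forall i, measurable (A i)) -> measurable [set w | forall i, A i w].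
Proof.
move=> mA; have -> : [set w | forall i, A i w] = \bigcap_(i in setT) A i.
  by apply/seteqP; split => [w Aw i _|w Aw i]; apply: Aw.
by apply: fin_bigcap_measurable => // i _; exact: mA.
Qed.

Lemma measurable_fun_bigsum (I : Type) (s : seq I) (F : I -> T -> R) :
  (forall i, measurable_fun setT (F i)) ->
  measurable_fun setT (fun w => \sum_(i <- s) F i w).
Proof.
move=> mF; elim: s => [|i s IH].
  by rewrite (_ : (fun _ => _) = cst 0) //; apply/funext => w; rewrite big_nil.
by under eq_fun do rewrite big_cons; exact: measurable_funD.
Qed.

Lemma measurable_fun_bigprod (I : Type) (s : seq I) (F : I -> T -> R) :
  (forall i, measurable_fun setT (F i)) ->
  measurable_fun setT (fun w => \prod_(i <- s) F i w).
Proof.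
move=> mF; elim: s => [|i s IH].
  by rewrite (_ : (fun _ => _) = cst 1) //; apply/funext => w; rewrite big_nil.
by under eq_fun do rewrite big_cons; exact: measurable_funM.
Qed.

Lemma measurable_fun_ind (A : set T) : measurable A ->
  measurable_fun setT (fun w => (w \in A)%:R : R).
Proof. by move=> mA; exact: measurable_indic. Qed.

End Measurability.

Section IdenticalLaw.
Context d (T : measurableType d) (R : realType) (P : probability T R).
Variable e : nat -> T -> R.
Hypothesis me : forall n, measurable_fun setT (e n).
Hypothesis ide : identically_distributed P e.

Lemma law_transfer k (g : R -> R) : measurable_fun setT g -> has_mean P (g \o e 0%N) ->
  has_mean P (g \o e k) /\ mean P (g \o e k) = mean P (g \o e 0%N).
Proof.
move=> mg h0.
pose X : {mfun T >-> R} := mfun_Sub (mem_set (me k)).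
pose Y : {mfun T >-> R} := mfun_Sub (mem_set (me 0%N)).
have law A : measurable A -> A `<=` setT -> distribution P X A = distribution P Y A.
  by move=> mA _; exact: ide.
have mg' : measurable_fun setT (EFin \o g) by exact/measurable_EFinP.
have hk : has_mean P (g \o e k).
  apply/integrableP; split; first by apply/measurable_EFinP; apply: measurableT_comp.
  have mag : measurable_fun setT (fun x => `|(g x)%:E|%E) by apply: measurableT_comp.
  have E (Z : {mfun T >-> R}) : (\int[P]_w `|(EFin \o (g \o Z)) w| = \int[distribution P Z]_x `|(g x)%:E|)%E.
    by rewrite ge0_integral_distribution.
  rewrite (E X) (eq_measure_integral _ law) -(E Y).
  by case/integrableP : h0.
split=> //; rewrite /mean; congr fine.
have E (Z : {mfun T >-> R}) : has_mean P (g \o Z) ->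
    (\int[P]_w ((g \o Z) w)%:E = \int[distribution P Z]_x (g x)%:E)%E.
  by move=> hZ; rewrite integral_distribution.
by rewrite (E X hk) (E Y h0) (eq_measure_integral _ law).
Qed.

End IdenticalLaw.

(** * The Gaussian characteristic function *)

Section Trig.
Variable R : realType.
Implicit Types x y a b c : R.

(** Each Taylor remainder below comes from applying this to a function whose derivative is the
    remainder bounded just before; the constants are not sharp. *)
Lemma mvt0 (f df : R -> R) : (forall x, is_derive x 1 f (df x)) ->
  forall x, exists2 c, `|c| <= `|x| & f x - f 0 = df c * x.
Proof.
move=> fdf x.
have cf (A : set R) : {within A, continuous f}.
  apply: continuous_subspaceT => y; apply: differentiable_continuous.
  by apply/derivable1_diffP; apply: ex_derive; exact: fdf.
have [x0|x0] := leP 0 x.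
  have [c] := MVT_segment x0 (fun y _ => fdf y) (cf _).
  rewrite in_itv /= subr0 => /andP[c0 cx] ->; exists c => //.
  by rewrite !ger0_norm.
have [c] := MVT_segment (ltW x0) (fun y _ => fdf y) (cf _).
rewrite in_itv /= sub0r => /andP[c0 cx] fE; exists c.
  by rewrite !ler0_norm ?lerN2 // ltW.
by rewrite -opprB fE mulrN opprK.
Qed.

Lemma norm_sin_le x : `|sin x| <= `|x|.
Proof.
have [c _] := mvt0 (@is_derive_sin R) x; rewrite sin0 subr0 => ->.
by rewrite normrM ler_piMl // cos_max.
Qed.

Lemma norm_cosB1_le x : `|cos x - 1| <= `|x|.
Proof.
have [c _] := mvt0 (@is_derive_cos R) x; rewrite cos0 => ->.
by rewrite normrM normrN ler_piMl // sin_max.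
Qed.

Lemma norm_cosB1_le2 x : `|cos x - 1| <= `|x| ^+ 2.
Proof.
have [c cx] := mvt0 (@is_derive_cos R) x; rewrite cos0 => ->.
by rewrite normrM normrN expr2 ler_wpM2r // (le_trans (norm_sin_le _)).
Qed.

Let sinBid c : exists2 c', `|c'| <= `|c| & sin c - c = (cos c' - 1) * c.
Proof.
have fdf y : is_derive y 1 (fun z : R => sin z - z) (cos y - 1).
  by apply: is_deriveB.
by have [c' c'c] := mvt0 fdf c; rewrite sin0 subrr subr0 => ->; exists c'.
Qed.

Lemma norm_sinBid_le2 x : `|sin x - x| <= `|x| ^+ 2.
Proof.
have [c cx ->] := sinBid x; rewrite normrM expr2 ler_wpM2r //.
exact: le_trans (norm_cosB1_le _) cx.
Qed.

Lemma norm_sinBid_le3 x : `|sin x - x| <= `|x| ^+ 3.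
Proof.
have [c cx ->] := sinBid x; rewrite normrM exprSr ler_wpM2r //.
by apply: le_trans (norm_cosB1_le2 _) _; rewrite ler_pXn2r.
Qed.

Let cos2B c : exists2 c', `|c'| <= `|c| & cos c - 1 + c ^+ 2 / 2 = (c' - sin c') * c.
Proof.
have fdf y : is_derive y 1 (fun z : R => cos z + 2^-1 * z ^+ 2) (y - sin y).
  by apply: is_derive_eq; rewrite /GRing.scale /= mulr1; field.
have [c' c'c] := mvt0 fdf c; rewrite cos0 expr0n mulr0 addr0 => E; exists c' => //.
by rewrite -E; ring.
Qed.

(** The same remainder gets a quadratic and a cubic bound: the quadratic one is integrable with two
    moments and serves for large noise, the cubic one gains a small factor for moderate noise. *)
Lemma norm_cosB2_le2 x : `|cos x - 1 + x ^+ 2 / 2| <= 2 * `|x| ^+ 2.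
Proof.
have [c cx ->] := cos2B x; rewrite normrM expr2 mulrA ler_wpM2r //.
apply: le_trans (ler_normB _ _) _; rewrite mulr2n mulrDl mul1r lerD //.
exact: le_trans (norm_sin_le _) cx.
Qed.

Lemma norm_cosB2_le3 x : `|cos x - 1 + x ^+ 2 / 2| <= `|x| ^+ 3.
Proof.
have [c cx ->] := cos2B x; rewrite normrM exprSr ler_wpM2r // -normrN opprB.
by apply: le_trans (norm_sinBid_le2 _) _; rewrite ler_pXn2r.
Qed.

Lemma cos_taylor2 a x : `|cos (a + x) - cos a + x * sin a| <= 2 * `|x| ^+ 2.
Proof.
have -> : cos (a + x) - cos a + x * sin a =
    cos a * (cos x - 1) - sin a * (sin x - x) by rewrite cosD; ring.
apply: le_trans (ler_normB _ _) _; rewrite mulr2n mulrDl !mul1r lerD // normrM.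
  by rewrite (le_trans _ (norm_cosB1_le2 _)) // ler_piMl // cos_max.
by rewrite (le_trans _ (norm_sinBid_le2 _)) // ler_piMl // sin_max.
Qed.

End Trig.

Section Gauss.
Variable R : realType.
Notation mu := (@lebesgue_measure R).
Implicit Types f g : R -> R.

Definition gpdf : R -> R := normal_pdf 0 1.
Definition gint f : R := fine (\int[mu]_x (f x * gpdf x)%:E).
Definition gintegrable f : Prop := mu.-integrable setT (fun x => (f x * gpdf x)%:E).

Lemma gpdf_ge0 x : 0 <= gpdf x. Proof. exact: normal_pdf_ge0. Qed.

Lemma gpdfE x : gpdf x = normal_peak 1 * expR (- (2^-1 * x ^+ 2)).
Proof.
rewrite /gpdf normal_pdfE ?oner_eq0 // /normal_fun; congr (_ * expR _).
by rewrite subr0 expr1n mulNr mulrC.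
Qed.

Lemma gpdf_meas : measurable_fun setT gpdf.
Proof. exact: measurable_normal_pdf. Qed.

Lemma gpdf_le1 x : gpdf x <= 1.
Proof.
apply: le_trans (@normal_pdf_ub R 0 1 x (oner_neq0 _)) _.
rewrite /normal_peak invf_le1; last first.
  by rewrite sqrtr_gt0 expr1n mul1r pmulrn_lgt0 // pi_gt0.
rewrite -[leLHS]sqrtr1 ler_sqrt; last by rewrite expr1n mul1r pmulrn_lge0 // pi_ge0.
rewrite expr1n mul1r; have := @pi_ge2 R; lra.
Qed.

Lemma gintegrable_bounded f (C : R) : measurable_fun setT f ->
  (forall x, `|f x| <= C) -> gintegrable f.
Proof.
move=> mf bf.
have := integrableZl measurableT C (@integrable_normal_pdf R 0 1).
apply: le_integrable => //.
  by apply/measurable_EFinP; apply: measurable_funM => //; exact: gpdf_meas.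
move=> x _; rewrite lee_fin /= normrM (ger0_norm (gpdf_ge0 _)).
apply: le_trans _ (ler_norm _); rewrite ler_wpM2r // ?gpdf_ge0 //.
Qed.

Lemma gintD f g : gintegrable f -> gintegrable g ->
  gint (fun x => f x + g x) = gint f + gint g.
Proof.
move=> hf hg; rewrite /gint -(RintegralD measurableT hf hg) /Rintegral.
by congr fine; apply: eq_integral => x _; rewrite mulrDl.
Qed.

Lemma gintegrableD f g : gintegrable f -> gintegrable g ->
  gintegrable (fun x => f x + g x).
Proof.
move=> hf hg; have := integrableD measurableT hf hg; apply: eq_integrable => // x _.
by rewrite /= mulrDl.
Qed.

Lemma gintegrableZ c f : gintegrable f -> gintegrable (fun x => c * f x).
Proof.
move=> hf; have := integrableZl measurableT c hf; apply: eq_integrable => // x _.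
by rewrite /= -EFinM mulrA.
Qed.

Lemma gintZ c f : gintegrable f -> gint (fun x => c * f x) = c * gint f.
Proof.
move=> hf; rewrite /gint -/(Rintegral mu setT (fun x => f x * gpdf x)).
rewrite -RintegralZl //.
by congr fine; apply: eq_integral => x _; rewrite mulrA.
Qed.

Lemma gint_le f g : gintegrable f -> gintegrable g -> (forall x, f x <= g x) ->
  gint f <= gint g.
Proof.
move=> hf hg fg; apply: (le_Rintegral measurableT hf hg) => x _.
by rewrite ler_wpM2r // gpdf_ge0.
Qed.

Lemma gint_cst (c : R) : gint (fun=> c) = c.
Proof.
have -> : gint (fun=> c) = c * gint (fun=> 1).
  rewrite -gintZ; last by apply: (@gintegrable_bounded _ 1) => // x; rewrite normr1.
  by congr gint; apply/funext => x; rewrite mulr1.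
rewrite -[RHS]mulr1; congr (_ * _); rewrite /gint.
under eq_integral do rewrite mul1r.
by rewrite integral_normal_pdf.
Qed.

Lemma gint_norm f : gintegrable f -> `|gint f| <= gint (fun x => `|f x|).
Proof.
move=> hf; have := le_normr_Rintegral measurableT hf; rewrite /gint /Rintegral /=.
move/le_trans; apply; rewrite le_eqVlt; apply/orP; left; apply/eqP; congr fine.
by apply: eq_integral => x _; rewrite normrM (ger0_norm (gpdf_ge0 _)).
Qed.

Lemma gintegrable_le f g : measurable_fun setT f -> (forall x, `|f x| <= g x) ->
  gintegrable g -> gintegrable f.
Proof.
move=> mf fg; apply: le_integrable => //.
  by apply/measurable_EFinP; apply: measurable_funM => //; exact: gpdf_meas.
move=> x _; rewrite lee_fin /= normrM (ger0_norm (gpdf_ge0 _)).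
apply: le_trans _ (ler_norm _); rewrite ler_wpM2r // ?gpdf_ge0 //.
Qed.

(** With [y = x^2 / 4], [y exp (- y) <= 1] gives [x^2 exp (- x^2 / 2) <= 4 exp (- x^2 / 4)], a
    multiple of the normal density of variance 2. *)
Lemma gintegrable_sqr : gintegrable (fun x => x ^+ 2).
Proof.
pose s := Num.sqrt 2 : R.
have s2 : s ^+ 2 = 2 by rewrite sqr_sqrtr.
have s0 : s != 0 by rewrite gt_eqF // sqrtr_gt0.
have := integrable_normal_pdf (0 : R) s.
move=> /(integrableZl measurableT (4 * (normal_peak s)^-1)).
apply: le_integrable => //.
  apply/measurable_EFinP; apply: measurable_funM => //; last exact: gpdf_meas.
move=> x _; rewrite lee_fin /= ger0_norm; last by apply: mulr_ge0; [exact: sqr_ge0|exact: gpdf_ge0].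
apply: le_trans _ (ler_norm _).
rewrite normal_pdfE // /normal_fun s2 subr0 gpdfE.
have p0 : 0 < normal_peak s by apply: normal_peak_gt0.
rewrite (mulrA (4 / _)) divfK ?gt_eqF //.
have p1 : normal_peak (1 : R) <= 1.
  by have := gpdf_le1 0; rewrite gpdfE expr0n mulr0 oppr0 expR0 mulr1.
set y := x ^+ 2 / 4.
have y0 : 0 <= y by rewrite divr_ge0 // sqr_ge0.
have -> : - (2^-1 * x ^+ 2) = - y + - y by rewrite /y; field.
have -> : - x ^+ 2 / (2 *+ 2) = - y by rewrite /y; field.
have -> : x ^+ 2 = 4 * y by rewrite /y; field.
rewrite expRD.
have ye : y * expR (- y) <= 1.
  by rewrite expRN ler_pdivrMr ?expR_gt0 // mul1r (le_trans _ (expR_ge1Dx _)) // lerDr.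
have e0 := expR_ge0 (- y).
have pp : 0 <= normal_peak (1 : R) by rewrite normal_peak_ge0.
have : normal_peak 1 * (y * expR (- y)) <= 1.
  by rewrite mulr_ile1 // mulr_ge0.
move=> h; have : (normal_peak 1 * (y * expR (- y))) * expR (- y) <= 1 * expR (- y) by rewrite ler_wpM2r.
lra.
Qed.

Definition gvar : R := gint (fun x => x ^+ 2).

Lemma gvar_ge0 : 0 <= gvar.
Proof.
rewrite -(gint_cst 0); apply: gint_le => //; last by move=> x; rewrite sqr_ge0.
  by apply: (@gintegrable_bounded _ 0) => // x; rewrite normr0.
exact: gintegrable_sqr.
Qed.

Lemma is_derive_gpdf x : is_derive x (1 : R) gpdf (- x * gpdf x).
Proof.
have -> : gpdf = fun x => normal_peak 1 * expR (- (2^-1 * x ^+ 2)).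
  by apply/funext => y; exact: gpdfE.
by apply: is_derive_eq; rewrite /GRing.scale /= !mulr1; field.
Qed.

Lemma cos_meas (u b : R) : measurable_fun setT (fun x : R => cos (u * x + b)).
Proof.
apply: measurableT_comp; first by apply: continuous_measurable_fun; exact: continuous_cos.
by apply: measurable_funD => //; exact: measurable_funM.
Qed.

Lemma sin_meas (u b : R) : measurable_fun setT (fun x : R => sin (u * x + b)).
Proof.
apply: measurableT_comp; first by apply: continuous_measurable_fun; exact: continuous_sin.
by apply: measurable_funD => //; exact: measurable_funM.
Qed.

Lemma gintegrable_cos u b : gintegrable (fun x => cos (u * x + b)).
Proof. by apply: (@gintegrable_bounded _ 1); [exact: cos_meas|move=> x; exact: cos_max]. Qed.

Lemma gintegrable_xsin u b : gintegrable (fun x => x * sin (u * x + b)).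
Proof.
apply: (@gintegrable_le _ (fun x => 1 + x ^+ 2)) => //.
- by apply: measurable_funM => //; exact: sin_meas.
- move=> x /=; rewrite normrM; apply: (@le_trans _ _ `|x|); first by rewrite ler_piMr // sin_max.
  have := sqr_ge0 (`|x| - 1); have := sqr_ge0 x.
  have -> : x ^+ 2 = `|x| ^+ 2 by rewrite real_normK // num_real.
  nra.
- by apply: gintegrableD gintegrable_sqr; apply: (@gintegrable_bounded _ 1) => // x; rewrite normr1.
Qed.

Lemma gpdf_le_inv (N : R) : 0 < N -> gpdf N <= N^-1 /\ gpdf (- N) <= N^-1.
Proof.
move=> N0; rewrite !gpdfE sqrrN; suff: normal_peak 1 * expR (- (2^-1 * N ^+ 2)) <= N^-1 by [].
have p1 : normal_peak (1 : R) <= 1.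
  by have := gpdf_le1 0; rewrite gpdfE expr0n mulr0 oppr0 expR0 mulr1.
apply: (@le_trans _ _ (1 * expR (- (2^-1 * N ^+ 2)))); first by rewrite ler_wpM2r ?expR_ge0.
rewrite mul1r expRN lef_pV2 ?posrE ?expR_gt0 //.
apply: le_trans (expR_ge1Dx _); have := sqr_ge0 (N - 1); nra.
Qed.

(** Stein's identity: the derivative [f] of [F = sin (u x + b) gpdf] integrates to 0 over the line,
    because [F] vanishes at both ends. *)
Lemma gint_by_parts u b :
  gint (fun x => x * sin (u * x + b)) = u * gint (fun x => cos (u * x + b)).
Proof.
pose F x := sin (u * x + b) * gpdf x.
pose f x := (u * cos (u * x + b) - x * sin (u * x + b)) * gpdf x.
have dF x : is_derive x (1:R) F (f x).
  have := is_derive_gpdf x => h; rewrite /F.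
  have h2 : is_derive x (1:R) (fun y : R => sin (u * y + b)) (u * cos (u * x + b)).
    apply: is_derive_eq; rewrite /GRing.scale /= ?mulr1 ?addr0 ?mulr0; ring.
  apply: is_derive_eq; rewrite /f /GRing.scale /=; ring.
have cg : continuous gpdf by apply: continuous_normal_pdf; exact: oner_neq0.
have cf : continuous f.
  have c1 : continuous (fun x : R => u * x + b).
    by move=> x; apply: cvgD; [apply: cvgM; [exact: cvg_cst|exact: cvg_id]|exact: cvg_cst].
  have c2 : continuous (fun x : R => cos (u * x + b)).
    by move=> x; apply: (continuous_comp (c1 x)); exact: continuous_cos.
  have c3 : continuous (fun x : R => sin (u * x + b)).
    by move=> x; apply: (continuous_comp (c1 x)); exact: continuous_sin.
  move=> x; apply: cvgM; last exact: cg.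
  apply: cvgB; first by apply: cvgM; [exact: cvg_cst|exact: c2].
  by apply: cvgM; [exact: cvg_id|exact: c3].
have mf : measurable_fun setT f by exact: continuous_measurable_fun.
have if_ : mu.-integrable setT (EFin \o f).
  have := gintegrableD (gintegrableZ u (gintegrable_cos u b))
    (gintegrableZ (-1) (gintegrable_xsin u b)).
  apply: eq_integrable => // x _; rewrite /= /f; congr EFin; ring.
suff E0 : fine (\int[mu]_x (f x)%:E) = 0.
  have E : gint (fun x => u * cos (u * x + b) + -1 * (x * sin (u * x + b))) = 0.
    by rewrite -E0; congr fine; apply: eq_integral => x _; congr EFin; rewrite /f; ring.
  move: E; rewrite gintD ?gintZ; first lra.
  - exact: gintegrable_xsin.
  - exact: gintegrable_cos.
  - exact/gintegrableZ/gintegrable_cos.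
  - exact/gintegrableZ/gintegrable_xsin.
(* The integral over the line is the limit of the integrals over [[-(n+1), n+1]], which the
   fundamental theorem of calculus evaluates. *)
pose g_ (n : nat) := (EFin \o f) \_ (`[- (n.+1%:R : R), n.+1%:R]).
have mg n : measurable_fun setT (g_ n).
  apply: (measurable_restrictT _ _).1 => //; apply/measurable_funTS.
  exact/measurable_EFinP.
have cvgg : {ae mu, forall x, setT x -> g_ ^~ x @ \oo --> (EFin \o f) x}.
  apply: aeW => x _; apply: cvg_near_cst.
  exists (Num.truncn `|x|) => // n /= nx.
  rewrite /g_ patchE mem_set //= in_itv /= -ler_norml.
  apply: le_trans (ltW (truncnS_gt _)) _.
  by rewrite ler_nat ltnS.
have gf : {ae mu, forall x n, setT x -> (`|g_ n x| <= `|(f x)%:E|)%E}.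
  apply: aeW => x n _; rewrite /g_ patchE; case: ifP => // _.
  by rewrite abse0.
have [_ _ cv] := @dominated_convergence _ _ _ mu setT measurableT g_ (EFin \o f) (fun x => `|(f x)%:E|%E)
  mg (proj2 (measurable_EFinP _ _) mf) cvgg (integrable_abse if_) gf.
have {}cv : (fun n => F n.+1%:R - F (- n.+1%:R)) @ \oo --> fine (\int[mu]_x (f x)%:E).
  have {}cv : [sequence (\int[mu]_x g_ n x)%E]_n @ \oo --> (fine (\int[mu]_x (f x)%:E))%:E.
    by rewrite fineK //; exact: integrable_fin_num.
  apply: cvg_trans (fine_cvg cv); apply: near_eq_cvg; near=> n.
  suff E : (\int[mu]_x g_ n x = (F n.+1%:R)%:E - (F (- n.+1%:R))%:E)%E by rewrite /= E.
  rewrite /g_ -integral_mkcond.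
  rewrite (@continuous_FTC2 _ f F) //.
  - by apply: (@lt_trans _ _ 0); rewrite ?oppr_lt0 ltr0Sn.
  - exact: continuous_subspaceT.
  - split.
    + by move=> x _; apply: ex_derive; exact: dF.
    + apply: cvg_at_right_filter; apply: differentiable_continuous.
      by apply/derivable1_diffP; apply: ex_derive; exact: dF.
    + apply: cvg_at_left_filter; apply: differentiable_continuous.
      by apply/derivable1_diffP; apply: ex_derive; exact: dF.
  - by move=> x _; rewrite derive1E; apply: (@derive_val _ _ _ _ _ _ _ (dF x)).
apply: (@cvg_unique _ _ _ _ _ _ cv) => //.
apply/norm_cvg0P.
have ch : (fun n => (2 : R) * harmonic n) @ \oo --> (0 : R).
  by rewrite -[X in _ --> X](mulr0 (2 : R)); apply: cvgM; [exact: cvg_cst|exact: cvg_harmonic].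
have c0 : (fun n : nat => (0 : R)) @ \oo --> (0 : R) by exact: cvg_cst.
apply: (squeeze_cvgr _ c0 ch).
near=> n; rewrite normr_ge0 /=.
have [h1 h2] := gpdf_le_inv (ltr0Sn R n).
apply: le_trans (ler_normB _ _) _; rewrite /harmonic /= mulr2n mulrDl !mul1r lerD // /F normrM (ger0_norm (gpdf_ge0 _)).
  by apply: le_trans h1; rewrite ler_piMl ?gpdf_ge0 // sin_max.
by apply: le_trans h2; rewrite ler_piMl ?gpdf_ge0 // sin_max.
Unshelve. all: by end_near.
Qed.

(** The difference quotient differs from [- S], the integral of the derivative, by at most
    [2 gvar |t|] thanks to the pointwise Taylor bound; Stein's identity then rewrites [S]. *)
Lemma gint_cos_derive (b u : R) :
  is_derive u (1:R) (fun u => gint (fun x => cos (u * x + b))) (- u * gint (fun x => cos (u * x + b))).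
Proof.
set psi := fun u => _; set S := gint (fun x => x * sin (u * x + b)).
have -> : - u * psi u = - S by rewrite /S gint_by_parts mulNr.
have taylor t : `|psi (u + t) - psi u + t * S| <= 2 * gvar * t ^+ 2.
  have -> : psi (u + t) - psi u + t * S =
    gint (fun x => cos ((u + t) * x + b) + -1 * cos (u * x + b) + t * (x * sin (u * x + b))).
    rewrite !gintD ?gintZ ?mulN1r //; do ?exact: gintegrable_cos; do ?exact: gintegrable_xsin.
    - exact/gintegrableZ/gintegrable_cos.
    - by apply: gintegrableD; [|apply: gintegrableZ]; exact: gintegrable_cos.
    - exact/gintegrableZ/gintegrable_xsin.
  have hI : gintegrable (fun x => cos ((u + t) * x + b) + -1 * cos (u * x + b) + t * (x * sin (u * x + b))).
    apply: gintegrableD; last exact/gintegrableZ/gintegrable_xsin.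
    by apply: gintegrableD; [|apply: gintegrableZ]; exact: gintegrable_cos.
  apply: le_trans (gint_norm hI) _.
  have -> : 2 * gvar * t ^+ 2 = gint (fun x => 2 * t ^+ 2 * x ^+ 2).
    by rewrite gintZ; [rewrite /gvar; ring|exact: gintegrable_sqr].
  have pw x : `|cos ((u + t) * x + b) + -1 * cos (u * x + b) + t * (x * sin (u * x + b))| <= 2 * t ^+ 2 * x ^+ 2.
    have := cos_taylor2 (u * x + b) (t * x).
    rewrite real_normK ?num_real //.
    have -> : u * x + b + t * x = (u + t) * x + b by ring.
    by rewrite mulN1r exprMn !mulrA.
  apply: gint_le => //; last exact/gintegrableZ/gintegrable_sqr.
  apply: (@gintegrable_le _ (fun x => 2 * t ^+ 2 * x ^+ 2)) (gintegrableZ _ gintegrable_sqr).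
    apply: measurableT_comp => //; apply: measurable_funD; last first.
      by do 2 apply: measurable_funM => //; exact: sin_meas.
    apply: measurable_funD; first exact: cos_meas.
    by apply: measurable_funM => //; exact: cos_meas.
  by move=> x; rewrite normr_id.
have key : (fun h : R => h^-1 *: ((psi \o shift u) (h *: (1:R)) - psi u)) @ (0 : R)^' --> - S.
  apply/cvgrPdist_le => /= eps eps0.
  have d0 : 0 < eps / (2 * gvar + 1) by rewrite divr_gt0 // ltr_wpDl // mulr_ge0 // gvar_ge0.
  near=> t.
  have t0 : t != 0 by near: t; exact: nbhs_dnbhs_neq.
  have tl : `|t| < eps / (2 * gvar + 1).
    near: t; apply: dnbhs0_lt => //.
  rewrite /= /GRing.scale /= mulr1.
  have -> : - S - t^-1 * (psi (t + u) - psi u) = - t^-1 * (psi (u + t) - psi u + t * S).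
    by rewrite (addrC t u); field.
  rewrite normrM normrN normfV.
  rewrite mulrC ler_pdivrMr ?normr_gt0 //.
  apply: le_trans (taylor t) _.
  have -> : t ^+ 2 = `|t| * `|t| by rewrite -expr2 real_normK // num_real.
  rewrite mulrA ler_wpM2r //.
  have := gvar_ge0 => g0.
  have : `|t| * (2 * gvar + 1) <= eps.
    by rewrite -ler_pdivlMr ?ltW // ltr_wpDl // mulr_ge0.
  have := normr_ge0 t; nra.
apply: DeriveDef.
  by apply/cvg_ex; exists (- S); exact: key.
by apply/cvg_lim => //; exact: key.
Unshelve. all: by end_near.
Qed.

(** By the differential equation just proved, [exp (u^2 / 2)] times the integral has derivative 0,
    and it equals [cos b] at [u = 0]. The phase [b] makes one real formula do the work of the
    complex characteristic function. *)
Lemma gint_cos u b : gint (fun x => cos (u * x + b)) = expR (- (2^-1 * u ^+ 2)) * cos b.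
Proof.
pose psi u := gint (fun x => cos (u * x + b)).
pose q u := expR (2^-1 * u ^+ 2) * psi u.
have dq v : is_derive v (1:R) q 0.
  rewrite /q; have h := gint_cos_derive b v; rewrite -/(psi) in h.
  have h' : is_derive v (1:R) (fun u : R => expR (2^-1 * u ^+ 2)) (v * expR (2^-1 * v ^+ 2)).
    by apply: is_derive_eq; rewrite /GRing.scale /= !mulr1; field.
  apply: (is_derive_eq (is_deriveM h' h)); rewrite /GRing.scale /= -/(psi v); ring.
have := is_derive_0_is_cst u 0 dq.
rewrite /q expr0n mulr0 expR0 mul1r.
have -> : psi 0 = cos b.
  rewrite /psi -[RHS]gint_cst; congr gint; apply/funext => x; by rewrite mul0r add0r.
move=> <-; rewrite mulrA -expRD addNr expR0 mul1r //.
Qed.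

Lemma PhiE s : Phi s = gint (\1_(`]-oo, s])).
Proof.
rewrite /Phi /normal_prob /gint integral_mkcond; congr fine; apply: eq_integral => x _.
rewrite patchE indicE; case: ifP => _; first by rewrite mul1r.
by rewrite mul0r.
Qed.

Lemma gintegrable_indic (A : set R) : measurable A -> gintegrable (\1_A).
Proof.
move=> mA; apply: (@gintegrable_bounded _ 1); first exact: measurable_indic.
by move=> x; rewrite indicE; case: (_ \in _); rewrite ?normr1 ?normr0.
Qed.

Lemma Phi_ge0 s : 0 <= Phi s :> R.
Proof.
rewrite PhiE -(gint_cst 0); apply: gint_le.
- by apply: (@gintegrable_bounded _ 0) => // x; rewrite normr0.
- exact: gintegrable_indic.
- by move=> x; rewrite indicE ler0n.
Qed.

Lemma Phi_le1 s : Phi s <= 1 :> R.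
Proof.
rewrite PhiE -[leRHS](gint_cst 1); apply: gint_le.
- exact: gintegrable_indic.
- by apply: (@gintegrable_bounded _ 1) => // x; rewrite normr1.
- by move=> x; rewrite indicE lern1; case: (_ \in _).
Qed.

Lemma mu_itv (a b : R) : a <= b -> mu `]a, b]%classic = (b - a)%:E.
Proof.
move=> ab; rewrite lebesgue_measure_itv /= lte_fin.
by case: ltgtP ab => //= -> _; rewrite subrr.
Qed.

Lemma gint_indic_le (a b : R) : a <= b -> gint (\1_(`]a, b])) <= b - a.
Proof.
move=> ab; rewrite /gint.
have -> : (\int[mu]_x (\1_(`]a, b]) x * gpdf x)%:E)%E = (\int[mu]_(x in `]a, b]) (gpdf x)%:E)%E.
  rewrite [RHS]integral_mkcond; apply: eq_integral => x _.
  by rewrite patchE indicE; case: ifP => _; rewrite ?mul1r ?mul0r.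
have -> : b - a = fine (\int[mu]_(x in `]a, b]) (cst 1%:E x))%E.
  by rewrite integral_cst // mul1e [X in fine X](_ : _ = (b - a)%:E) // -mu_itv.
apply: (@le_Rintegral _ _ _ mu) => //.
- apply: (@integrableS _ _ _ _ setT) => //; exact: integrable_normal_pdf.
- apply/integrableP; split; first exact: measurable_cst.
  rewrite (eq_integral (cst 1%:E)); last by move=> x _ /=; rewrite normr1.
  rewrite integral_cst // mul1e [ltLHS](_ : _ = (b - a)%:E) ?ltry //.
  by rewrite -mu_itv.
- by move=> x _; exact: gpdf_le1.
Qed.

Lemma Phi_lip s t : s <= t -> Phi t - Phi s <= t - s :> R.
Proof.
move=> st; rewrite !PhiE; apply: le_trans (gint_indic_le st).
rewrite lerBlDr -gintD; do ?exact: gintegrable_indic.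
apply: gint_le; do ?exact: gintegrable_indic; first by apply: gintegrableD; exact: gintegrable_indic.
move=> x; rewrite !indicE !mem_setE !in_itv /=.
by have [xs|xs] := leP x s; have [xt|xt] := leP x t => //=; rewrite ?addr0 ?add0r ?lexx ?ler01.
Qed.

Lemma gint_tail (N : R) : 0 < N -> gint (\1_([set x | N < `|x|])) <= gvar / N ^+ 2.
Proof.
move=> N0.
have mA : measurable [set x : R | N < `|x|].
  have := measurable_fun_ltr (measurable_cst N) (@normr_measurable R setT).
  by move=> /(_ measurableT [set true] I); rewrite setTI.
have N20 : 0 < N ^+ 2 by rewrite exprn_gt0.
rewrite ler_pdivlMr // mulrC -gintZ; last exact: gintegrable_indic.
apply: gint_le; [exact/gintegrableZ/gintegrable_indic|exact: gintegrable_sqr|].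
move=> x; rewrite indicE; case: (boolP (x \in _)) => [/set_mem /= Nx|_]; last first.
  by rewrite mulr0 sqr_ge0.
rewrite mulr1 -[leRHS]real_normK ?num_real // !expr2.
by apply: ler_pM => //; apply: ltW.
Qed.

End Gauss.

(** * Trigonometric approximation of orthants *)

Section TrigSums.
Variable R : realType.
Implicit Types (l : seq (R * R * R)) (x a b c : R).

(** A triple [(c, a, b)] encodes [c cos (a x + b)]. Free phases absorb the sines, so the class is
    closed under products by the product-to-sum formula alone. *)
Definition trigsum l x : R := \sum_(t <- l) t.1.1 * cos (t.1.2 * x + t.2).
Definition is_trigsum (f : R -> R) := exists l, forall x, f x = trigsum l x.

Lemma is_trigsum_cos c a b : is_trigsum (fun x => c * cos (a * x + b)).
Proof. by exists [:: (c, a, b)] => x; rewrite /trigsum big_seq1. Qed.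

Lemma is_trigsum_ext f g : f =1 g -> is_trigsum f -> is_trigsum g.
Proof. by move=> fg [l lE]; exists l => x; rewrite -fg. Qed.

Lemma is_trigsum_cst c : is_trigsum (fun=> c).
Proof.
apply: is_trigsum_ext (is_trigsum_cos c 0 0) => x.
by rewrite mul0r addr0 cos0 mulr1.
Qed.

Lemma is_trigsumD f g : is_trigsum f -> is_trigsum g -> is_trigsum (fun x => f x + g x).
Proof.
by move=> [l lE] [k kE]; exists (l ++ k) => x; rewrite lE kE /trigsum big_cat.
Qed.

Lemma is_trigsum_sum (I : Type) (s : seq I) (F : I -> R -> R) :
  (forall i, is_trigsum (F i)) -> is_trigsum (fun x => \sum_(i <- s) F i x).
Proof.
move=> hF; elim: s => [|i s IH].
  by apply: is_trigsum_ext (is_trigsum_cst 0) => x; rewrite big_nil.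
apply: is_trigsum_ext (is_trigsumD (hF i) IH) => x.
by rewrite big_cons.
Qed.

Lemma cosMcos (x y : R) : cos x * cos y = 2^-1 * cos (x + y) + 2^-1 * cos (x - y).
Proof. by rewrite cosD cosB; field. Qed.

Lemma is_trigsumM f g : is_trigsum f -> is_trigsum g -> is_trigsum (fun x => f x * g x).
Proof.
move=> [l lE] [k kE].
pose F (t s : R * R * R) x := (t.1.1 * cos (t.1.2 * x + t.2)) * (s.1.1 * cos (s.1.2 * x + s.2)).
apply: (@is_trigsum_ext (fun x => \sum_(t <- l) \sum_(s <- k) F t s x)) => [x|].
  by rewrite lE kE /trigsum mulr_suml; apply: eq_bigr => t _; rewrite mulr_sumr.
apply: is_trigsum_sum => t; apply: is_trigsum_sum => s.
apply: is_trigsum_ext (is_trigsumD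
  (is_trigsum_cos (t.1.1 * s.1.1 / 2) (t.1.2 + s.1.2) (t.2 + s.2))
  (is_trigsum_cos (t.1.1 * s.1.1 / 2) (t.1.2 - s.1.2) (t.2 - s.2))) => x.
rewrite /F mulrACA cosMcos.
have -> : (t.1.2 + s.1.2) * x + (t.2 + s.2) = t.1.2 * x + t.2 + (s.1.2 * x + s.2) by ring.
have -> : (t.1.2 - s.1.2) * x + (t.2 - s.2) = t.1.2 * x + t.2 - (s.1.2 * x + s.2) by ring.
by ring.
Qed.

Lemma is_trigsumX f n : is_trigsum f -> is_trigsum (fun x => f x ^+ n).
Proof.
move=> hf; elim: n => [|n IH].
  by apply: is_trigsum_ext (is_trigsum_cst 1) => x; rewrite expr0.
by apply: is_trigsum_ext (is_trigsumM hf IH) => x; rewrite exprS.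
Qed.

Lemma bernoulli_ineq (x : R) n : -1 <= x -> 1 + n%:R * x <= (1 + x) ^+ n.
Proof.
move=> x1; elim: n => [|n IH]; first by rewrite mul0r addr0 expr0.
rewrite exprS; apply: (@le_trans _ _ ((1 + x) * (1 + n%:R * x))); last first.
  by rewrite ler_wpM2l //; lra.
rewrite -natr1; have := sqr_ge0 x; have : (0 : R) <= n%:R by []; nra.
Qed.

(* The Brosowski--Deutsch polynomials (1 - y^n)^(2^n) approximate the step at y = 1/2. *)
Lemma step_poly_le (y : R) n : 1 / 2 <= y -> y <= 1 ->
  (1 - y ^+ n) ^+ (2 ^ n) * (2 * y) ^+ n <= 1.
Proof.
move=> y12 y1; set z := y ^+ n; set m := (2 ^ n)%N.
have y0 : 0 <= y by lra.
have z0 : 0 <= z by rewrite exprn_ge0.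
have z1 : z <= 1 by rewrite exprn_ile1.
have -> : (2 * y) ^+ n = m%:R * z by rewrite exprMn natrX.
(* Bernoulli gives [m z <= (1 + z)^m], and [(1 - z)(1 + z) <= 1]. *)
apply: (@le_trans _ _ ((1 - z) ^+ m * (1 + z) ^+ m)).
  rewrite ler_wpM2l ?exprn_ge0 ?subr_ge0 //.
  by apply: le_trans (bernoulli_ineq m _); [rewrite lerDr|lra].
rewrite -exprMn; apply: exprn_ile1; nra.
Qed.

Lemma step_poly_ge (y : R) n : 0 <= y -> y <= 1 / 2 ->
  1 - (2 * y) ^+ n <= (1 - y ^+ n) ^+ (2 ^ n).
Proof.
move=> y0 y12.
have z1 : y ^+ n <= 1 by rewrite exprn_ile1 //; lra.
have := @bernoulli_ineq (- y ^+ n) (2 ^ n) _.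
rewrite mulrN natrX -exprMn; apply; lra.
Qed.

(** The argument [y = (1 + sin (a x)) / 2] of the step polynomial has [a N = pi / 2]: the sine is
    then increasing on [[-N, N]], so [y] crosses 1/2 only at 0, and by [s0 / 2] at least once
    [|x| >= delta]. *)
Lemma step_trigsum (N delta eta : R) : 0 < delta -> delta <= N -> 0 < eta ->
  exists2 f, is_trigsum f &
    [/\ forall x, 0 <= f x <= 1,
        forall x, - N <= x <= - delta -> 1 - eta <= f x &
        forall x, delta <= x <= N -> f x <= eta].
Proof.
move=> d0 dN eta0; have N0 : 0 < N by apply: lt_le_trans dN.
pose a := pi / (2 * N) : R.
have pi0 := @pi_gt0 R.
have a0 : 0 < a by rewrite divr_gt0 // mulr_gt0.
have aN : a * N = pi / 2 by rewrite /a; field; rewrite gt_eqF.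
pose s0 := sin (a * delta).
have ad : a * delta <= pi / 2 by rewrite -aN ler_wpM2l // ltW.
have ad0 : 0 < a * delta by rewrite mulr_gt0.
have s0_gt0 : 0 < s0.
  by rewrite /s0 -[X in X < _]sin0 ltr_sin // in_itv /=; apply/andP; split; lra.
have s0_le1 : s0 <= 1 by exact: sin_le1.
have sin_ge x : delta <= x <= N -> s0 <= sin (a * x).
  move=> /andP[dx xN]; rewrite /s0; have: a * delta <= a * x by rewrite ler_wpM2l // ltW.
  have : a * x <= a * N by rewrite ler_wpM2l // ltW.
  rewrite aN => h1; rewrite le_eqVlt => /predU1P[->//|h2].
  by apply/ltW; rewrite ltr_sin // in_itv /=; apply/andP; split; lra.
(* Bernoulli's inequality [(1 + s0)^n >= 1 + n s0] shows that [n >= 1 / (eta s0)] suffices. *)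
have [n nP] : exists n : nat, (1 + s0) ^- n <= eta.
  exists (Num.truncn (eta * s0)^-1).+1; set n := _.+1.
  have nl : (eta * s0)^-1 <= n%:R by apply/ltW/truncnS_gt.
  have n1 : 1 <= n%:R * s0 * eta.
    have : (eta * s0)^-1 * (eta * s0) <= n%:R * (eta * s0) by rewrite ler_wpM2r // mulr_ge0 // ltW.
    by rewrite mulVf ?gt_eqF ?mulr_gt0 // => h; lra.
  have := @bernoulli_ineq s0 n; move=> /(_ _)/wrap[]; first lra.
  move=> hb; rewrite -[leLHS]mul1r ler_pdivrMr ?exprn_gt0 //; last lra.
  have : eta * (1 + n%:R * s0) <= eta * (1 + s0) ^+ n by rewrite ler_wpM2l // ltW.
  lra.
pose y x := (1 + sin (a * x)) / 2.
have y01 x : 0 <= y x <= 1.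
  by rewrite /y; have := sin_geN1 (a * x); have := sin_le1 (a * x) => *; apply/andP; split; lra.
exists (fun x => (1 - y x ^+ n) ^+ (2 ^ n)).
  apply: is_trigsumX.
  apply: (@is_trigsum_ext (fun x => 1 + (-1) * y x ^+ n)) => [x|]; first by rewrite mulN1r.
  apply: is_trigsumD; first exact: is_trigsum_cst.
  apply: is_trigsumM; first exact: is_trigsum_cst.
  apply: is_trigsumX.
  apply: (@is_trigsum_ext (fun x => 2^-1 + 2^-1 * cos (a * x + - (pi / 2)))) => [x|].
    by rewrite /y cosB cos_pihalf sin_pihalf; field.
  by apply: is_trigsumD; [exact: is_trigsum_cst|exact: is_trigsum_cos].
split=> x.
- have /andP[y0 y1] := y01 x; have z1 : y x ^+ n <= 1 by rewrite exprn_ile1.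
  by rewrite exprn_ge0 ?subr_ge0 //= exprn_ile1 ?subr_ge0 // gerBl exprn_ge0.
- move=> /andP[Nx xd]; have := sin_ge (- x); rewrite mulrN sinN => /(_ _)/wrap[].
    by apply/andP; split; lra.
  move=> sx; have /andP[y0 y1] := y01 x.
  apply: le_trans (step_poly_ge n y0 _); last by rewrite /y; lra.
  rewrite lerD2l lerN2; apply: le_trans nP.
  rewrite -exprVn lerXn2r ?nnegrE //; first lra.
    by rewrite invr_ge0; lra.
  rewrite -[leRHS]mul1r ler_pdivlMr; last lra.
  have : 2 * y x <= 1 - s0 by rewrite /y; lra.
  have : 0 <= 2 * y x by lra.
  nra.
- move=> /sin_ge sx; have /andP[y0 y1] := y01 x.
  have yh : 1 / 2 <= y x by rewrite /y; lra.
  have := step_poly_le n yh y1 => h.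
  apply: le_trans nP; rewrite -[leRHS]mul1r ler_pdivlMr; last by rewrite exprn_gt0 //; lra.
  apply: le_trans h; rewrite ler_wpM2l //.
    by rewrite exprn_ge0 // subr_ge0 exprn_ile1.
  by rewrite lerXn2r ?nnegrE //; rewrite /y; lra.
Qed.

End TrigSums.

Section MultiTrig.
Variables (R : realType) (p : nat).
Implicit Types (L : seq (R * 'rV[R]_p * R)) (x r : 'I_p -> R).

Definition msum L x : R := \sum_(t <- L) t.1.1 * cos (\sum_i t.1.2 0 i * x i + t.2).
(** The expectation of [msum L] under the standard Gaussian law on [R^p]. *)
Definition mgauss L : R :=
  \sum_(t <- L) t.1.1 * (expR (- (2^-1 * \sum_i t.1.2 0 i ^+ 2)) * cos t.2).

Lemma trigsum_meas l : measurable_fun setT (trigsum l : R -> R).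
Proof.
apply: measurable_fun_bigsum => t; apply: measurable_funM => //.
exact: cos_meas.
Qed.

Lemma gint_trigsum (l : seq (R * R * R)) (r : R) :
  gint (fun x : R => trigsum l (x - r)) =
  \sum_(t <- l) t.1.1 * (expR (- (2^-1 * t.1.2 ^+ 2)) * cos (t.2 - t.1.2 * r)).
Proof.
have E (x : R) : trigsum l (x - r) = trigsum [seq (t.1, t.2 - t.1.2 * r) | t <- l] x.
  rewrite /trigsum big_map; apply: eq_bigr => t _ /=; congr (_ * cos _); ring.
under [X in gint X]eq_fun do rewrite E.
rewrite -(big_map (fun t => (t.1, t.2 - t.1.2 * r)) xpredT
  (fun t => t.1.1 * (expR (- (2^-1 * t.1.2 ^+ 2)) * cos t.2))).
elim: [seq _ | _ <- l] => [|t k IH].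
  rewrite big_nil -[RHS](gint_cst (0 : R)); congr gint; apply/funext => x.
  by rewrite /trigsum big_nil.
rewrite big_cons -IH -gint_cos -gintZ; last exact: gintegrable_cos.
rewrite -gintD; first by congr gint; apply/funext => x; rewrite /trigsum big_cons.
  exact/gintegrableZ/gintegrable_cos.
apply: (@gintegrable_bounded _ _ (\sum_(s <- k) `|s.1.1|)); first exact: trigsum_meas.
move=> x; apply: le_trans (ler_norm_sum _ _ _) _; apply: ler_sum => s _.
by rewrite normrM ler_piMr // cos_max.
Qed.

Let sumD_delta (u : 'rV[R]_p) (a : R) (j : 'I_p) x :
  \sum_i (u + a *: delta_mx 0 j) 0 i * x i = \sum_i u 0 i * x i + a * x j.
Proof.
transitivity (\sum_i u 0 i * x i + \sum_i (if i == j then a * x i else 0)).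
  rewrite -big_split; apply: eq_bigr => i _; rewrite !mxE eqxx /= mulrDl.
  by case: eqP => _; rewrite /= ?mulr1 ?mulr0 ?mul0r.
by rewrite -big_mkcond /= big_pred1_eq.
Qed.

Let sum_sqr_delta (u : 'rV[R]_p) (a : R) (j : 'I_p) : u 0 j = 0 ->
  \sum_i (u + a *: delta_mx 0 j) 0 i ^+ 2 = \sum_i u 0 i ^+ 2 + a ^+ 2.
Proof.
move=> uj; transitivity (\sum_i u 0 i ^+ 2 + \sum_i (if i == j then a ^+ 2 else 0)).
  rewrite -big_split; apply: eq_bigr => i _; rewrite !mxE eqxx /=.
  by case: eqP => [->|_]; rewrite /= ?uj ?mulr1 ?mulr0 ?addr0 // expr0n !add0r.
by rewrite -big_mkcond /= big_pred1_eq.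
Qed.

Let sum_norm_delta (u : 'rV[R]_p) (a : R) (j : 'I_p) :
  \sum_i `|(u + a *: delta_mx 0 j) 0 i| <= \sum_i `|u 0 i| + `|a|.
Proof.
apply: (@le_trans _ _ (\sum_i `|u 0 i| + \sum_i (if i == j then `|a| else 0))).
  rewrite -big_split; apply: ler_sum => i _; rewrite !mxE eqxx /=.
  apply: le_trans (ler_normD _ _) _; rewrite lerD2l.
  by case: eqP => _; rewrite /= ?mulr1 ?mulr0 ?normr0.
by rewrite -big_mkcond /= big_pred1_eq.
Qed.

(** Coordinates are multiplied in one at a time by product-to-sum. The bounds on total coefficient
    and frequency involve only [l] and the number of factors, not the shifts [r]: this makes the
    later approximation uniform over orthants. *)
Lemma prod_trigsum (l : seq (R * R * R)) (s : seq 'I_p) r : uniq s ->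
  exists L, [/\ forall x, \prod_(i <- s) trigsum l (x i - r i) = msum L x,
     \prod_(i <- s) gint (fun y => trigsum l (y - r i)) = mgauss L,
     \sum_(t <- L) `|t.1.1| <= (\sum_(t <- l) `|t.1.1|) ^+ size s &
     forall t, t \in L -> \sum_i `|t.1.2 0 i| <= (size s)%:R * (\sum_(t <- l) `|t.1.2|)
        /\ forall i, i \notin s -> t.1.2 0 i = 0].
Proof.
elim: s => [_|j s IH /= /andP[js us]].
  exists [:: (1, 0, 0)]; split=> [x||/=|t].
  - rewrite big_nil /msum big_seq1 /= mul1r big1 ?add0r ?cos0 // => i _.
    by rewrite mxE mul0r.
  - rewrite big_nil /mgauss big_seq1 /= mul1r cos0 mulr1 big1 ?mulr0 ?oppr0 ?expR0 //.
    by move=> i _; rewrite mxE expr0n.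
  - by rewrite big_seq1 /= normr1 expr0.
  - rewrite inE => /eqP -> /=; split=> [|i _]; last by rewrite mxE.
    by rewrite mul0r big1 // => i _; rewrite mxE normr0.
have [L [LE LG Lc Lu]] := IH us.
(* The two cosines of the product-to-sum formula, [sg] being the sign with which the new frequency
   and phase enter. *)
pose G (sg : R) (t0 : R * R * R) (t : R * 'rV[R]_p * R) : R * 'rV[R]_p * R :=
  (t0.1.1 * t.1.1 / 2, t.1.2 + (sg * t0.1.2) *: delta_mx 0 j,
   t.2 + sg * (t0.2 - t0.1.2 * r j)).
exists ([seq G 1 t0 t | t0 <- l, t <- L] ++ [seq G (-1) t0 t | t0 <- l, t <- L]); split.
- move=> x; rewrite big_cons LE /msum big_cat !big_allpairs_dep /= -big_split /= mulr_suml.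
  apply: eq_bigr => t0 _; rewrite -big_split mulr_sumr; apply: eq_bigr => t _ /=.
  rewrite !sumD_delta mulrACA mulrC (mulrC (cos _)) cosMcos.
  set S := \sum_i _; set b0 := t0.2; set a := t0.1.2.
  have -> : S + 1 * a * x j + (t.2 + 1 * (b0 - a * r j)) =
    S + t.2 + (a * (x j - r j) + b0) by ring.
  have -> : S + -1 * a * x j + (t.2 + -1 * (b0 - a * r j)) =
    S + t.2 - (a * (x j - r j) + b0) by ring.
  by ring.
- rewrite big_cons LG gint_trigsum /mgauss big_cat !big_allpairs_dep /= -big_split /= mulr_suml.
  apply: eq_bigr => t0 _; rewrite -big_split mulr_sumr /= big_seq [RHS]big_seq.
  (* The coordinate [j] is absent from the earlier frequencies, so squared norms add and the
     Gaussian factor splits; the sines cancel between the two signs. *)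
  apply: eq_bigr => t tL /=; have [_ /(_ j js) tj] := Lu t tL.
  rewrite !sum_sqr_delta // !exprMn sqrrN expr1n mul1r.
  set b := t0.2 - _; set E2 := \sum_i _; set a2 := _ ^+ 2.
  have -> : - (2^-1 * (E2 + a2)) = - (2^-1 * a2) + - (2^-1 * E2) by ring.
  have -> : cos (t.2 + 1 * b) = cos t.2 * cos b - sin t.2 * sin b by rewrite mul1r cosD.
  have -> : cos (t.2 + -1 * b) = cos t.2 * cos b + sin t.2 * sin b by rewrite mulN1r cosB.
  by rewrite expRD; field.
- rewrite big_cat !big_allpairs_dep /= -big_split /= exprS.
  apply: (@le_trans _ _ ((\sum_(t <- l) `|t.1.1|) * (\sum_(t <- L) `|t.1.1|))).
    rewrite mulr_suml; apply: ler_sum => t0 _; rewrite -big_split mulr_sumr /=.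
    apply: ler_sum => t _; rewrite !normrM normfV (@ger0_norm _ 2) //.
    lra.
  by rewrite ler_wpM2l // sumr_ge0.
- move=> t; rewrite mem_cat => tL.
  have [sg [t0 [t1 [t0l t1L nsg ->]]]] : exists sg t0 t1, [/\ t0 \in l, t1 \in L, `|sg| = 1 & t = G sg t0 t1].
    case/orP : tL => /allpairsP[[t0 t1] /= [h0 h1 ->]].
      by exists 1, t0, t1; split=> //; rewrite normr1.
    by exists (-1), t0, t1; split=> //; rewrite normrN normr1.
  have [h1 h2] := Lu t1 t1L; split => [|i].
    apply: le_trans (sum_norm_delta _ _ _) _; rewrite normrM nsg mul1r.
    rewrite -natr1 mulrDl mul1r lerD // (big_rem t0) //= lerDl sumr_ge0 //.
  rewrite inE negb_or => /andP[ij iS]; rewrite /= !mxE (negbTE ij) andbF mulr0 addr0.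
  exact: h2.
Qed.

End MultiTrig.

(** * A martingale central limit theorem *)

(** Factors are replaced one by one; as the others stay in [[0, 1]], no error is amplified. *)
Lemma prod_le_add (R : realType) (I : Type) (s : seq I) (a b : I -> R) (kap : R) : 0 <= kap ->
  (forall i, 0 <= a i <= 1) -> (forall i, 0 <= b i <= 1) ->
  (forall i, a i <= b i + kap) ->
  \prod_(i <- s) a i <= \prod_(i <- s) b i + (size s)%:R * kap.
Proof.
move=> k0 a01 b01 ab; elim: s => [|i s IH]; first by rewrite !big_nil mul0r addr0.
rewrite !big_cons /= -natr1 mulrDl mul1r.
have /andP[a0 a1] := a01 i; have /andP[b0 b1] := b01 i; have abi := ab i.
have pa0 : 0 <= \prod_(i <- s) a i by apply: prodr_ge0 => j _; have /andP[] := a01 j.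
have pa1 : \prod_(i <- s) a i <= 1 by apply: prodr_ile1 => j _; exact: a01.
have sk : 0 <= (size s)%:R * kap by rewrite mulr_ge0.
set pa := \prod_(i <- s) a i in pa0 pa1 IH *; set pb := \prod_(i <- s) b i in IH *.
set K := _ * kap in sk IH *.
nra.
Qed.

Lemma size_index_ord p : size (index_enum 'I_p) = p.
Proof. by rewrite -sum1_size big_const_ord iter_addn_0 mul1n. Qed.

Section StepFunction.
Variables (R : realType) (N ep : R) (f : R -> R).
Hypotheses (N1 : 1 <= N) (ep0 : 0 < ep) (ep1 : ep <= 1).
Hypothesis mf : measurable_fun setT f.
Hypothesis f01 : forall x, 0 <= f x <= 1.
Hypothesis fm : forall x, - (2 * N + 3) <= x <= - ep -> 1 - ep <= f x.
Hypothesis fp : forall x, ep <= x <= 2 * N + 3 -> f x <= ep.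

(* The smoothed steps are only controlled on a bounded window, hence the clipped thresholds. *)
Definition clip (s : R) : R := Num.max (- (N + 2)) (Num.min (N + 2) s).

Lemma clip_bound s : - (N + 2) <= clip s <= N + 2.
Proof.
apply/andP; split; first by rewrite le_max lexx.
by rewrite ge_max ge_min lexx /= andbT; move: N1; lra.
Qed.

Lemma clip_ge s x : x <= s -> `|x| <= N -> x <= clip s.
Proof.
rewrite ler_norml => xs /andP[xN1 xN2]; rewrite /clip le_max; apply/orP; right.
by rewrite le_min xs andbT; lra.
Qed.

Lemma clip_le s x : s < x -> `|x| <= N -> clip s <= x.
Proof.
rewrite ler_norml => sx /andP[xN1 xN2]; rewrite /clip ge_max ge_min.
by rewrite (ltW sx) orbT andbT; lra.
Qed.

(** For a point of the window beyond the threshold the only possible clipping is upward, to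
    [-(N + 2)], which still leaves a distance of at least 2. *)
Lemma clip_left s x : s < x -> `|x| <= N -> clip s = s \/ clip s = - (N + 2).
Proof.
rewrite ler_norml => sx /andP[xN1 xN2]; rewrite /clip min_r; last lra.
by have [sN|sN] := leP (- (N + 2)) s; [left|right].
Qed.

Lemma clip_right s x : x <= s -> `|x| <= N -> clip s = s \/ clip s = N + 2.
Proof.
rewrite ler_norml => xs /andP[xN1 xN2]; rewrite /clip max_r.
  by have [sN|sN] := leP (N + 2) s; [right|left].
by rewrite le_min; apply/andP; split; lra.
Qed.

Lemma step_up p (x s : 'I_p -> R) : (forall i, x i <= s i) -> (forall i, `|x i| <= N) ->
  1 <= \prod_i f (x i - (clip (s i) + ep)) + p%:R * ep.
Proof.
move=> xs xN.
have := @prod_le_add R _ (index_enum 'I_p) (fun=> 1) (fun i => f (x i - (clip (s i) + ep))) ep (ltW ep0).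
rewrite size_index_ord big1 // => h; apply: h => i; rewrite ?lexx ?ler01 //.
(* The window [2 N + 3] is [N] for the point, [N + 2] for the clipped threshold and 1 for the shift
   by [ep]. *)
rewrite -lerBlDr; apply: fm.
have := clip_ge (xs i) (xN i); have := xN i; rewrite ler_norml => /andP[a1 a2].
by have /andP[b1 b2] := clip_bound (s i) => b3; move: N1 ep0 ep1 => *; apply/andP; split; lra.
Qed.

Lemma step_low p (x s : 'I_p -> R) i : s i < x i -> `|x i| <= N ->
  \prod_i f (x i - (clip (s i) - ep)) <= ep.
Proof.
move=> si xN; rewrite (bigD1 i) //=; apply: (@le_trans _ _ (f (x i - (clip (s i) - ep)) * 1)).
  apply: ler_wpM2l; first by have /andP[] := f01 (x i - (clip (s i) - ep)).
  by apply: prodr_ile1 => j _; exact: f01.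
rewrite mulr1; apply: fp.
have := clip_le si xN; move: xN; rewrite ler_norml => /andP[a1 a2].
by have /andP[b1 b2] := clip_bound (s i) => b3; move: N1 ep0 ep1 => *; apply/andP; split; lra.
Qed.

Lemma gintegrable_shift r : gintegrable (fun y => f (y - r)).
Proof.
apply: (@gintegrable_bounded _ _ 1).
  by apply: measurableT_comp => //; exact: measurable_funB.
by move=> x; have /andP[? ?] := f01 (x - r); rewrite ger0_norm.
Qed.

Lemma gint_shift01 r : 0 <= gint (fun y => f (y - r)) <= 1.
Proof.
have gf := gintegrable_shift r; apply/andP; split.
  rewrite -(gint_cst 0); apply: gint_le => //.
    by apply: (@gintegrable_bounded _ _ 0) => // x; rewrite normr0.
  by move=> x; have /andP[] := f01 (x - r).
rewrite -[leRHS](gint_cst 1); apply: gint_le => //.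
  by apply: (@gintegrable_bounded _ _ 1) => // x; rewrite normr1.
by move=> x; have /andP[] := f01 (x - r).
Qed.

Hypothesis gN : gvar R <= ep * N ^+ 2.

Let A := [set x : R | N < `|x|].

Let mA : measurable A.
Proof. exact: (measurable_set_lt (measurable_cst N) (@normr_measurable R setT)). Qed.

Let gtail : gint (\1_A) <= ep.
Proof.
have N0 : 0 < N by apply: lt_le_trans N1.
by apply: le_trans (gint_tail N0) _; rewrite ler_pdivrMr // exprn_gt0.
Qed.

Let gA : gintegrable (\1_A : R -> R). Proof. exact: gintegrable_indic. Qed.

Let gcst : gintegrable (fun _ : R => ep).
Proof. by apply: (@gintegrable_bounded _ _ ep) => // x; rewrite ger0_norm // ltW. Qed.

Let in_itvNy (t x : R) : (x \in `]-oo, t]%classic) = (x <= t).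
Proof. by rewrite mem_setE in_itv. Qed.

(** The [4 ep] consists of [2 ep] for moving the threshold, [Phi] being 1-Lipschitz, [ep] for the
    height of the smoothed step beyond it, and [ep] for the Gaussian mass outside [[-N, N]]. *)
Lemma gint_step_up s : gint (fun y => f (y - (clip s + ep))) <= Phi s + 4 * ep.
Proof.
have gs : gintegrable (\1_(`]-oo, s + 2 * ep]) : R -> R) by exact: gintegrable_indic.
have h : gint (fun y => f (y - (clip s + ep))) <= Phi (s + 2 * ep) + ep + gint (\1_A).
  rewrite PhiE -[X in _ + X + _](gint_cst ep) -!gintD //; last exact: gintegrableD.
  apply: gint_le; [exact: gintegrable_shift|by do ![apply: gintegrableD => //]|].
  move=> x; have /andP[f0 f1] := f01 (x - (clip s + ep)).
  rewrite !indicE in_itvNy; have [xN|xN] := leP `|x| N; last first.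
    rewrite (mem_set (xN : A x)); apply: le_trans f1 _.
    by rewrite lerDr addr_ge0 // ltW.
  apply: (@le_trans _ _ ((x <= s + 2 * ep)%R%:R + ep)); last by rewrite lerDl.
  have [xs|xs] := leP x (s + 2 * ep); first by apply: le_trans f1 _; rewrite lerDl ltW.
  rewrite add0r; apply: fp; have sx : s < x by move: ep0; lra.
  have := clip_left sx xN; move: (xN); rewrite ler_norml => /andP[x1 x2].
  have /andP[b1 b2] := clip_bound s.
  by move: N1 ep0 ep1 => ? ? ? [] E; rewrite E in b1 b2 *; apply/andP; split; lra.
have st : s <= s + 2 * ep by rewrite lerDl mulr_ge0 // ltW.
have := Phi_lip st; move: gtail h; lra.
Qed.

Lemma gint_step_low s : Phi s <= gint (fun y => f (y - (clip s - ep))) + 4 * ep.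
Proof.
have gs : gintegrable (\1_(`]-oo, s - 2 * ep]) : R -> R) by exact: gintegrable_indic.
have h : Phi (s - 2 * ep) <= gint (fun y => f (y - (clip s - ep))) + ep + gint (\1_A).
  have gf := gintegrable_shift (clip s - ep).
  rewrite PhiE -[X in _ + X + _](gint_cst ep) -!gintD //; last exact: gintegrableD.
  apply: gint_le => //; first by do ![apply: gintegrableD => //].
  move=> x; have /andP[f0 f1] := f01 (x - (clip s - ep)).
  rewrite !indicE in_itvNy; have [xN|xN] := leP `|x| N; last first.
    rewrite (mem_set (xN : A x)); apply: (@le_trans _ _ 1); first by rewrite lern1 leq_b1.
    by rewrite lerDr addr_ge0 // ltW.
  apply: (@le_trans _ _ (f (x - (clip s - ep)) + ep)); last by rewrite lerDl.
  have [xs|xs] := leP x (s - 2 * ep); last by rewrite addr_ge0 // ltW.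
  rewrite -lerBlDr; apply: fm; have sx : x <= s by move: ep0; lra.
  have := clip_right sx xN; move: (xN); rewrite ler_norml => /andP[x1 x2].
  have /andP[b1 b2] := clip_bound s.
  by move: N1 ep0 ep1 => ? ? ? [] E; rewrite E in b1 b2 *; apply/andP; split; lra.
have st : s - 2 * ep <= s by rewrite gerBl mulr_ge0 // ltW.
have := Phi_lip st; move: gtail h; lra.
Qed.

End StepFunction.

Section Martingale.
Context d (T : measurableType d) (R : realType) (P : probability T R).
Variables (e : nat -> T -> R) (s2 : R).
Hypothesis me : forall n, measurable_fun setT (e n).
Hypothesis ie : mutually_independent P e.
Hypothesis ide : identically_distributed P e.
Hypothesis h1 : has_mean P (e 0%N).
Hypothesis m1 : mean P (e 0%N) = 0.
Hypothesis h2 : has_mean P (fun w => e 0%N w ^+ 2).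
Hypothesis m2 : mean P (fun w => e 0%N w ^+ 2) = s2.

Definition past_meas k (U : T -> R) := measurable_fun setT (U : past e k -> R).

Lemma past_meas_mono k n U : (k <= n)%N -> past_meas k U -> past_meas n U.
Proof.
move=> kn mU _ B mB; have := mU measurableT B mB; apply: sub_smallest2r; first exact: smallest_sigma_algebra.
move=> _ [C [mC ->]]; exists (fun i => if (i < k)%N then C i else setT); split.
  by move=> i; case: ifP.
rewrite !iota_set; apply/seteqP; split => [w Cw i ik|w Cw i ik].
  by case: ifP => // /Cw.
by have := Cw i (leq_trans ik kn); rewrite (ik : (i < k)%N).
Qed.

Lemma past_meas_noise k n : (k < n)%N -> past_meas n (e k).
Proof. exact: past_noise. Qed.

Lemma noise_mean k : has_mean P (e k) /\ mean P (e k) = 0.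
Proof.
by have [h m] := @law_transfer _ _ _ P e me ide k id (@measurable_id _ _ _) h1; rewrite -m1.
Qed.

Lemma sqr_meas : measurable_fun setT (fun x : R => x ^+ 2).
Proof. exact: measurable_funX. Qed.

Lemma noise_sqr k : has_mean P (fun w => e k w ^+ 2) /\ mean P (fun w => e k w ^+ 2) = s2.
Proof.
by have [h m] := law_transfer me ide k sqr_meas h2; rewrite -m2.
Qed.

Lemma s2_ge0 : 0 <= s2.
Proof. by rewrite -m2; apply: mean_ge0 => w; rewrite sqr_ge0. Qed.

Definition tail_fun (A x : R) : R := x ^+ 2 * (A < `|x|)%R%:R.
(** Lindeberg's truncated second moment; by equality of laws it is the same for every noise
    variable. *)
Definition tail_mean (A : R) : R := mean P (tail_fun A \o e 0%N).

Lemma tail_fun_meas A : measurable_fun setT (tail_fun A).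
Proof.
apply: measurable_funM; first exact: sqr_meas.
rewrite (_ : (fun x => _) = \1_[set x : R | A < `|x|]); last first.
  apply/funext => x; rewrite indicE; congr (nat_of_bool _)%:R.
  by apply/idP/idP => h; [exact/mem_set|exact: set_mem h].
apply: measurable_indic.
exact: (measurable_set_lt (measurable_cst A) (@normr_measurable R setT)).
Qed.

Lemma tail_fun_ge0 A x : 0 <= tail_fun A x.
Proof. by rewrite mulr_ge0 ?sqr_ge0. Qed.

Lemma tail_fun_le A x : tail_fun A x <= x ^+ 2.
Proof. by rewrite /tail_fun ler_piMr ?sqr_ge0 // lern1 leq_b1. Qed.

Lemma has_mean_tail A k : has_mean P (tail_fun A \o e k).
Proof.
have [hk _] := noise_sqr k; apply: has_mean_le hk.
  by apply: measurableT_comp => //; exact: tail_fun_meas.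
by move=> w /=; rewrite ger0_norm ?tail_fun_ge0 // tail_fun_le.
Qed.

Lemma tail_mean_ge0 A : 0 <= tail_mean A.
Proof. by apply: mean_ge0 => w; exact: tail_fun_ge0. Qed.

Lemma tail_noise A k : mean P (tail_fun A \o e k) = tail_mean A.
Proof.
by have [_ ->] := law_transfer me ide k (tail_fun_meas A) (has_mean_tail A 0).
Qed.

Lemma tail_mean_anti A B : A <= B -> tail_mean B <= tail_mean A.
Proof.
move=> AB; apply: mean_le; do ?exact: has_mean_tail.
move=> w /=; rewrite /tail_fun ler_wpM2l ?sqr_ge0 // ler_nat.
by case: (ltP B) => // Be; rewrite (le_lt_trans AB Be).
Qed.

(** Dominated convergence with [e_0^2] as dominating function; monotonicity in the truncation level
    passes from integers to all larger [B]. *)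
Lemma tail_mean_small (eta : R) : 0 < eta ->
  exists2 A, 0 < A & forall B, A <= B -> tail_mean B <= eta.
Proof.
move=> eta0.
pose f_ (n : nat) w := (tail_fun n.+1%:R (e 0%N w))%:E.
have mf n : measurable_fun setT (f_ n).
  by apply/measurable_EFinP; apply: measurableT_comp => //; exact: tail_fun_meas.
have cf : {ae P, forall w, setT w -> f_ ^~ w @ \oo --> (cst 0%E : T -> \bar R) w}.
  apply: aeW => w _; apply: cvg_near_cst.
  exists (Num.truncn `|e 0%N w|) => // n /= nx.
  rewrite /f_ /tail_fun ltNge (le_trans (ltW (truncnS_gt _))) ?mulr0 //.
  by rewrite ler_nat ltnS.
have gf : {ae P, forall w n, setT w -> (`|f_ n w| <= (e 0%N w ^+ 2)%:E)%E}.
  apply: aeW => w n _; rewrite /f_ lee_fin ger0_norm ?tail_fun_ge0 //.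
  exact: tail_fun_le.
have [_ _ cv] := @dominated_convergence _ _ _ P setT measurableT f_ (cst 0%E) _
  mf (measurable_cst _) cf h2 gf.
rewrite integral_cst // mul0e in cv.
have {}cv : tail_mean (n.+1%:R) @[n --> \oo] --> (0 : R) by exact: (fine_cvg cv).
have /cvgrPdist_le /(_ _ eta0) [n _ /(_ n (leqnn n)) hn] := cv.
exists n.+1%:R => // B /tail_mean_anti; move/le_trans; apply.
by move: hn; rewrite sub0r normrN ger0_norm ?tail_mean_ge0.
Qed.

(** Martingale increments are orthogonal: in the expanded square the cross term factors through the
    mean of [g (e n)], which is 0. With [g] the identity this gives tightness, with centred
    truncated squares a weak law of large numbers. *)
Lemma mg_var (U : nat -> T -> R) (C : R) (g : R -> R) (v : R) n :
  (forall k, past_meas k (U k)) -> (forall k w, `|U k w| <= C) ->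
  measurable_fun setT g -> has_mean P (g \o e 0%N) -> mean P (g \o e 0%N) = 0 ->
  has_mean P (fun w => g (e 0%N w) ^+ 2) -> mean P (fun w => g (e 0%N w) ^+ 2) = v ->
  let S n w := \sum_(k < n) U k w * g (e k w) in
  [/\ past_meas n (S n), has_mean P (fun w => S n w ^+ 2) &
   mean P (fun w => S n w ^+ 2) = v * \sum_(k < n) mean P (fun w => U k w ^+ 2)].
Proof.
move=> pU bU mg hg mg0 hg2 mg2 S.
have mg2' : measurable_fun setT (fun x => g x ^+ 2) by exact: measurable_funX.
elim: n => [|n [pS hS mS]].
  have S0 : S 0%N = cst 0 by apply/funext => w; rewrite /S big_ord0.
  split.
  - by rewrite S0; exact: measurable_cst.
  - have -> : (fun w => S 0%N w ^+ 2) = cst 0 by apply/funext => w; rewrite S0 expr0n.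
    exact: has_mean_cst.
  - have -> : (fun w => S 0%N w ^+ 2) = cst 0 by apply/funext => w; rewrite S0 expr0n.
    by rewrite big_ord0 mulr0 mean_cst.
have SS w : S n.+1 w = S n w + U n w * g (e n w) by rewrite /S big_ord_recr.
have [hgn mgn] := law_transfer me ide n mg hg.
have [hg2n mg2n] := law_transfer me ide n mg2' hg2.
have mSn : measurable_fun setT (S n) by exact: (past_measurable_fun me pS).
have mUn : measurable_fun setT (U n) by exact: (past_measurable_fun me (pU n)).
have C0 : 0 <= C := le_trans (normr_ge0 _) (bU 0%N point).
have hU2 k : has_mean P (fun w => U k w ^+ 2).
  apply: (@has_mean_bounded _ _ _ _ _ (C ^+ 2)).
    by apply: measurable_funX; exact: (past_measurable_fun me (pU k)).
  by move=> w; rewrite normrX lerXn2r.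
have hU2g : has_mean P (fun w => U n w ^+ 2 * g (e n w) ^+ 2).
  apply: (@has_mean_bM _ _ _ _ _ _ (C ^+ 2)) hg2n.
    by apply: measurable_funX.
  by move=> w; rewrite normrX lerXn2r.
have mgn' : measurable_fun setT (fun w => g (e n w)) by apply: measurableT_comp.
have hSU : has_mean P (fun w => S n w * U n w).
  apply: has_mean_le (has_meanD hS (hU2 n)); first exact: measurable_funM.
  move=> w; rewrite normrM; have := sqr_ge0 (`|S n w| - `|U n w|).
  rewrite -[S n w ^+ 2]real_normK ?num_real // -[U n w ^+ 2]real_normK ?num_real //.
  have := normr_ge0 (S n w); have := normr_ge0 (U n w); nra.
have hSUg : has_mean P (fun w => S n w * U n w * g (e n w)).
  apply: has_mean_le (has_meanD hS hU2g).
    by apply: measurable_funM => //; exact: measurable_funM.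
  move=> w; rewrite -mulrA normrM -exprMn; set y := U n w * _.
  have := sqr_ge0 (`|S n w| - `|y|).
  rewrite -[S n w ^+ 2]real_normK ?num_real // -[y ^+ 2]real_normK ?num_real //.
  have := normr_ge0 (S n w); have := normr_ge0 y; nra.
have E w : S n.+1 w ^+ 2 = S n w ^+ 2 + (2 * (S n w * U n w * g (e n w)) + U n w ^+ 2 * g (e n w) ^+ 2).
  by rewrite SS; ring.
have E' : (fun w => S n.+1 w ^+ 2) = fun w => S n w ^+ 2 + (2 * (S n w * U n w * g (e n w)) + U n w ^+ 2 * g (e n w) ^+ 2).
  exact/funext.
split.
- have -> : S n.+1 = fun w => S n w + U n w * g (e n w) by apply/funext.
  apply: measurable_funD; first exact: (past_meas_mono (leqnSn n) pS).
  apply: measurable_funM; first exact: (past_meas_mono (leqnSn n) (pU n)).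
  by apply: measurableT_comp => //; exact: past_meas_noise.
- rewrite E'; apply: has_meanD => //; apply: has_meanD => //; exact: has_meanZ.
- rewrite E' meanD //; last by apply: has_meanD => //; exact: has_meanZ.
  rewrite meanD //; last exact: has_meanZ.
  rewrite meanZ // mS big_ord_recr /= mulrDr.
  rewrite (mean_past_mul me ie _ hSU mg hgn hSUg); last first.
    by apply: measurable_funM => //; exact: pU.
  rewrite mgn mg0 mulr0 mulr0 add0r.
  rewrite (mean_past_mul me ie (measurable_funX 2 (pU n)) (hU2 n) mg2' hg2n hU2g).
  by rewrite mg2n mg2 (mulrC v (mean _ _)).
Qed.

Lemma chebyshev_mean (X : T -> R) (a : R) : 0 < a -> measurable_fun setT X ->
  has_mean P (fun w => X w ^+ 2) ->
  Pr P [set w | a <= `|X w|] <= mean P (fun w => X w ^+ 2) / a ^+ 2.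
Proof.
move=> a0 mX hX; apply: markov_mean => //.
- exact: exprn_gt0.
- by move=> w; exact: sqr_ge0.
- by apply: measurable_set_le => //; apply: measurableT_comp.
- by move=> w /= aX; rewrite -[X in _ <= X]real_normK ?num_real // ler_sqr ?nnegrE // ltW.
Qed.

Lemma martingale_tight n (D : nat -> T -> R) (z C lam : R) :
  (forall k, past_meas k (D k)) -> (forall k w, `|D k w| <= z) ->
  (forall w, \sum_(k < n) D k w ^+ 2 <= C) -> 0 < lam ->
  measurable [set w | lam <= `|\sum_(k < n) D k w * e k w|] /\
  Pr P [set w | lam <= `|\sum_(k < n) D k w * e k w|] <= s2 * C / lam ^+ 2.
Proof.
move=> pD bD sD l0.
have [pS hS mS] := mg_var n pD bD (@measurable_id _ _ setT) h1 m1 h2 m2.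
set S := (fun w : T => \sum_(k < n) D k w * e k w) in pS hS mS *.
have mSm : measurable_fun setT S by exact: (past_measurable_fun me pS).
split; first by apply: measurable_set_le => //; apply: measurableT_comp.
apply: le_trans (chebyshev_mean l0 mSm hS) _.
rewrite ler_wpM2r ?invr_ge0 ?sqr_ge0 // mS ler_wpM2l ?s2_ge0 //.
have hD k : has_mean P (fun w => D k w ^+ 2).
  apply: (@has_mean_bounded _ _ _ _ _ (z ^+ 2)).
    by apply: measurable_funX; exact: (past_measurable_fun me (pD k)).
  by move=> w; rewrite normrX ler_sqr ?nnegrE //; exact: le_trans (bD k w).
rewrite -(mean_sum (P := P) (index_enum 'I_n) (fun k : 'I_n => hD k)).
by apply: mean_le_bound => //; apply: has_mean_sum => k; exact: hD.
Qed.

Lemma exp_taylor (v : R) : 0 <= v -> `|1 - v - expR (- v)| <= v ^+ 2.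
Proof.
move=> v0; have l1 := expR_ge1Dx (- v).
rewrite distrC ger0_norm; last lra.
have : expR (- v) <= (1 + v)^-1.
  by rewrite expRN lef_pV2 ?posrE ?expR_gt0 //; [exact: expR_ge1Dx|lra].
move=> h; have : (1 + v)^-1 <= 1 - v + v ^+ 2.
  rewrite -[leLHS]mul1r ler_pdivrMr; last lra.
  have := exprn_ge0 3 v0; rewrite !exprS expr0; nra.
lra.
Qed.

(** For [|x| <= A] the two cubic bounds apply with [|D x| <= delta A], whence the factor 2;
    otherwise the quadratic bounds, with constants 2 and 1, add up to 3. *)
Lemma trig_remainder (D x delta A : R) : 0 <= A -> `|D| <= delta ->
  `|cos (D * x) - 1 + (D * x) ^+ 2 / 2| + `|sin (D * x) - D * x| <=
  D ^+ 2 * (2 * delta * A * x ^+ 2 + 3 * tail_fun A x).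
Proof.
move=> A0 Dd; set y := D * x.
have y2 : `|y| ^+ 2 = D ^+ 2 * x ^+ 2 by rewrite real_normK ?num_real // exprMn.
have dd : 0 <= delta by apply: le_trans Dd.
rewrite /tail_fun; case: ltP => xA; last first.
  have yA : `|y| <= delta * A by rewrite normrM ler_pM.
  have := norm_cosB2_le3 y; have := norm_sinBid_le3 y.
  rewrite exprSr y2 mulr0 mulr0 addr0 => b1 b2.
  have : D ^+ 2 * x ^+ 2 * `|y| <= D ^+ 2 * x ^+ 2 * (delta * A).
    by rewrite ler_wpM2l // mulr_ge0 // sqr_ge0.
  lra.
have := norm_cosB2_le2 y; have := norm_sinBid_le2 y; rewrite y2 mulr1 => b1 b2.
have : 0 <= D ^+ 2 * (2 * delta * A * x ^+ 2).
  by rewrite mulr_ge0 ?sqr_ge0 // mulr_ge0 ?sqr_ge0 // !mulr_ge0.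
lra.
Qed.

(* The compensated mean [E (exp (s2 V_m / 2) cos (S_m + b))] telescopes in [m]: conditionally on
   the past, the terms of order at most two of each increment cancel. *)
Lemma char_bound (D : nat -> T -> R) (C delta A b : R) n :
  (forall k, past_meas k (D k)) -> (forall k w, `|D k w| <= delta) ->
  (forall w, \sum_(k < n) D k w ^+ 2 <= C) -> 0 <= A ->
  `|mean P (fun w => expR (2^-1 * s2 * \sum_(k < n) D k w ^+ 2) *
       cos (\sum_(k < n) D k w * e k w + b)) - cos b| <=
  expR (2^-1 * s2 * C) * C * (2 * delta * A * s2 + 3 * tail_mean A + s2 ^+ 2 * delta ^+ 2).
Proof.
move=> pD bD bV A0.
have s20 := s2_ge0; have t0 := tail_mean_ge0 A.
have d0 : 0 <= delta := le_trans (normr_ge0 _) (bD 0%N point).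
set E := expR _; set kap := (2 * delta * A * s2 + _ + _).
have E0 : 0 <= E by exact: expR_ge0.
have kap0 : 0 <= kap.
  by rewrite /kap !addr_ge0 ?mulr_ge0 ?sqr_ge0 //.
have mD k : measurable_fun setT (D k) by exact: (past_measurable_fun me (pD k)).
have hD2 k : has_mean P (fun w => D k w ^+ 2).
  apply: (@has_mean_bounded _ _ _ _ _ (delta ^+ 2)); first exact: measurable_funX.
  by move=> w; rewrite normrX lerXn2r.
pose V m w := \sum_(k < m) D k w ^+ 2.
pose S m w := \sum_(k < m) D k w * e k w.
pose phi m w := expR (2^-1 * s2 * V m w) * cos (S m w + b).
have VC m w : (m <= n)%N -> V m w <= C.
  move=> mn; apply: le_trans (bV w); rewrite /V -!(big_mkord xpredT (fun k => D k w ^+ 2)).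
  by rewrite (big_cat_nat _ mn) //= lerDl sumr_ge0 // => i _; exact: sqr_ge0.
have V0 m w : 0 <= V m w by apply: sumr_ge0 => k _; exact: sqr_ge0.
have WE m w : (m <= n)%N -> expR (2^-1 * s2 * V m w) <= E.
  by move=> mn; rewrite ler_expR ler_wpM2l ?VC // mulr_ge0.
have pV m k : (k <= m.+1)%N -> past_meas m (V k).
  move=> km; apply: measurable_fun_bigsum => i; apply: measurable_funX.
  apply: past_meas_mono (pD i); rewrite -ltnS; exact: leq_trans (ltn_ord i) km.
have pS m : past_meas m (S m).
  apply: measurable_fun_bigsum => i; apply: measurable_funM.
    by apply: past_meas_mono (pD i); exact: ltnW.
  exact: past_meas_noise.
have pcos m (f : T -> R) : past_meas m f -> past_meas m (fun w => cos (f w)).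
  move=> pf; apply: measurableT_comp => //.
  by apply: continuous_measurable_fun; exact: continuous_cos.
have psin m (f : T -> R) : past_meas m f -> past_meas m (fun w => sin (f w)).
  move=> pf; apply: measurableT_comp => //.
  by apply: continuous_measurable_fun; exact: continuous_sin.
have pW m k : (k <= m.+1)%N -> past_meas m (fun w => expR (2^-1 * s2 * V k w)).
  move=> km; apply: measurableT_comp; first exact: measurable_expR.
  by apply: measurable_funM; [exact: measurable_cst|exact: pV].
have pSb m : past_meas m (fun w => S m w + b).
  by apply: measurable_funD; [exact: pS|exact: measurable_cst].
have hphi m : (m <= n)%N -> has_mean P (phi m).
  move=> mn; apply: (@has_mean_bounded _ _ _ _ _ E).
    apply: (past_measurable_fun me (k := m)); apply: measurable_funM; first exact: pW.
    apply: pcos; exact: pSb.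
  move=> w; rewrite normrM ger0_norm ?expR_ge0 //.
  by apply: le_trans (WE m w mn); rewrite ler_piMr ?expR_ge0 // cos_max.
(* Keeping the mean of the partial bracket in the induction lets the errors sum to a multiple of [C]
   instead of [n]. *)
suff main m : (m <= n)%N -> `|mean P (phi m) - cos b| <= E * kap * \sum_(k < m) mean P (fun w => D k w ^+ 2).
  apply: le_trans (main n (leqnn n)) _.
  rewrite (mulrAC E C) ler_wpM2l ?mulr_ge0 //.
  rewrite -mean_sum //; apply: mean_le_bound => //; exact: has_mean_sum.
elim: m => [_|m IH mn].
  rewrite big_ord0 mulr0 /phi.
  have -> : (fun w => expR (2^-1 * s2 * V 0%N w) * cos (S 0%N w + b)) = cst (cos b).
    by apply/funext => w; rewrite /V /S !big_ord0 mulr0 expR0 mul1r add0r.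
  by rewrite mean_cst subrr normr0.
have {}IH := IH (ltnW mn).
rewrite big_ord_recr /= mulrDr.
have -> : mean P (phi m.+1) - cos b = (mean P (phi m) - cos b) + (mean P (phi m.+1) - mean P (phi m)) by ring.
apply: le_trans (ler_normD _ _) _; rewrite lerD // {IH}.
rewrite -meanB; try exact: hphi; last exact/hphi/ltnW.
(* The compensator is taken at [m + 1]: since [D m] is predictable, it is still determined by the
   past of [e m]. *)
pose W w := expR (2^-1 * s2 * V m.+1 w).
pose c w := W w * cos (S m w + b); pose s w := W w * sin (S m w + b).
pose x w := D m w * e m w; pose v w := 2^-1 * s2 * D m w ^+ 2.
have pc : past_meas m c by apply: measurable_funM; [exact: pW|apply: pcos; exact: pSb].
have ps : past_meas m s by apply: measurable_funM; [exact: pW|apply: psin; exact: pSb].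
have W0 w : 0 <= W w by exact: expR_ge0.
have bc w : `|c w| <= E.
  rewrite normrM ger0_norm //; apply: le_trans (WE m.+1 w mn).
  by rewrite ler_piMr // cos_max.
have bs w : `|s w| <= E.
  rewrite normrM ger0_norm //; apply: le_trans (WE m.+1 w mn).
  by rewrite ler_piMr // sin_max.
have mc := past_measurable_fun me pc; have ms := past_measurable_fun me ps.
(* The increment of [phi] splits into remainders of order above two ([Rr]), a term in [s2 - e_m^2]
   ([Z1]) and a term in [e_m] ([Z2]); the last two have mean 0 because their coefficients depend on
   the past. *)
pose Rr w := c w * (cos (x w) - 1 + x w ^+ 2 / 2) - s w * (sin (x w) - x w)
  + c w * (1 - v w - expR (- v w)).
pose Z1 w := c w * D m w ^+ 2 / 2 * s2 - c w * D m w ^+ 2 / 2 * e m w ^+ 2.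
pose Z2 w := s w * D m w * e m w.
have phiE w : phi m.+1 w - phi m w = Rr w + (Z1 w - Z2 w).
  have -> : phi m w = W w * expR (- v w) * cos (S m w + b).
    rewrite /phi /W -expRD; congr (expR _ * _).
    by rewrite /v /V big_ord_recr /=; ring.
  have -> : phi m.+1 w = W w * (cos (S m w + b) * cos (x w) - sin (S m w + b) * sin (x w)).
    rewrite /phi -/(W w) -cosD; congr (_ * cos _).
    by rewrite /S big_ord_recr /= -/(S m w) /x; ring.
  by rewrite /Rr /Z1 /Z2 /c /s /v /x; field.
have [he1 me1] := noise_mean m; have [he2 me2] := noise_sqr m.
have pU1 : past_meas m (fun w => c w * D m w ^+ 2 / 2).
  apply: measurable_funM; last exact: measurable_cst.
  by apply: measurable_funM; [exact: pc|exact: (measurable_funX 2 (pD m))].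
have bU1 w : `|c w * D m w ^+ 2 / 2| <= E * delta ^+ 2.
  rewrite -mulrA normrM ler_pM // normrM normrX.
  have : `|D m w| ^+ 2 <= delta ^+ 2 by rewrite lerXn2r.
  rewrite normfV (@ger0_norm _ 2) //; have := sqr_ge0 `|D m w|; lra.
have hU1 : has_mean P (fun w => c w * D m w ^+ 2 / 2).
  by apply: has_mean_bounded bU1; exact: (past_measurable_fun me pU1).
have hU1e : has_mean P (fun w => c w * D m w ^+ 2 / 2 * e m w ^+ 2).
  by apply: has_mean_bM bU1 he2; exact: (past_measurable_fun me pU1).
have hU1s : has_mean P (fun w => c w * D m w ^+ 2 / 2 * s2).
  by apply: has_mean_bM bU1 (has_mean_cst _ _); exact: (past_measurable_fun me pU1).
have hZ1 : has_mean P Z1 by exact: has_meanB.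
have Z10 : mean P Z1 = 0.
  rewrite meanB // (mean_past_mul me ie pU1 hU1 sqr_meas he2 hU1e).
  have -> : (fun w => c w * D m w ^+ 2 / 2 * s2) = (fun w => s2 * (c w * D m w ^+ 2 / 2)).
    by apply/funext => w; rewrite mulrC.
  by rewrite meanZ // (_ : mean P (_ \o e m) = s2) // mulrC subrr.
have pU2 : past_meas m (fun w => s w * D m w).
  by apply: measurable_funM; [exact: ps|exact: pD].
have bU2 w : `|s w * D m w| <= E * delta by rewrite normrM ler_pM.
have hU2 : has_mean P (fun w => s w * D m w).
  by apply: has_mean_bounded bU2; exact: (past_measurable_fun me pU2).
have hZ2 : has_mean P Z2.
  by apply: has_mean_bM bU2 he1; exact: (past_measurable_fun me pU2).
have Z20 : mean P Z2 = 0.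
  by rewrite /Z2 (mean_past_mul me ie pU2 hU2 (@measurable_id _ _ _) he1 hZ2) (_ : mean P (id \o e m) = 0) ?mulr0.
pose g y := 2 * delta * A * y ^+ 2 + 3 * tail_fun A y.
have mg : measurable_fun setT g.
  by apply: measurable_funD; apply: measurable_funM => //; exact: tail_fun_meas.
have hg : has_mean P (g \o e m).
  by apply: has_meanD; apply: has_meanZ => //; exact: has_mean_tail.
have Eg : mean P (g \o e m) = 2 * delta * A * s2 + 3 * tail_mean A.
  rewrite (_ : g \o e m = fun w => 2 * delta * A * e m w ^+ 2 + 3 * (tail_fun A \o e m) w) //.
  have ht := has_mean_tail A m.
  rewrite meanD; [|exact: has_meanZ|exact: has_meanZ].
  by rewrite !meanZ // me2 tail_noise.
have hDg : has_mean P (fun w => D m w ^+ 2 * g (e m w)).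
  apply: (@has_mean_bM _ _ _ _ _ _ (delta ^+ 2)) hg; first exact: measurable_funX.
  by move=> w; rewrite normrX lerXn2r.
have EDg : mean P (fun w => D m w ^+ 2 * g (e m w)) = mean P (fun w => D m w ^+ 2) * mean P (g \o e m).
  by apply: (mean_past_mul me ie _ (hD2 m) mg hg hDg); exact: (measurable_funX 2 (pD m)).
pose B w := E * (D m w ^+ 2 * g (e m w) + s2 ^+ 2 * delta ^+ 2 * D m w ^+ 2).
have hB : has_mean P B by apply/has_meanZ/has_meanD => //; exact: has_meanZ.
have RB w : `|Rr w| <= B w.
  rewrite /B (mulrDr E) /Rr; apply: le_trans (ler_normD _ _) _; apply: lerD.
    apply: le_trans (ler_normB _ _) _.
    apply: (@le_trans _ _ (E * (`|cos (x w) - 1 + x w ^+ 2 / 2| + `|sin (x w) - x w|))).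
      by rewrite (mulrDr E) lerD // normrM ler_wpM2r.
    by rewrite ler_wpM2l // trig_remainder.
  rewrite normrM ler_pM //.
  have v0 : 0 <= v w by apply: mulr_ge0; [exact: mulr_ge0|exact: sqr_ge0].
  apply: le_trans (exp_taylor v0) _.
  have DD : D m w ^+ 2 <= delta ^+ 2.
    by rewrite -[leLHS]real_normK ?num_real // lerXn2r.
  have -> : v w ^+ 2 = 4^-1 * (s2 ^+ 2 * (D m w ^+ 2 * D m w ^+ 2)) by rewrite /v; field.
  have : s2 ^+ 2 * (D m w ^+ 2 * D m w ^+ 2) <= s2 ^+ 2 * (delta ^+ 2 * D m w ^+ 2).
    by rewrite ler_wpM2l ?sqr_ge0 // ler_wpM2r ?sqr_ge0.
  have : 0 <= s2 ^+ 2 * (D m w ^+ 2 * D m w ^+ 2).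
    by apply: mulr_ge0; [|apply: mulr_ge0]; exact: sqr_ge0.
  rewrite mulrA; lra.
have mRr : measurable_fun setT Rr.
  have E1 : Rr = fun w => (phi m.+1 w - phi m w) - (Z1 w - Z2 w).
    by apply/funext => w; rewrite phiE; ring.
  rewrite E1; apply: measurable_funB; apply: measurable_funB.
  - exact: (has_mean_meas (hphi _ mn)).
  - exact: (has_mean_meas (hphi _ (ltnW mn))).
  - exact: (has_mean_meas hZ1).
  - exact: (has_mean_meas hZ2).
have hRr : has_mean P Rr by apply: has_mean_le hB.
rewrite (_ : (fun w => phi m.+1 w - phi m w) = fun w => Rr w + (Z1 w - Z2 w)); last exact/funext.
rewrite meanD //; last exact: has_meanB.
rewrite meanB // Z10 Z20 subrr addr0.
apply: le_trans (mean_norm hRr) _.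
apply: le_trans (mean_le (has_mean_norm hRr) hB RB) _.
rewrite /B meanZ; last by apply: has_meanD => //; exact: has_meanZ.
rewrite meanD //; last exact: has_meanZ.
rewrite meanZ // EDg Eg /kap le_eqVlt; apply/orP; left; apply/eqP; ring.
Qed.

Lemma expR_dist (a b m : R) : a <= m -> b <= m ->
  `|expR a - expR b| <= expR m * `|a - b|.
Proof.
wlog ab : a b / a <= b => [h am bm|].
  by have [/h|/ltW/h] := leP a b; [exact|rewrite distrC [X in _ * X]distrC; exact].
move=> am bm; rewrite distrC ger0_norm ?subr_ge0 ?ler_expR // distrC ger0_norm ?subr_ge0 //.
have -> : expR b - expR a = expR b * (1 - expR (a - b)).
  by rewrite mulrBr mulr1 -expRD [b + _]addrC subrK.
apply: (@le_trans _ _ (expR b * (b - a))).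
  by rewrite ler_wpM2l ?expR_ge0 //; have := expR_ge1Dx (a - b); lra.
by rewrite ler_wpM2r ?subr_ge0 // ler_expR.
Qed.

(** Passes from the compensated mean to the characteristic function. [zeta] is fixed before [n],
    [D], [q] and [B], so it serves all parameters and stopping levels at once. *)
Lemma charfun_close (C Q eta : R) : 0 <= C -> 0 <= Q -> 0 < eta ->
  exists2 zeta, 0 < zeta & forall n (D : nat -> T -> R) (q : R) (B : set T), 0 <= q <= Q ->
    (forall k, past_meas k (D k)) -> (forall k w, `|D k w| <= zeta) ->
    (forall w, \sum_(k < n) D k w ^+ 2 <= C) ->
    measurable B -> Pr P B <= zeta ->
    (forall w, ~ B w -> `|s2 * (\sum_(k < n) D k w ^+ 2) - q| <= zeta) ->
    forall b, `|mean P (fun w => cos (\sum_(k < n) D k w * e k w + b))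
                - expR (- (2^-1 * q)) * cos b| <= eta.
Proof.
move=> C0 Q0 eta0; have s20 := s2_ge0.
set K1 := expR (2^-1 * s2 * C) * C.
have K10 : 0 <= K1 by rewrite mulr_ge0 ?expR_ge0.
set E2 := expR (2^-1 * (s2 * C + Q)).
have E20 : 0 < E2 by exact: expR_gt0.
(* The truncation level comes first, since [zeta] multiplies it in the remainder. The 12 makes the
   tail term, which enters three times, at most [eta / 4]. *)
have [A A0 /(_ A (lexx A)) tA] : exists2 A, 0 < A & forall B, A <= B ->
    tail_mean B <= eta / (12 * (K1 + 1)).
  by apply: tail_mean_small; rewrite divr_gt0 // mulr_gt0 // ltr_wpDl.
set K2 := (2 * A * s2 + s2 ^+ 2) * (K1 + 1).
have K20 : 0 <= K2.
  apply: mulr_ge0; last by rewrite addr_ge0.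
  by apply: addr_ge0; [rewrite !mulr_ge0 // ltW|exact: sqr_ge0].
pose zeta := Num.min 1 (Num.min (eta / (4 * (K2 + 1))) (eta / (4 * E2))).
have z0 : 0 < zeta.
  by rewrite !lt_min ltr01 !divr_gt0 // mulr_gt0 // ltr_wpDl.
have z1 : zeta <= 1 by rewrite ge_min lexx.
have zK : zeta * K2 <= eta / 4.
  have : zeta <= eta / (4 * (K2 + 1)) by rewrite !ge_min lexx orbT.
  rewrite ler_pdivlMr ?mulr_gt0 // ?ltr_wpDl //; nra.
have zE : zeta * E2 <= eta / 4.
  have : zeta <= eta / (4 * E2) by rewrite !ge_min lexx !orbT.
  by rewrite ler_pdivlMr ?mulr_gt0 //; lra.
exists zeta => // n D q B /andP[q0 qQ] pD bD bV mB PB BV b.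
have cb := char_bound b pD bD bV (ltW A0).
have {}cb : `|mean P (fun w => expR (2^-1 * s2 * \sum_(k < n) D k w ^+ 2) *
       cos (\sum_(k < n) D k w * e k w + b)) - cos b| <= eta / 2.
  apply: le_trans cb _; rewrite -/K1.
  have tK : K1 * tail_mean A <= eta / 12.
    have t0 := tail_mean_ge0 A.
    have : tail_mean A * (12 * (K1 + 1)) <= eta.
      by rewrite -ler_pdivlMr // mulr_gt0 // ltr_wpDl.
    nra.
  have : K1 * (2 * zeta * A * s2 + s2 ^+ 2 * zeta ^+ 2) <= zeta * K2.
    have h : s2 ^+ 2 * zeta ^+ 2 <= s2 ^+ 2 * zeta.
      by rewrite ler_wpM2l ?sqr_ge0 // expr2 ler_piMl // ltW.
    have h0 : 0 <= 2 * zeta * A * s2 + s2 ^+ 2 * zeta ^+ 2.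
      apply: addr_ge0; first by rewrite !mulr_ge0 // ltW.
      by apply: mulr_ge0; exact: sqr_ge0.
    have h' : 2 * zeta * A * s2 + s2 ^+ 2 * zeta ^+ 2 <= zeta * (2 * A * s2 + s2 ^+ 2) by lra.
    apply: (@le_trans _ _ ((K1 + 1) * (zeta * (2 * A * s2 + s2 ^+ 2)))).
      by apply: ler_pM => //; rewrite lerDl.
    by rewrite /K2; lra.
  lra.
pose V w := \sum_(k < n) D k w ^+ 2; pose S w := \sum_(k < n) D k w * e k w.
have mD k : measurable_fun setT (D k) by exact: (past_measurable_fun me (pD k)).
have mV : measurable_fun setT V by apply: measurable_fun_bigsum => k; exact: measurable_funX.
have mS : measurable_fun setT S.
  by apply: measurable_fun_bigsum => k; exact: measurable_funM.
have mcos : measurable_fun setT (fun w => cos (S w + b)).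
  apply: measurableT_comp; last by apply: measurable_funD.
  by apply: continuous_measurable_fun; exact: continuous_cos.
have hcos : has_mean P (fun w => cos (S w + b)).
  by apply: (@has_mean_bounded _ _ _ _ _ 1) => // w; exact: cos_max.
have V0 w : 0 <= V w by apply: sumr_ge0 => k _; exact: sqr_ge0.
have aE w : 2^-1 * s2 * V w <= 2^-1 * (s2 * C + Q).
  have : s2 * V w <= s2 * C by rewrite ler_wpM2l // bV.
  lra.
have qE : 2^-1 * q <= 2^-1 * (s2 * C + Q).
  have : 0 <= s2 * C by rewrite mulr_ge0.
  lra.
have mW : measurable_fun setT (fun w => expR (2^-1 * s2 * V w)).
  by apply: measurableT_comp; [exact: measurable_expR|exact: measurable_funM].
have hphi : has_mean P (fun w => expR (2^-1 * s2 * V w) * cos (S w + b)).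
  apply: (@has_mean_bM _ _ _ _ _ _ E2) => // w.
  by rewrite ger0_norm ?expR_ge0 // ler_expR.
(* Off [B] the bracket [s2 V] is close to [q], so the compensator is nearly constant. *)
pose G w := (expR (2^-1 * q) - expR (2^-1 * s2 * V w)) * cos (S w + b).
have hG : has_mean P G.
  have -> : G = fun w => expR (2^-1 * q) * cos (S w + b) - expR (2^-1 * s2 * V w) * cos (S w + b).
    by apply/funext => w; rewrite /G mulrBl.
  by apply: has_meanB => //; exact: has_meanZ.
have GB w : `|G w| <= E2 * zeta + E2 * \1_B w.
  rewrite normrM; apply: (@le_trans _ _ `|expR (2^-1 * q) - expR (2^-1 * s2 * V w)|).
    by rewrite ler_piMr // cos_max.
  rewrite indicE; case: (boolP (w \in B)) => [wB|/negP wB].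
    rewrite mulr1; apply: (@le_trans _ _ E2); last by rewrite lerDr mulr_ge0 // ltW.
    rewrite ler_norml; have := expR_ge0 (2^-1 * q); have := expR_ge0 (2^-1 * s2 * V w).
    have : expR (2^-1 * q) <= E2 by rewrite ler_expR.
    have : expR (2^-1 * s2 * V w) <= E2 by rewrite ler_expR.
    by move=> *; apply/andP; split; lra.
  rewrite mulr0 addr0; apply: le_trans (expR_dist qE (aE w)) _.
  rewrite ler_wpM2l ?expR_ge0 //.
  have := BV w; rewrite -/(V w) => /(_ _)/wrap[]; first by move=> Bw; apply: wB; exact: mem_set.
  rewrite -mulrA -mulrBr normrM (@ger0_norm _ 2^-1) // distrC.
  have := normr_ge0 (s2 * V w - q); lra.
have mG : `|mean P G| <= eta / 2.
  have hb : has_mean P (fun w => E2 * zeta + E2 * \1_B w).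
    by apply: has_meanD; [exact: has_mean_cst|exact/has_meanZ/has_mean_indic].
  apply: le_trans (mean_norm hG) _.
  apply: le_trans (mean_le (has_mean_norm hG) hb GB) _.
  rewrite meanD; [|exact: has_mean_cst|exact/has_meanZ/has_mean_indic].
  rewrite mean_cst meanZ; last exact: has_mean_indic.
  rewrite mean_indic //.
  have : E2 * Pr P B <= E2 * zeta by rewrite ler_wpM2l // ltW.
  lra.
have EG : mean P G = expR (2^-1 * q) * mean P (fun w => cos (S w + b)) -
    mean P (fun w => expR (2^-1 * s2 * V w) * cos (S w + b)).
  rewrite -meanZ // -meanB //; last exact: has_meanZ.
  by congr mean; apply/funext => w; rewrite /G mulrBl.
have Eq : expR (- (2^-1 * q)) * expR (2^-1 * q) = 1 by rewrite -expRD addNr expR0.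
have Eq1 : expR (- (2^-1 * q)) <= 1.
  by rewrite -expR0 ler_expR oppr_le0 mulr_ge0.
have Eq0 := expR_ge0 (- (2^-1 * q)).
suff: `|mean P (fun w => cos (S w + b)) - expR (- (2^-1 * q)) * cos b| <= eta by [].
set M := mean P (fun w => cos (S w + b)) in EG *.
(* Multiplying by [exp (- q / 2) <= 1] removes the deterministic compensator without enlarging the
   two errors of size [eta / 2]. *)
have -> : M - expR (- (2^-1 * q)) * cos b =
  expR (- (2^-1 * q)) * (mean P G + (mean P (fun w => expR (2^-1 * s2 * V w) * cos (S w + b)) - cos b)).
  have : M = expR (- (2^-1 * q)) * expR (2^-1 * q) * M by rewrite Eq mul1r.
  by rewrite EG => {1}->; ring.
rewrite normrM (ger0_norm Eq0) -[leRHS]mul1r; apply: ler_pM => //.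
apply: le_trans (ler_normD _ _) _.
have -> : eta = eta / 2 + eta / 2 by field.
exact: lerD.
Qed.

Section Vector.
Variable p : nat.
Implicit Types (u : 'rV[R]_p) (a : 'I_p -> 'I_p -> R).

Lemma quad_bound u a (U m : R) : \sum_i `|u 0 i| <= U -> 0 <= m ->
  (forall i j, `|a i j| <= m) ->
  `|\sum_i \sum_j u 0 i * u 0 j * a i j| <= U ^+ 2 * m.
Proof.
move=> uU m0 am; have S0 : 0 <= \sum_i `|u 0 i| by rewrite sumr_ge0.
apply: (@le_trans _ _ ((\sum_i `|u 0 i|) * (\sum_i `|u 0 i|) * m)); last first.
  by rewrite ler_wpM2r // expr2 ler_pM.
apply: le_trans (ler_norm_sum _ _ _) _; rewrite -mulrA mulr_suml; apply: ler_sum => i _.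
apply: le_trans (ler_norm_sum _ _ _) _; rewrite mulr_suml mulr_sumr; apply: ler_sum => j _.
by rewrite !normrM -mulrA ler_wpM2l // ler_wpM2l.
Qed.

Lemma sum_sqr_quad u n (D : nat -> 'I_p -> R) :
  \sum_(k < n) (\sum_i u 0 i * D k i) ^+ 2 =
  \sum_i \sum_j u 0 i * u 0 j * \sum_(k < n) D k i * D k j.
Proof.
transitivity (\sum_(k < n) \sum_i \sum_j u 0 i * u 0 j * (D k i * D k j)).
  apply: eq_bigr => k _; rewrite expr2 mulr_suml; apply: eq_bigr => i _.
  by rewrite mulr_sumr; apply: eq_bigr => j _; ring.
rewrite exchange_big; apply: eq_bigr => i _; rewrite exchange_big; apply: eq_bigr => j _.
by rewrite mulr_sumr.
Qed.

Lemma sum_sqr_delta u :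
  \sum_i u 0 i ^+ 2 = \sum_i \sum_j u 0 i * u 0 j * (i == j)%:R.
Proof.
apply: eq_bigr => i _; rewrite (bigD1 i) //= eqxx mulr1 big1 ?addr0 ?expr2 // => j.
by rewrite eq_sym => /negbTE ->; rewrite mulr0.
Qed.

(** The Cramer-Wold reduction: the scalar statement is applied to the increments [u . D_k],
    uniformly over directions of bounded [l^1] norm. *)
Lemma charfun_vec (C U eta : R) : 0 <= C -> 0 <= U -> 0 < eta ->
  exists2 zeta, 0 < zeta & forall n (D : nat -> T -> 'I_p -> R) (B : set T),
    (forall k i, past_meas k (fun w => D k w i)) -> (forall k w i, `|D k w i| <= zeta) ->
    (forall w i, \sum_(k < n) D k w i ^+ 2 <= C) ->
    measurable B -> Pr P B <= zeta ->
    (forall w, ~ B w -> forall i j,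
       `|s2 * (\sum_(k < n) D k w i * D k w j) - (i == j)%:R| <= zeta) ->
    forall u b, \sum_i `|u 0 i| <= U ->
      `|mean P (fun w => cos (\sum_i u 0 i * (\sum_(k < n) D k w i * e k w) + b))
                - expR (- (2^-1 * \sum_i u 0 i ^+ 2)) * cos b| <= eta.
Proof.
move=> C0 U0 eta0.
have [z z0 zP] := charfun_close (mulr_ge0 (sqr_ge0 U) C0) (sqr_ge0 U) eta0.
(* Increments scale by [U] and the quadratic form of the bracket error by [U^2]; dividing by [K]
   covers both, as well as the untouched probability of [B]. *)
pose K := Num.max 1 (Num.max U (U ^+ 2)).
have K1 : 1 <= K by rewrite le_max lexx.
have KU : U <= K by rewrite !le_max lexx orbT.
have KU2 : U ^+ 2 <= K by rewrite !le_max lexx !orbT.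
have K0 : 0 < K by apply: lt_le_trans K1.
exists (z / K); first by rewrite divr_gt0.
move=> n D B pD bD bV mB PB BV u b uU.
have zK : z / K <= z by rewrite ler_pdivrMr // ler_peMr // ltW.
have zK0 : 0 <= z / K by rewrite divr_ge0 // ltW.
pose Du k w := \sum_i u 0 i * D k w i.
have ES w : \sum_i u 0 i * (\sum_(k < n) D k w i * e k w) = \sum_(k < n) Du k w * e k w.
  transitivity (\sum_i \sum_(k < n) u 0 i * D k w i * e k w).
    by apply: eq_bigr => i _; rewrite mulr_sumr; apply: eq_bigr => k _; rewrite mulrA.
  by rewrite exchange_big; apply: eq_bigr => k _; rewrite mulr_suml.
under [X in mean P X]eq_fun do rewrite ES.
apply: (zP n Du (\sum_i u 0 i ^+ 2) B) => //.
- apply/andP; split; first by apply: sumr_ge0 => i _; exact: sqr_ge0.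
  rewrite sum_sqr_delta -[leRHS]mulr1; apply: le_trans (ler_norm _) _.
  by apply: quad_bound => // i j; case: (i == j); rewrite ?normr1 ?normr0.
- move=> k; apply: measurable_fun_bigsum => i; apply: measurable_funM; [exact: measurable_cst|exact: pD].
- move=> k w; apply: le_trans (ler_norm_sum _ _ _) _.
  apply: (@le_trans _ _ (\sum_i `|u 0 i| * (z / K))).
    by apply: ler_sum => i _; rewrite normrM ler_wpM2l.
  rewrite -mulr_suml; apply: (@le_trans _ _ (U * (z / K))); first by rewrite ler_wpM2r.
  by rewrite mulrA ler_pdivrMr // mulrC ler_wpM2l // ltW.
- move=> w; rewrite /Du (sum_sqr_quad u n (fun k i => D k w i)); apply: le_trans (ler_norm _) _.
  apply: quad_bound => // i j; apply: le_trans (ler_norm_sum _ _ _) _.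
  apply: (@le_trans _ _ (\sum_(k < n) (2^-1 * D k w i ^+ 2 + 2^-1 * D k w j ^+ 2))).
    apply: ler_sum => k _; rewrite normrM.
    rewrite -[D k w i ^+ 2]real_normK ?num_real // -[D k w j ^+ 2]real_normK ?num_real //.
    have := sqr_ge0 (`|D k w i| - `|D k w j|); lra.
  rewrite big_split /= -!mulr_sumr; have := bV w i; have := bV w j; lra.
- exact: le_trans PB zK.
- move=> w /BV Bw; rewrite /Du (sum_sqr_quad u n (fun k i => D k w i)) sum_sqr_delta mulr_sumr -sumrB.
  rewrite (eq_bigr (fun i => \sum_j u 0 i * u 0 j *
      (s2 * (\sum_(k < n) D k w i * D k w j) - (i == j)%:R))); last first.
    by move=> i _; rewrite mulr_sumr -sumrB; apply: eq_bigr => j _; ring.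
  apply: le_trans (quad_bound uU zK0 Bw) _.
  by rewrite mulrA ler_pdivrMr // mulrC ler_wpM2l // ltW.
Qed.

End Vector.

(** The error budget, isolated as linear arithmetic: with [q] coordinates the lower side uses
    [(5 q + 2) ep] and the upper side [(6 q + 1) ep]. *)
Lemma sandwich_low (q ep eta m g a b t : R) : 0 <= q * ep -> 0 <= ep -> (6 * q + 2) * ep <= eta ->
  - ep <= m - g -> m <= a + ep + t -> b <= g + q * (4 * ep) -> t <= q * ep -> - eta <= a - b.
Proof. by move=> *; lra. Qed.

Lemma sandwich_up (q ep eta m g a b t : R) : 0 <= q * ep -> 0 <= ep -> (6 * q + 2) * ep <= eta ->
  m - g <= ep -> a <= m + q * ep + t -> g <= b + q * (4 * ep) -> t <= q * ep -> a - b <= eta.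
Proof. by move=> *; lra. Qed.

(** The choices run [ep], then the window [N], then one trigonometric step, then [zeta] from its
    coefficients and frequencies; the thresholds [s] come last and only shift phases. *)
Lemma martingale_clt p (C eta : R) : 0 <= C -> 0 < eta ->
  exists2 zeta, 0 < zeta & forall n (D : nat -> T -> 'I_p -> R) (B : set T),
    (forall k i, past_meas k (fun w => D k w i)) -> (forall k w i, `|D k w i| <= zeta) ->
    (forall w i, \sum_(k < n) D k w i ^+ 2 <= C) ->
    measurable B -> Pr P B <= zeta ->
    (forall w, ~ B w -> forall i j,
       `|s2 * (\sum_(k < n) D k w i * D k w j) - (i == j)%:R| <= zeta) ->
    forall s : 'I_p -> R,
      `|Pr P [set w | forall i, \sum_(k < n) D k w i * e k w <= s i]
        - \prod_i Phi (s i)| <= eta.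
Proof.
move=> C0 eta0; have s20 := s2_ge0.
pose ep := Num.min 1 (eta / (6 * p%:R + 2)).
have p0 : 0 < 6 * p%:R + 2 :> R by rewrite ltr_wpDl // mulr_ge0.
have ep0 : 0 < ep by rewrite lt_min ltr01 divr_gt0.
have ep1 : ep <= 1 by rewrite ge_min lexx.
have epeta : (6 * p%:R + 2) * ep <= eta.
  by rewrite mulrC -ler_pdivlMr // ge_min lexx orbT.
(* [N] is large enough for Chebyshev to bound by [ep] both the Gaussian tail and the tail of each
   coordinate of the martingale. *)
pose K := (s2 * C + gvar R + 1) / ep.
have K0 : 0 <= K.
  by rewrite divr_ge0 ?(ltW ep0) // addr_ge0 // addr_ge0 ?gvar_ge0 // mulr_ge0.
pose N := 1 + K.
have N1 : 1 <= N by rewrite lerDl.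
have N0 : 0 < N by apply: lt_le_trans N1.
have NK : s2 * C + gvar R + 1 <= ep * N ^+ 2.
  have -> : s2 * C + gvar R + 1 = ep * K by rewrite /K mulrCA divff ?mulr1 // gt_eqF.
  rewrite ler_wpM2l ?(ltW ep0) // /N; nra.
have sC0 : 0 <= s2 * C by rewrite mulr_ge0.
have g0 := gvar_ge0 R.
have [|f [l lE] [f01 fm fp]] := @step_trigsum R (2 * N + 3) ep ep ep0 _ ep0; first lra.
have {}lE : f = trigsum l by apply/funext.
subst f; set f := trigsum l in f01 fm fp.
pose Cl := \sum_(t <- l) `|t.1.1|; pose Ul := \sum_(t <- l) `|t.1.2|.
have Cl0 : 0 <= Cl ^+ p by rewrite exprn_ge0 // sumr_ge0.
have Ul0 : 0 <= p%:R * Ul by rewrite mulr_ge0 // sumr_ge0.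
have Cle0 : 0 < ep / (Cl ^+ p + 1) by rewrite divr_gt0 // ltr_wpDl.
have [z z0 zP] := @charfun_vec p C (p%:R * Ul) (ep / (Cl ^+ p + 1)) C0 Ul0 Cle0.
exists z => // n D B pD bD bV mB PB BV s.
have {}zP := zP n D B pD bD bV mB PB BV.
pose S i w := \sum_(k < n) D k w i * e k w.
have mD k i : measurable_fun setT (fun w => D k w i) by exact: (past_measurable_fun me (pD k i)).
have mS i : measurable_fun setT (S i).
  by apply: measurable_fun_bigsum => k; exact: measurable_funM.
have fmeas : measurable_fun setT f by exact: trigsum_meas.
pose F r w := \prod_i f (S i w - r i).
have mF r : measurable_fun setT (F r).
  apply: measurable_fun_bigprod => i; apply: measurableT_comp => //.
  exact: measurable_funB.
have F01 r w : 0 <= F r w <= 1.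
  by rewrite prodr_ge0 ?prodr_ile1 // => i _; have /andP[] := f01 (S i w - r i).
have hF r : has_mean P (F r).
  by apply: (@has_mean_bounded _ _ _ _ _ 1) => // w; have /andP[? ?] := F01 r w; rewrite ger0_norm.
(* Expanding the product into at most [Cl^p] worth of cosines, each within [ep / (Cl^p + 1)] of its
   Gaussian value, gives a total error [ep]. *)
have FG r : `|mean P (F r) - \prod_i gint (fun y => f (y - r i))| <= ep.
  have [L [LE LG Lc Lu]] := @prod_trigsum R p l (index_enum 'I_p) r (index_enum_uniq _).
  rewrite size_index_ord in Lc Lu.
  rewrite [\prod_i _](_ : _ = mgauss L) //.
  have -> : F r = fun w => \sum_(t <- L) t.1.1 * cos (\sum_i t.1.2 0 i * S i w + t.2).
    by apply/funext => w; rewrite /F LE.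
  have hc (t : R * 'rV[R]_p * R) : has_mean P (fun w => cos (\sum_i t.1.2 0 i * S i w + t.2)).
    apply: (@has_mean_bounded _ _ _ _ _ 1); last by move=> w; exact: cos_max.
    apply: measurableT_comp; first by apply: continuous_measurable_fun; exact: continuous_cos.
    apply: measurable_funD => //; apply: measurable_fun_bigsum => i.
    exact: measurable_funM.
  rewrite mean_sum; last by move=> t; exact: has_meanZ.
  rewrite /mgauss -sumrB big_seq; apply: le_trans (ler_norm_sum _ _ _) _.
  apply: (@le_trans _ _ (\sum_(t <- L | t \in L) `|t.1.1| * (ep / (Cl ^+ p + 1)))).
    apply: ler_sum => t tL; rewrite meanZ // -mulrBr normrM ler_wpM2l //.
    by apply: zP; have [] := Lu t tL.
  rewrite -big_seq -mulr_suml mulrA ler_pdivrMr; last by rewrite ltr_wpDl.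
  rewrite mulrC ler_wpM2l ?(ltW ep0) //; apply: le_trans Lc _.
  by rewrite lerDl.
pose A := [set w | forall i, S i w <= s i].
have mA : measurable A.
  by apply: measurable_set_forall => i; apply: measurable_set_le.
pose W i := [set w | N <= `|S i w|].
have tight i := martingale_tight (fun k => pD k i) (fun k w => bD k w i) (fun w => bV w i) N0.
have mW i : measurable (W i) by have [] := tight i.
have PW i : Pr P (W i) <= ep.
  have [_ h] := tight i; apply: le_trans h _; rewrite ler_pdivrMr ?exprn_gt0 //; lra.
pose c i := clip N (s i).
have tailsum : \sum_i Pr P (W i) <= p%:R * ep.
  apply: (@le_trans _ _ (\sum_(i < p) ep)); first by apply: ler_sum => i _; exact: PW.
  by rewrite sumr_const card_ord mulr_natl lexx.
have hW : has_mean P (fun w => \sum_i \1_(W i) w).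
  by apply: has_mean_sum => i; exact: has_mean_indic.
have mWs : mean P (fun w => \sum_i \1_(W i) w) = \sum_i Pr P (W i).
  by rewrite mean_sum => [|i]; [apply: eq_bigr => i _; exact: mean_indic|exact: has_mean_indic].
have W0 w : 0 <= \sum_i \1_(W i) w :> R by apply: sumr_ge0 => i _; rewrite indicE ler0n.
have Wge w i : N <= `|S i w| -> 1 <= \sum_i \1_(W i) w :> R.
  move=> h; rewrite (bigD1 i) //= indicE (mem_set (h : W i w)) lerDl.
  by apply: sumr_ge0 => j _; rewrite indicE ler0n.
(* Where some coordinate leaves the window, the indicators of [W i] already add up to at least 1, so
   the smoothed product needs control only inside. *)
have up w : \1_A w <= F (fun i => c i + ep) w + p%:R * ep + \sum_i \1_(W i) w.
  have /andP[F0 _] := F01 (fun i => c i + ep) w.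
  have pe : 0 <= p%:R * ep by rewrite mulr_ge0 // ltW.
  rewrite indicE; case: (boolP (w \in A)) => [/set_mem Aw|_]; last by rewrite !addr_ge0.
  have [NW|/existsNP[i /negP]] := pselect (forall i, `|S i w| <= N); last first.
    by rewrite -ltNge => /ltW/Wge h; apply: le_trans h _; rewrite lerDr addr_ge0.
  have h : 1 <= F (fun i => c i + ep) w + p%:R * ep by exact: step_up.
  by apply: le_trans h _; rewrite lerDl.
have low w : F (fun i => c i - ep) w <= \1_A w + ep + \sum_i \1_(W i) w.
  have /andP[_ F1] := F01 (fun i => c i - ep) w.
  rewrite indicE; case: (boolP (w \in A)) => [_|/negP NA].
    by apply: le_trans F1 _; rewrite -addrA lerDl addr_ge0 // ltW.
  have [NW|/existsNP[i /negP]] := pselect (forall i, `|S i w| <= N); last first.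
    by rewrite -ltNge => /ltW/Wge h; apply: le_trans F1 (le_trans h _); rewrite lerDr add0r ltW.
  have [i si] : exists i, s i < S i w.
    apply: contrapT => h; apply: NA; apply: mem_set => i; rewrite leNgt; apply/negP => h'.
    by apply: h; exists i.
  have h : F (fun i => c i - ep) w <= ep.
    exact: (step_low N1 ep0 ep1 f01 fp si (NW i)).
  by apply: le_trans h _; rewrite add0r lerDl.
have gN : gvar R <= ep * N ^+ 2 by apply: le_trans NK; rewrite -addrA [leRHS]addrCA lerDl addr_ge0.
have gup i : gint (fun y => f (y - (c i + ep))) <= Phi (s i) + 4 * ep by exact: gint_step_up.
have gdn i : Phi (s i) <= gint (fun y => f (y - (c i - ep))) + 4 * ep by exact: gint_step_low.
have g01 r : 0 <= gint (fun y => f (y - r)) <= 1.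
  exact: (gint_shift01 fmeas f01).
have P01 i : 0 <= (Phi (s i) : R) <= 1 by rewrite Phi_ge0 Phi_le1.
have hA : has_mean P (\1_A) by exact: has_mean_indic.
have U1 : Pr P A <= mean P (F (fun i => c i + ep)) + p%:R * ep + \sum_i Pr P (W i).
  rewrite -mean_indic // -mWs -[X in _ + X + _](mean_cst P (p%:R * ep)) -meanD //; last exact: has_mean_cst.
  rewrite -meanD //; last by apply: has_meanD => //; exact: has_mean_cst.
  apply: mean_le => //; apply: has_meanD => //; apply: has_meanD => //; exact: has_mean_cst.
have L1 : mean P (F (fun i => c i - ep)) <= Pr P A + ep + \sum_i Pr P (W i).
  rewrite -mean_indic // -mWs -[X in _ + X + _](mean_cst P ep) -meanD //; last exact: has_mean_cst.
  rewrite -meanD //; last by apply: has_meanD => //; exact: has_mean_cst.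
  apply: mean_le => //; apply: has_meanD => //; apply: has_meanD => //; exact: has_mean_cst.
have e4 : 0 <= 4 * ep by rewrite mulr_ge0 // ltW.
have U2 := prod_le_add (index_enum 'I_p) e4 (fun i => g01 (c i + ep)) P01 gup.
have L2 := prod_le_add (index_enum 'I_p) e4 P01 (fun i => g01 (c i - ep)) gdn.
rewrite size_index_ord in U2 L2.
have := FG (fun i => c i + ep); have := FG (fun i => c i - ep).
rewrite -/A !ler_norml => /andP[F1 F2] /andP[F3 F4].
have pe : 0 <= p%:R * ep by rewrite mulr_ge0 // ltW.
apply/andP; split.
  exact: (sandwich_low pe (ltW ep0) epeta F1 L1 L2 tailsum).
exact: (sandwich_up pe (ltW ep0) epeta F4 U1 U2 tailsum).
Qed.

End Martingale.

(** * Square roots of positive semidefinite matrices *)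

Lemma cvg_bigsum (R : realType) (T : Type) (F : set_system T) (FF : Filter F) (I : Type)
    (s : seq I) (f : I -> T -> R) (l : I -> R) :
  (forall i, f i x @[x --> F] --> l i) ->
  \sum_(i <- s) f i x @[x --> F] --> \sum_(i <- s) l i.
Proof.
move=> fl; elim: s => [|i s IH].
  rewrite big_nil (_ : (fun _ => _) = fun=> 0); first exact: cvg_cst.
  by apply/funext => x; rewrite big_nil.
rewrite big_cons (_ : (fun _ => _) = fun x => f i x + \sum_(j <- s) f j x).
  exact: cvgD.
by apply/funext => x; rewrite big_cons.
Qed.

Section QuadraticForms.
Variables (R : realType) (p : nat).
Implicit Types (u v : 'cV[R]_p) (S M : 'M[R]_p).

Definition bform S u v : R := (u^T *m S *m v) 0 0.
Definition normsq v : R := \sum_i v i 0 ^+ 2.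
Definition frob S : R := \sum_i \sum_j S i j ^+ 2.

(** The common source of Cauchy-Schwarz for sums and for semidefinite forms. A negative [c]
    contradicts the hypothesis at a large [t] and its opposite; [c = 0] forces [b = 0]. *)
Lemma discriminant (a b c : R) : (forall t, 0 <= a + 2 * t * b + t ^+ 2 * c) -> b ^+ 2 <= a * c.
Proof.
move=> h; have a0 : 0 <= a by have := h 0; rewrite expr0n !mulr0 !mul0r !addr0.
have [c0|c0|c0] := ltrgt0P c.
- have := h (- b / c).
  have -> : a + 2 * (- b / c) * b + (- b / c) ^+ 2 * c = (a * c - b ^+ 2) / c.
    by field; rewrite gt_eqF.
  by rewrite pmulr_lge0 ?invr_gt0 // subr_ge0.
- have c1 : 0 < - c by rewrite oppr_gt0.
  pose t := 1 + a / - c; have t1 : t * - c = a - c by rewrite /t; field; rewrite lt_eqF.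
  have t2 : 1 <= t by rewrite lerDl divr_ge0 // ltW.
  have := h t; have := h (- t); rewrite sqrrN; nra.
- subst c; rewrite mulr0; have [->|b0] := eqVneq b 0; first by rewrite expr0n.
  have b2 : 0 < b ^+ 2 by rewrite exprn_even_gt0.
  pose t := - b * ((a + 1) / b ^+ 2); have := h t.
  have -> : a + 2 * t * b + t ^+ 2 * 0 = - a - 2 by rewrite /t; field.
  lra.
Qed.

Lemma normr_sqr (x : R) : `|x| ^+ 2 = x ^+ 2.
Proof. by rewrite real_normK ?num_real. Qed.

Lemma sum_cauchy (I : finType) (a b : I -> R) :
  (\sum_i a i * b i) ^+ 2 <= (\sum_i a i ^+ 2) * (\sum_i b i ^+ 2).
Proof.
apply: discriminant => t.
have -> : \sum_i a i ^+ 2 + 2 * t * (\sum_i a i * b i) + t ^+ 2 * (\sum_i b i ^+ 2)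
   = \sum_i (a i + t * b i) ^+ 2.
  rewrite !mulr_sumr -!big_split /=; apply: eq_bigr => i _; ring.
by apply: sumr_ge0 => i _; exact: sqr_ge0.
Qed.

Lemma bformE S u v : bform S u v = \sum_i \sum_j u i 0 * S i j * v j 0.
Proof.
rewrite /bform mxE exchange_big /=; apply: eq_bigr => j _; rewrite mxE mulr_suml.
by apply: eq_bigr => i _; rewrite mxE.
Qed.

Lemma bform_mulr S u v : bform S u v = \sum_i u i 0 * (S *m v) i 0.
Proof.
rewrite bformE; apply: eq_bigr => i _; rewrite mxE mulr_sumr.
by apply: eq_bigr => j _; rewrite mulrA.
Qed.

Lemma bformC S u v : S^T = S -> bform S u v = bform S v u.
Proof.
move=> St; rewrite !bformE exchange_big /=; apply: eq_bigr => j _; apply: eq_bigr => i _.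
by rewrite -[in RHS]St mxE; ring.
Qed.

Lemma normsq_ge0 v : 0 <= normsq v.
Proof. by apply: sumr_ge0 => i _; exact: sqr_ge0. Qed.

Lemma normsq_eq0 v : normsq v = 0 -> v = 0.
Proof.
move/eqP; rewrite psumr_eq0 => [/allP h|i _]; last exact: sqr_ge0.
apply/matrixP => i j; rewrite ord1 mxE; have := h i (mem_index_enum _).
by rewrite /= sqrf_eq0 => /eqP.
Qed.

Lemma psd_cauchy S u v : psd S -> bform S u v ^+ 2 <= bform S u u * bform S v v.
Proof.
move=> [St Sp]; apply: discriminant => t.
have := Sp (u + t *: v); rewrite -/(bform S (u + t *: v) (u + t *: v)).
suff -> : bform S (u + t *: v) (u + t *: v) =
  bform S u u + 2 * t * bform S u v + t ^+ 2 * bform S v v by [].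
have -> : bform S (u + t *: v) (u + t *: v) =
   bform S u u + t * bform S u v + t * bform S v u + t ^+ 2 * bform S v v.
  rewrite !bformE !mulr_sumr -!big_split /=; apply: eq_bigr => i _.
  by rewrite !mulr_sumr -!big_split /=; apply: eq_bigr => j _; rewrite !mxE; ring.
by rewrite (bformC v u St); ring.
Qed.

Lemma bform1B S v : bform (1%:M - S) v v = normsq v - bform S v v.
Proof.
rewrite /bform mulmxBr mulmxBl mulmx1 [LHS]mxE [X in _ + X]mxE; congr (_ - _).
by rewrite mxE; apply: eq_bigr => i _; rewrite mxE expr2.
Qed.

Lemma bformZ (a : R) S u v : bform (a *: S) u v = a * bform S u v.
Proof. by rewrite /bform -scalemxAr -scalemxAl mxE. Qed.

Lemma bform_delta S i j : bform S (delta_mx i 0) (delta_mx j 0) = S i j.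
Proof.
rewrite bform_mulr (bigD1 i) //= big1 => [|k ki].
  by rewrite addr0 mxE !eqxx mul1r -colE mxE.
by rewrite mxE (negbTE ki) mul0r.
Qed.

Lemma normsq_delta j : normsq (delta_mx j 0) = 1.
Proof.
rewrite /normsq (bigD1 j) //= big1 => [|k ki]; first by rewrite mxE !eqxx expr1n addr0.
by rewrite mxE (negbTE ki) expr0n.
Qed.

Lemma psd_diag_ge0 S i : psd S -> 0 <= S i i.
Proof. by move=> [_ Sp]; rewrite -bform_delta; exact: Sp. Qed.

Lemma psd_trace_ge0 S : psd S -> 0 <= \tr S.
Proof. by move=> pS; apply: sumr_ge0 => i _; exact: psd_diag_ge0. Qed.

(** Cauchy-Schwarz on basis vectors gives [|S_ij| <= sqrt (S_ii S_jj)], so the form is at most the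
    square of a scalar product; this replaces a bound by the largest eigenvalue. *)
Lemma psd_le_trace S v : psd S -> bform S v v <= \tr S * normsq v.
Proof.
move=> pS; pose a i := Num.sqrt (S i i).
have aS i j : `|S i j| <= a i * a j.
  have := psd_cauchy (delta_mx i 0) (delta_mx j 0) pS; rewrite !bform_delta => h.
  rewrite -[leRHS]ger0_norm ?mulr_ge0 ?sqrtr_ge0 // -ler_sqr ?nnegrE // !normr_sqr.
  by rewrite exprMn !sqr_sqrtr ?psd_diag_ge0.
apply: (@le_trans _ _ ((\sum_i a i * `|v i 0|) ^+ 2)).
  rewrite bformE expr2 mulr_suml; apply: ler_sum => i _; rewrite mulr_sumr; apply: ler_sum => j _.
  apply: le_trans (ler_norm _) _; rewrite !normrM.
  have -> : a i * `|v i 0| * (a j * `|v j 0|) = `|v i 0| * (a i * a j) * `|v j 0| by ring.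
  by rewrite ler_wpM2r // ler_wpM2l.
apply: le_trans (sum_cauchy _ _) _; rewrite /normsq /mxtrace.
rewrite (eq_bigr (fun i => S i i)); last by move=> i _; rewrite sqr_sqrtr // psd_diag_ge0.
by rewrite [X in _ * X](eq_bigr (fun i => v i 0 ^+ 2)) // => i _; rewrite normr_sqr.
Qed.

Lemma psd_ker S v : psd S -> bform S v v = 0 -> S *m v = 0.
Proof.
move=> pS v0; apply/matrixP => i j; rewrite ord1 [RHS]mxE.
have := psd_cauchy (delta_mx i 0) v pS; rewrite v0 mulr0.
rewrite bform_mulr (bigD1 i) //= big1 => [|k ki]; last by rewrite mxE (negbTE ki) mul0r.
rewrite mxE !eqxx mul1r addr0 => h.
have /eqP : ((S *m v) i 0) ^+ 2 = 0 by apply/eqP; rewrite eq_le h sqr_ge0.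
by rewrite sqrf_eq0 => /eqP.
Qed.

Lemma normsq_mul_sym S v : S^T = S -> normsq (S *m v) = bform S v (S *m v).
Proof.
move=> St; rewrite bformC // bform_mulr; apply: eq_bigr => i _; by rewrite expr2.
Qed.

Lemma normsq_mul_sqr S v : S^T = S -> normsq (S *m v) = bform (S *m S) v v.
Proof.
by move=> St; rewrite normsq_mul_sym // /bform !mulmxA.
Qed.

(** Cauchy-Schwarz for the form at [v] and [S v] gives [|S v|^4 <= (v' S v) (tr S |S v|^2)], and one
    factor [|S v|^2] cancels. *)
Lemma psd_mul_le_trace S v : psd S -> normsq (S *m v) <= \tr S * bform S v v.
Proof.
move=> pS; have [St Sp] := pS.
have := psd_cauchy v (S *m v) pS; rewrite -normsq_mul_sym // => h.
have h2 := psd_le_trace (S *m v) pS.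
have N0 := normsq_ge0 (S *m v).
have q0 : 0 <= bform S v v := Sp v.
have [z|nz] := eqVneq (normsq (S *m v)) 0.
  by rewrite z mulr_ge0 // psd_trace_ge0.
have Np : 0 < normsq (S *m v) by rewrite lt_def nz.
rewrite -(ler_pM2r Np) -expr2; apply: le_trans h _.
rewrite (mulrC (\tr S)) -mulrA ler_wpM2l //.
Qed.

Lemma frob_ge0 S : 0 <= frob S.
Proof. by apply: sumr_ge0 => i _; apply: sumr_ge0 => j _; exact: sqr_ge0. Qed.

Lemma frob_eq0 S : frob S = 0 -> S = 0.
Proof.
move/eqP; rewrite psumr_eq0 => [/allP h|i _]; last by apply: sumr_ge0 => j _; exact: sqr_ge0.
apply/matrixP => i j; rewrite mxE; have := h i (mem_index_enum _) => /=.
rewrite psumr_eq0 => [/allP/(_ j (mem_index_enum _))|k _]; last exact: sqr_ge0.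
by rewrite /= sqrf_eq0 => /eqP.
Qed.

Lemma mxtrace_sand S M : M^T = M -> \tr (M *m S *m M) = \sum_j bform S (col j M) (col j M).
Proof.
move=> Mt; apply: eq_bigr => j _; rewrite /bform !mxE; apply: eq_bigr => k _.
rewrite !mxE; congr (_ * _); apply: eq_bigr => l _; rewrite !mxE.
by rewrite -[in LHS]Mt mxE.
Qed.

Lemma frob_trace S : S^T = S -> frob S = \tr (S *m S).
Proof.
move=> St; apply: eq_bigr => i _; rewrite mxE; apply: eq_bigr => j _.
by rewrite -[in X in _ * X]St mxE expr2.
Qed.

Lemma frob_trace_cauchy S M : S^T = S -> \tr (S *m M) ^+ 2 <= frob S * frob M.
Proof.
move=> St.
have -> : \tr (S *m M) = \sum_(x : 'I_p * 'I_p) S x.1 x.2 * M x.1 x.2.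
  rewrite -(pair_bigA _ (fun i j => S i j * M i j)) /= exchange_big.
  apply: eq_bigr => i _; rewrite mxE; apply: eq_bigr => j _.
  by rewrite -[in LHS]St mxE.
apply: le_trans (sum_cauchy _ _) _.
by rewrite -(pair_bigA _ (fun i j => S i j ^+ 2)) -(pair_bigA _ (fun i j => M i j ^+ 2)).
Qed.

(** With [D = S1 - S2] one has [S1^2 - S2^2 = S1 D + D S2]. This identity yields both uniqueness of
    the square root and its Lipschitz bound. *)
Lemma sqrt_diff_trace S1 S2 : \tr ((S1 - S2) *m (S1 *m S1 - S2 *m S2)) =
  \tr ((S1 - S2) *m S1 *m (S1 - S2)) + \tr ((S1 - S2) *m S2 *m (S1 - S2)).
Proof.
set D := S1 - S2.
have -> : S1 *m S1 - S2 *m S2 = S1 *m D + D *m S2.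
  by rewrite /D mulmxBr mulmxBl addrA subrK.
rewrite mulmxDr mxtraceD !mulmxA; congr (_ + _).
by rewrite [RHS]mxtrace_mulC mulmxA.
Qed.

(** Both traces of the identity are sums of nonnegative forms, so they vanish; then
    [S1 D = S2 D = 0], hence [D^2 = 0] and [D = 0]. *)
Lemma psd_sqrt_unique S1 S2 : psd S1 -> psd S2 -> S1 *m S1 = S2 *m S2 -> S1 = S2.
Proof.
move=> p1 p2 E; have := sqrt_diff_trace S1 S2; rewrite E subrr mulmx0 mxtrace0.
set D := S1 - S2.
have Dt : D^T = D by rewrite /D linearB /= p1.1 p2.1.
rewrite !mxtrace_sand // => /esym/eqP.
have s0 S : psd S -> 0 <= \sum_j bform S (col j D) (col j D).
  by move=> pS; apply: sumr_ge0 => j _; exact: pS.2.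
rewrite paddr_eq0 ?s0 // => /andP[/eqP z1 /eqP z2].
have kill S : psd S -> \sum_j bform S (col j D) (col j D) = 0 -> S *m D = 0.
  move=> pS /eqP; rewrite psumr_eq0 => [/allP h|j _]; last exact: pS.2.
  apply/matrixP => i j; have /eqP/(psd_ker pS)/matrixP/(_ i 0) := h j (mem_index_enum _).
  by rewrite colE mulmxA -colE !mxE.
have DD : D *m D = 0 by rewrite {1}/D mulmxBl !kill // subrr.
have : frob D = 0 by rewrite frob_trace // DD mxtrace0.
by move/frob_eq0/eqP; rewrite subr_eq0 => /eqP.
Qed.

(** The term with [S1] is nonnegative and the term with [S2] is at least [c |D|^2]; Cauchy-Schwarz
    for the trace bounds their sum by [|D| |E|]. So coercivity of one root is enough. *)
Lemma psd_sqrt_perturb S1 S2 (c : R) : psd S1 -> psd S2 -> 0 < c ->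
  (forall v, c * normsq v <= bform S2 v v) ->
  c ^+ 2 * frob (S1 - S2) <= frob (S1 *m S1 - S2 *m S2).
Proof.
move=> p1 p2 c0 cS; have := sqrt_diff_trace S1 S2.
set D := S1 - S2; set E := _ - _.
have Dt : D^T = D by rewrite /D linearB /= p1.1 p2.1.
rewrite !mxtrace_sand // => tE.
have h1 : c * frob D <= \tr (D *m E).
  rewrite tE; apply: (@le_trans _ _ (\sum_j bform S2 (col j D) (col j D))); last first.
    by rewrite lerDr; apply: sumr_ge0 => j _; exact: p1.2.
  rewrite /frob exchange_big mulr_sumr; apply: ler_sum => j _.
  have := cS (col j D).
  by rewrite (_ : normsq (col j D) = \sum_i D i j ^+ 2) //; apply: eq_bigr => i _; rewrite mxE.
have h2 := frob_trace_cauchy E Dt.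
have D0 := frob_ge0 D.
have [z|nz] := eqVneq (frob D) 0; first by rewrite z mulr0 frob_ge0.
have Dp : 0 < frob D by rewrite lt_def nz.
rewrite -(ler_pM2l Dp); apply: le_trans h2.
have -> : frob D * (c ^+ 2 * frob D) = (c * frob D) ^+ 2 by ring.
have cf : 0 <= c * frob D by rewrite mulr_ge0 // ltW.
by rewrite !expr2; apply: ler_pM.
Qed.

Lemma trace_sqr_le S : S^T = S -> (\tr S) ^+ 2 <= p%:R * \tr (S *m S).
Proof.
move=> St; rewrite -frob_trace //.
have -> : \tr S = \sum_i S i i * 1 by apply: eq_bigr => i _; rewrite mulr1.
apply: le_trans (sum_cauchy _ _) _.
rewrite [X in _ * X](_ : _ = p%:R); last first.
  by rewrite (eq_bigr (fun=> 1)) ?sumr_const ?card_ord // => i _; rewrite expr1n.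
rewrite mulrC ler_wpM2l //; apply: ler_sum => i _.
by rewrite (bigD1 i) //= lerDl; apply: sumr_ge0 => j _; exact: sqr_ge0.
Qed.

(** From [c |v|^2 <= |S v|^2 <= tr S (v' S v)]: a lower bound passes to the square root without
    eigenvalues. *)
Lemma psd_sqrt_lower S (c t : R) v : psd S -> \tr S <= t -> 0 < t ->
  c * normsq v <= bform (S *m S) v v -> c / t * normsq v <= bform S v v.
Proof.
move=> pS St t0 h; rewrite mulrAC ler_pdivrMr //; apply: le_trans h _.
rewrite -normsq_mul_sqr ?pS.1 //; apply: le_trans (psd_mul_le_trace v pS) _.
by rewrite mulrC ler_wpM2l //; exact: pS.2.
Qed.

Definition enorm v : R := Num.sqrt (normsq v).

Lemma enorm_ge0 v : 0 <= enorm v. Proof. exact: sqrtr_ge0. Qed.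

Lemma enorm_sqr v : enorm v ^+ 2 = normsq v.
Proof. by rewrite sqr_sqrtr ?normsq_ge0. Qed.

Lemma dot_le_enorm u v : `|\sum_i u i 0 * v i 0| <= enorm u * enorm v.
Proof.
rewrite -[leRHS]ger0_norm ?mulr_ge0 ?enorm_ge0 // -ler_sqr ?nnegrE // !normr_sqr.
by rewrite exprMn !enorm_sqr sum_cauchy.
Qed.

Lemma enormD u v : enorm (u + v) <= enorm u + enorm v.
Proof.
rewrite -ler_sqr ?nnegrE ?addr_ge0 ?enorm_ge0 // enorm_sqr.
have -> : normsq (u + v) = normsq u + normsq v + 2 * (\sum_i u i 0 * v i 0).
  rewrite /normsq mulr_sumr -!big_split /=; apply: eq_bigr => i _; rewrite mxE; ring.
have := dot_le_enorm u v; rewrite sqrrD !enorm_sqr.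
have := ler_norm (\sum_i u i 0 * v i 0); lra.
Qed.

Lemma enormZ (a : R) v : enorm (a *: v) = `|a| * enorm v.
Proof.
rewrite /enorm -sqrtr_sqr -sqrtrM ?sqr_ge0 //; congr Num.sqrt.
by rewrite /normsq mulr_sumr; apply: eq_bigr => i _; rewrite mxE exprMn.
Qed.

Lemma enorm0 : enorm 0 = 0.
Proof. by rewrite /enorm /normsq big1 ?sqrtr0 // => i _; rewrite mxE expr0n. Qed.

Lemma entry_le_enorm v i : `|v i 0| <= enorm v.
Proof.
rewrite -ler_sqr ?nnegrE ?enorm_ge0 // normr_sqr enorm_sqr /normsq (bigD1 i) //= lerDl.
by apply: sumr_ge0 => j _; exact: sqr_ge0.
Qed.

Lemma enorm_eq0 v : enorm v = 0 -> v = 0.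
Proof. by move=> v0; apply: normsq_eq0; rewrite -enorm_sqr v0 expr0n. Qed.

(* Nonnegative combinations of powers of [B]; the index is the value at [B = 1]. *)
Inductive nncomb (B : 'M[R]_p) : 'M[R]_p -> R -> Prop :=
| nncomb0 : nncomb B 0 0
| nncombB : nncomb B B 1
| nncombD Z1 w1 Z2 w2 : nncomb B Z1 w1 -> nncomb B Z2 w2 -> nncomb B (Z1 + Z2) (w1 + w2)
| nncombM Z1 w1 Z2 w2 : nncomb B Z1 w1 -> nncomb B Z2 w2 -> nncomb B (Z1 *m Z2) (w1 * w2)
| nncombZ c Z w : 0 <= c -> nncomb B Z w -> nncomb B (c *: Z) (c * w).

Lemma nncomb_ge0 B Z w : nncomb B Z w -> 0 <= w.
Proof.
by elim=> // [*|*|c Z' w' c0 _ w0]; [exact: addr_ge0|exact: mulr_ge0|exact: mulr_ge0].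
Qed.

Lemma nncomb_commB B Z w : nncomb B Z w -> Z *m B = B *m Z.
Proof.
elim=> // [|Z1 w1 Z2 w2 _ h1 _ h2|Z1 w1 Z2 w2 _ h1 _ h2|c Z' w' _ _ h].
- by rewrite mul0mx mulmx0.
- by rewrite mulmxDl mulmxDr h1 h2.
- by rewrite -mulmxA h2 mulmxA h1 mulmxA.
- by rewrite -scalemxAl h scalemxAr.
Qed.

Lemma nncomb_comm B Z w Z' w' : nncomb B Z w -> nncomb B Z' w' -> Z *m Z' = Z' *m Z.
Proof.
move=> hZ; elim=> [||Z1 w1 Z2 w2 _ h1 _ h2|Z1 w1 Z2 w2 _ h1 _ h2|c Z1 w1 _ _ h].
- by rewrite mul0mx mulmx0.
- exact: nncomb_commB hZ.
- by rewrite mulmxDl mulmxDr h1 h2.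
- by rewrite mulmxA h1 -mulmxA h2 mulmxA.
- by rewrite -scalemxAl -h scalemxAr.
Qed.

Lemma nncomb_sym B Z w : B^T = B -> nncomb B Z w -> Z^T = Z.
Proof.
move=> Bt; elim=> // [|Z1 w1 Z2 w2 _ h1 _ h2|Z1 w1 Z2 w2 n1 h1 n2 h2|c Z' w' _ _ h].
- by rewrite trmx0.
- by rewrite linearD /= h1 h2.
- by rewrite trmx_mul h1 h2 (nncomb_comm n2 n1).
- by rewrite linearZ /= h.
Qed.

(** Since [B] is a contraction and coefficients are nonnegative, the scalar iteration at 1 dominates
    the matrix one in norm. *)
Lemma nncomb_norm B Z w v : (forall v, enorm (B *m v) <= enorm v) -> nncomb B Z w ->
  enorm (Z *m v) <= w * enorm v.
Proof.
move=> hB hZ; elim: hZ v => [|v|Z1 w1 Z2 w2 _ h1 _ h2 v|Z1 w1 Z2 w2 n1 h1 n2 h2 v|c Z' w' c0 _ h v].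
- by move=> v; rewrite mul0mx enorm0 mul0r.
- by rewrite mul1r.
- by rewrite mulmxDl mulrDl; apply: le_trans (enormD _ _) _; exact: lerD.
- rewrite -mulmxA -mulrA; apply: le_trans (h1 _) _.
  by rewrite ler_wpM2l // (nncomb_ge0 n1).
- by rewrite -scalemxAl enormZ ger0_norm // -mulrA ler_wpM2l.
Qed.

Lemma nncomb_entry B Z w i j : (forall v, enorm (B *m v) <= enorm v) -> nncomb B Z w ->
  `|Z i j| <= w.
Proof.
move=> hB hZ; have := nncomb_norm (delta_mx j 0) hB hZ.
have -> : enorm (delta_mx j 0) = 1 by rewrite /enorm normsq_delta sqrtr1.
rewrite mulr1; apply: le_trans; apply: le_trans (entry_le_enorm _ i).
by rewrite -colE mxE.
Qed.

(* For [0 <= B <= 1] the iterates increase to [1 - sqrt (1 - B)]; being polynomial in [B], they make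
   the square root a measurable function of its argument. *)
Fixpoint sqrt_iter (B : 'M[R]_p) (n : nat) : 'M[R]_p :=
  if n is n'.+1 then 2^-1 *: (B + sqrt_iter B n' *m sqrt_iter B n') else 0.

Fixpoint sqrt_wt (n : nat) : R := if n is n'.+1 then 2^-1 * (1 + sqrt_wt n' * sqrt_wt n') else 0.

Lemma sqrt_iter_comb B n : nncomb B (sqrt_iter B n) (sqrt_wt n).
Proof.
elim: n => [|n IH] /=; first exact: nncomb0.
apply: nncombZ; first by rewrite invr_ge0.
apply: nncombD; [exact: nncombB|exact: nncombM].
Qed.

(** The iterates commute, so the next increment is [(Y1 - Y0)(Y1 + Y0) / 2], again a nonnegative
    combination. Its weight is the scalar increment, whose sum is bounded. *)
Lemma sqrt_iter_step B n :
  nncomb B (sqrt_iter B n.+1 - sqrt_iter B n) (sqrt_wt n.+1 - sqrt_wt n).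
Proof.
elim: n => [|n IH].
  rewrite /= !subr0 mulmx0 mulr0 !addr0.
  by apply: nncombZ; [rewrite invr_ge0|exact: nncombB].
set Y1 := sqrt_iter B n.+1; set Y0 := sqrt_iter B n.
set w1 := sqrt_wt n.+1; set w0 := sqrt_wt n.
have -> : sqrt_iter B n.+2 - Y1 = 2^-1 *: ((Y1 - Y0) *m (Y1 + Y0)).
  rewrite {2}/Y1 /= -/Y0 -scalerBr opprD addrACA subrr add0r mulmxBl !mulmxDr.
  by rewrite (nncomb_comm (sqrt_iter_comb B n) (sqrt_iter_comb B n.+1)) opprD addrA addrK.
have -> : sqrt_wt n.+2 - w1 = 2^-1 * ((w1 - w0) * (w1 + w0)).
  have E1 : w1 = 2^-1 * (1 + w0 * w0) by [].
  have -> : sqrt_wt n.+2 = 2^-1 * (1 + w1 * w1) by [].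
  transitivity (2^-1 * (1 + w1 * w1) - 2^-1 * (1 + w0 * w0)); first by rewrite -E1.
  by ring.
apply: nncombZ; first by rewrite invr_ge0.
by apply: nncombM => //; apply: nncombD; exact: sqrt_iter_comb.
Qed.

Lemma sqrt_wt_mono : nondecreasing_seq sqrt_wt.
Proof.
apply/nondecreasing_seqP => n; rewrite -subr_ge0.
(* The weights do not depend on the matrix, so the instance [B = 0] serves. *)
exact: (nncomb_ge0 (sqrt_iter_step 0 n)).
Qed.

Lemma sqrt_wt_ge0 n : 0 <= sqrt_wt n.
Proof. exact: (nncomb_ge0 (sqrt_iter_comb 0 n)). Qed.

Lemma sqrt_wt_le1 n : sqrt_wt n <= 1.
Proof.
elim: n => [|n IH] /=; first exact: ler01.
have : sqrt_wt n * sqrt_wt n <= 1 by rewrite mulr_ile1 // sqrt_wt_ge0.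
lra.
Qed.

Section Limit.
Variable B : 'M[R]_p.
Hypothesis pB : psd B.
Hypothesis B1 : forall v, bform B v v <= normsq v.

Lemma contraction v : enorm (B *m v) <= enorm v.
Proof.
rewrite -ler_sqr ?nnegrE ?enorm_ge0 // !enorm_sqr.
have := psd_cauchy v (B *m v) pB; rewrite -normsq_mul_sym ?pB.1 // => h.
have h1 := B1 v; have h2 := B1 (B *m v).
have q0 : 0 <= bform B v v := pB.2 v.
have N0 := normsq_ge0 (B *m v); have Nv := normsq_ge0 v.
have [z|nz] := eqVneq (normsq (B *m v)) 0; first by rewrite z.
have Np : 0 < normsq (B *m v) by rewrite lt_def nz.
rewrite -(ler_pM2r Np) -expr2; apply: le_trans h _; apply: ler_pM => //.
exact: pB.2.
Qed.

Definition sqrt_lim : 'M[R]_p := \matrix_(i, j) lim (sqrt_iter B n i j @[n --> \oo]).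

Lemma sqrt_iter_cvg i j : sqrt_iter B n i j @[n --> \oo] --> sqrt_lim i j.
Proof.
rewrite /sqrt_lim mxE.
have cw : cvg (sqrt_wt @ \oo).
  apply: nondecreasing_is_cvgn; first exact: sqrt_wt_mono.
  by exists 1 => _ [n _ <-]; exact: sqrt_wt_le1.
have step n : `|sqrt_iter B n.+1 i j - sqrt_iter B n i j| <= sqrt_wt n.+1 - sqrt_wt n.
  have := nncomb_entry i j contraction (sqrt_iter_step B n).
  by rewrite !mxE.
(* Increments of an entry are at most those of the weights in absolute value, so entry plus weight
   is nondecreasing, and bounded by 2. *)
have ca : cvg ((fun n => sqrt_iter B n i j + sqrt_wt n) @ \oo).
  apply: nondecreasing_is_cvgn.
    apply/nondecreasing_seqP => n; have := step n; rewrite ler_norml => /andP[h _].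
    by rewrite -subr_ge0; move: h; set y1 := sqrt_iter B n.+1 i j; set w1 := sqrt_wt n.+1; lra.
  exists 2 => _ [n _ <-]; have := nncomb_entry i j contraction (sqrt_iter_comb B n).
  rewrite ler_norml => /andP[_]; have := sqrt_wt_le1 n; lra.
have -> : (fun n => sqrt_iter B n i j) = (fun n => (sqrt_iter B n i j + sqrt_wt n) - sqrt_wt n).
  by apply/funext => n; rewrite addrK.
exact: is_cvgB ca cw.
Qed.

(** The fixed-point equation [2 Y = B + Y^2] is [(1 - Y)^2 = 1 - B] in disguise. *)
Lemma sqrt_lim_eq : sqrt_lim = 2^-1 *: (B + sqrt_lim *m sqrt_lim).
Proof.
apply/matrixP => i j.
have c1 : sqrt_iter B n.+1 i j @[n --> \oo] --> sqrt_lim i j.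
  by have := sqrt_iter_cvg (i := i) (j := j); rewrite -(cvg_shiftS (fun n => sqrt_iter B n i j)).
apply: (cvg_unique _ c1) => //.
rewrite (_ : (fun n => sqrt_iter B n.+1 i j) =
  fun n => 2^-1 * (B i j + \sum_k sqrt_iter B n i k * sqrt_iter B n k j)); last first.
  by apply/funext => n; rewrite !mxE.
rewrite !mxE; apply: cvgM; first exact: cvg_cst.
apply: cvgD; first exact: cvg_cst.
apply: cvg_bigsum => k; apply: cvgM; exact: sqrt_iter_cvg.
Qed.

Lemma sqrt_lim_psd : psd (1%:M - sqrt_lim).
Proof.
have Yt : sqrt_lim^T = sqrt_lim.
  apply/matrixP => i j; rewrite mxE; apply: (cvg_unique _ (@sqrt_iter_cvg j i)) => //.
  rewrite (_ : (fun n => sqrt_iter B n j i) = fun n => sqrt_iter B n i j); first exact: sqrt_iter_cvg.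
  by apply/funext => n; rewrite -[in LHS](nncomb_sym pB.1 (sqrt_iter_comb B n)) mxE.
split; first by rewrite linearB /= trmx1 Yt.
move=> v; rewrite -/(bform _ v v) bform1B subr_ge0 bformE.
have c : (\sum_i \sum_j v i 0 * sqrt_iter B n i j * v j 0) @[n --> \oo] -->
   \sum_i \sum_j v i 0 * sqrt_lim i j * v j 0.
  apply: cvg_bigsum => i; apply: cvg_bigsum => j; apply: cvgM; last exact: cvg_cst.
  by apply: cvgM; [exact: cvg_cst|exact: sqrt_iter_cvg].
rewrite -(cvg_lim (@Rhausdorff R) c); apply: limr_le; first by apply/cvg_ex; eexists; exact: c.
near=> n.
rewrite -bformE bform_mulr; apply: le_trans (ler_norm _) _.
apply: le_trans (dot_le_enorm _ _) _; rewrite -enorm_sqr expr2 ler_wpM2l ?enorm_ge0 //.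
apply: le_trans (nncomb_norm v contraction (sqrt_iter_comb B n)) _.
by rewrite ler_piMl ?enorm_ge0 // sqrt_wt_le1.
Unshelve. all: by end_near.
Qed.

Lemma sqrt_lim_sqr : (1%:M - sqrt_lim) *m (1%:M - sqrt_lim) = 1%:M - B.
Proof.
rewrite mulmxBr !mulmxBl !mulmx1 mul1mx.
have : 2 *: sqrt_lim = B + sqrt_lim *m sqrt_lim.
  by rewrite {1}sqrt_lim_eq scalerA divff // scale1r.
set Y := sqrt_lim; set Y2 := Y *m Y => h.
have -> : Y2 = Y + Y - B by rewrite -mulr2n -scaler_nat h addrC addKr.
apply/matrixP => i j; rewrite !mxE; ring.
Qed.

End Limit.

(** Dividing by the trace, which dominates the form, puts [1 - M / tr M] between 0 and 1, where the
    iteration converges. This explicit limit identifies the matrix that [sqrtmx] selects by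
    choice. *)
Definition psd_sqrt M : 'M[R]_p :=
  Num.sqrt (\tr M) *: (1%:M - sqrt_lim (1%:M - (\tr M)^-1 *: M)).

Lemma residual_psd M : psd M -> psd (1%:M - (\tr M)^-1 *: M) /\
  forall v, bform (1%:M - (\tr M)^-1 *: M) v v <= normsq v.
Proof.
move=> pM; have [Mt Mp] := pM; have t0 := psd_trace_ge0 pM.
set B := 1%:M - (\tr M)^-1 *: M.
have bB v : bform B v v = normsq v - (\tr M)^-1 * bform M v v.
  by rewrite bform1B bformZ.
have ti : 0 <= (\tr M)^-1 by rewrite invr_ge0.
split; last by move=> v; rewrite bB gerBl mulr_ge0 //; exact: Mp.
split; first by rewrite /B linearB /= trmx1 linearZ /= Mt.
move=> v; rewrite -/(bform B v v) bB subr_ge0.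
have [z|nz] := eqVneq (\tr M) 0; first by rewrite z invr0 mul0r normsq_ge0.
have tp : 0 < \tr M by rewrite lt_def nz.
by rewrite ler_pdivrMl //; exact: psd_le_trace.
Qed.

Lemma psd_sqrtP M : psd M -> is_psd_sqrt (psd_sqrt M) M.
Proof.
move=> pM; have [Mt Mp] := pM; have t0 := psd_trace_ge0 pM.
set B := 1%:M - (\tr M)^-1 *: M.
have [pB B1] := residual_psd pM.
have [St Sp] := sqrt_lim_psd pB B1.
rewrite /psd_sqrt -/B; split; first split.
- by rewrite linearZ /= St.
- move=> v; rewrite -scalemxAr -scalemxAl mxE mulr_ge0 ?sqrtr_ge0 //; exact: Sp.
- rewrite -scalemxAr -scalemxAl scalerA -expr2 sqr_sqrtr // sqrt_lim_sqr //.
  rewrite /B opprB addrCA subrr addr0 scalerA.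
  have [z|nz] := eqVneq (\tr M) 0; last by rewrite divff // scale1r.
  (* When the trace is 0 the candidate is 0, and the trace bound with Cauchy-Schwarz makes every
     entry of [M] vanish. *)
  rewrite z mul0r scale0r; apply/matrixP => i j; rewrite mxE -bform_delta; apply/esym/eqP.
  have := psd_cauchy (delta_mx i 0) (delta_mx j 0) pM.
  have := psd_le_trace (delta_mx i 0) pM; rewrite z mul0r => h1.
  have h2 : 0 <= bform M (delta_mx i 0) (delta_mx i 0) := Mp _.
  have -> : bform M (delta_mx i 0) (delta_mx i 0) = 0 by apply/eqP; rewrite eq_le h1 h2.
  by rewrite mul0r => h; rewrite -sqrf_eq0 eq_le h sqr_ge0.
Qed.

Lemma sqrtmxE M : psd M -> sqrtmx M = psd_sqrt M.
Proof.
move=> /psd_sqrtP h; have [p1 e1] := h.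
have [p2 e2] : is_psd_sqrt (sqrtmx M) M.
  exact: (@xgetI _ 0 [set S | is_psd_sqrt S M] (psd_sqrt M) h).
by apply: psd_sqrt_unique => //; rewrite e1 e2.
Qed.

Lemma sqrtmxP M : psd M -> is_psd_sqrt (sqrtmx M) M.
Proof. by move=> pM; rewrite sqrtmxE //; exact: psd_sqrtP. Qed.

End QuadraticForms.

(** * Stability of the companion matrix *)

Lemma dot_mul (R : realType) (p : nat) (u v : 'cV[R]_p) : (u^T *m v) 0 0 = \sum_i u i 0 * v i 0.
Proof. by rewrite mxE; apply: eq_bigr => i _; rewrite mxE. Qed.

Lemma normsq_mul (R : realType) (p : nat) (u : 'cV[R]_p) : (u^T *m u) 0 0 = normsq u.
Proof. by rewrite dot_mul; apply: eq_bigr => i _; rewrite expr2. Qed.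

Section Companion.
Variables (R : realType) (p : nat).
Implicit Types (th y v : 'cV[R]_p.+1).

Definition compan th : 'M[R]_p.+1 := \matrix_(i, j)
  if unlift ord0 i is Some i' then (widen_ord (leqnSn p) i' == j)%:R else th j 0.

Definition toep y : 'M[R]_p.+1 := \matrix_(i, j) y (inord `|i - j|%N) 0.

Lemma compan_mul0 th m (B : 'M[R]_(p.+1, m)) j : (compan th *m B) ord0 j = \sum_l th l 0 * B l j.
Proof. by rewrite mxE; apply: eq_bigr => l _; rewrite mxE unlift_none. Qed.

Lemma compan_mulS th m (B : 'M[R]_(p.+1, m)) i j :
  (compan th *m B) (lift ord0 i) j = B (widen_ord (leqnSn p) i) j.
Proof.
rewrite mxE (bigD1 (widen_ord (leqnSn p) i)) //= big1 => [|l li].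
  by rewrite mxE liftK eqxx mul1r addr0.
by rewrite mxE liftK eq_sym (negbTE li) mul0r.
Qed.

Lemma thc_ord th (i : 'I_p.+1) : thc th i.+1 = th i 0.
Proof. by rewrite /thc valK. Qed.

Lemma ar_X0 th e : ar_X th e 0 = 0.
Proof. by apply/matrixP => i j; rewrite !mxE nth_nil. Qed.

Lemma ar_XS th e n : ar_X th e n.+1 = compan th *m ar_X th e n + e n *: delta_mx ord0 0.
Proof.
apply/matrixP => i j; rewrite ord1 [RHS]mxE [X in _ = _ + X]mxE [X in _ * X]mxE.
case: (unliftP ord0 i) => [i' ->|->].
  by rewrite compan_mulS !mxE /= mulr0 addr0.
rewrite compan_mul0 !mxE /= mulr1; congr (_ + _); apply: eq_bigr => k _.
by rewrite mxE.
Qed.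

Lemma ar_xE th e n : ar_x th e n = ar_X th e n ord0 0.
Proof. by rewrite mxE. Qed.

Lemma toep_sym y : (toep y)^T = toep y.
Proof. by apply/matrixP => i j; rewrite !mxE distnC. Qed.

Lemma toepC y i j : toep y i j = toep y j i.
Proof. by rewrite !mxE distnC. Qed.

Lemma toep_widen y (i j : 'I_p) :
  toep y (lift ord0 i) (lift ord0 j) = toep y (widen_ord (leqnSn p) i) (widen_ord (leqnSn p) j).
Proof. by rewrite !mxE /= /bump /= distnDl. Qed.

Lemma toep_col0 y i : toep y i ord0 = y i 0.
Proof. by rewrite mxE (_ : `|i - @ord0 p|%N = i) ?inord_val //; exact: distn0. Qed.

Section Lyapunov.
Variables (th y : 'cV[R]_p.+1).
Hypothesis y0 : y ord0 0 = 1.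
Hypothesis yule : forall j : 'I_p, y (lift ord0 j) 0 = (toep y *m th) (widen_ord (leqnSn p) j) 0.

Definition defect : R := 1 - bform (toep y) th th.

(* With [A] the companion matrix and [L] the Toeplitz matrix, the Yule system says that
   [A L A^T = L - s b b^T], where [b] is the first basis vector. *)
Lemma lyapunov : compan th *m toep y *m (compan th)^T = toep y - defect *: delta_mx ord0 ord0.
Proof.
set A := compan th; set L := toep y.
have key (j : 'I_p) : \sum_l th l 0 * L l (widen_ord (leqnSn p) j) = y (lift ord0 j) 0.
  rewrite yule mxE; apply: eq_bigr => l _.
  by rewrite mulrC toepC.
have -> : A *m L *m A^T = A *m (A *m L)^T by rewrite trmx_mul toep_sym mulmxA.
apply/matrixP => i j; rewrite [RHS]mxE [X in _ = _ + X]mxE [X in _ = _ - X]mxE [X in _ * X]mxE.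
case: (unliftP ord0 i) => [i' ->|->]; case: (unliftP ord0 j) => [j' ->|->] /=.
- rewrite compan_mulS mxE compan_mulS mulr0 subr0 -toep_widen.
  by rewrite toepC.
- by rewrite compan_mulS mxE compan_mul0 key mulr0 subr0 toep_col0.
- rewrite compan_mul0 mulr0 subr0.
  under eq_bigr do rewrite mxE compan_mulS.
  rewrite [in RHS]toepC toep_col0 -key; apply: eq_bigr => l _.
  by rewrite toepC.
- rewrite compan_mul0 mulr1 toep_col0 y0 /defect opprB addrC subrK bform_mulr.
  apply: eq_bigr => l _; rewrite mxE compan_mul0 mxE; congr (_ * _); apply: eq_bigr => k _.
  by rewrite mulrC toepC.
Qed.

Lemma lyapunov_form v :
  bform (toep y) ((compan th)^T *m v) ((compan th)^T *m v) =
  bform (toep y) v v - defect * v ord0 0 ^+ 2.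
Proof.
have -> : bform (toep y) ((compan th)^T *m v) ((compan th)^T *m v) =
  bform (compan th *m toep y *m (compan th)^T) v v.
  by rewrite /bform trmx_mul trmxK !mulmxA.
rewrite lyapunov /bform mulmxBr mulmxBl [LHS]mxE [X in _ + X]mxE; congr (_ - _).
rewrite -/(bform _ v v) bformZ; congr (_ * _).
rewrite bform_mulr (bigD1 ord0) //= big1 => [|i i0]; last first.
  by rewrite mxE big1 ?mulr0 // => k _; rewrite mxE (negbTE i0) mul0r.
rewrite addr0 mxE (bigD1 ord0) //= big1 => [|i i0]; last first.
  by rewrite mxE (negbTE i0) andbF mul0r.
by rewrite mxE !eqxx mul1r addr0 expr2.
Qed.

Hypothesis Lpd : posdef (toep y).

Lemma posdef_psd : psd (toep y).
Proof.
split; first exact: toep_sym.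
move=> v; have [->|v0] := eqVneq v 0; first by rewrite mulmx0 mxE.
exact/ltW/Lpd.
Qed.

Hypothesis c1 : cond1 th.

(* A root [z] of the characteristic polynomial gives an eigenvector [a + i b] of [A^T], so that
   [|A^T a|_L^2 + |A^T b|_L^2 = |z|^2 (|a|_L^2 + |b|_L^2)], while the left-hand side is
   [|a|_L^2 + |b|_L^2 - s] by the Lyapunov identity. *)
Lemma defect_ge0 : 0 <= defect.
Proof.
have szP : (size (Defs.char_poly th) != 1)%N.
  have hs : (size (\sum_(i < p.+1) ((th i 0)%:C)%C%:P * 'X^(p.+1 - i.+1))%R < p.+2)%N.
    rewrite ltnS; apply: leq_trans (size_sum _ _ _) _; apply/bigmax_leqP => i _.
    rewrite mul_polyC; apply: leq_trans (size_scale_leq _ _) _.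
    by rewrite size_polyXn ltnS subSS leq_subr.
  by rewrite /Defs.char_poly size_polyDl ?size_polyXn // size_polyN.
have [z rz] := closed_rootP _ szP.
have zn := c1 rz.
(* Horner's partial values of the characteristic polynomial at [z]. They end with [w (p + 1) = 0],
   which makes them an eigenvector of the transposed companion matrix with first entry 1. *)
pose w : nat -> R[i] := fix w k := if k is k'.+1 then z * w k' - ((thc th k'.+1)%:C)%C else 1.
have wE k : w k = z ^+ k - \sum_(i < k) ((thc th i.+1)%:C)%C * z ^+ (k - i.+1).
  elim: k => [|k IH]; first by rewrite big_ord0 subr0.
  rewrite /= -/(w k) IH big_ord_recr /= subnn expr0 mulr1 mulrBr -exprS opprD addrA; congr (_ - _ - _).
  rewrite mulr_sumr; apply: eq_bigr => i _; rewrite mulrCA -exprS subSS; congr (_ * _ ^+ _).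
  by rewrite -subSn.
have w0 : w p.+1 = 0.
  move/rootP: rz => <-; rewrite wE /Defs.char_poly hornerD hornerXn hornerN horner_sum; congr (_ - _).
  by apply: eq_bigr => i _; rewrite hornerM hornerC hornerXn thc_ord.
pose a : 'cV[R]_p.+1 := \col_i complex.Re (w i).
pose b : 'cV[R]_p.+1 := \col_i complex.Im (w i).
pose x := complex.Re z; pose t := complex.Im z.
(* The value 0 beyond the last index agrees with [w (p + 1) = 0]. *)
have Ac v (j : 'I_p.+1) : ((compan th)^T *m v) j 0 =
    v ord0 0 * th j 0 + (if insub j.+1 is Some k then v k 0 else 0).
  rewrite mxE big_ord_recl !mxE unlift_none mulrC; congr (_ + _).
  case: insubP => [k jk kE|jk]; last first.
    rewrite big1 // => i _; rewrite !mxE liftK (_ : (_ == j) = false) ?mul0r //.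
    by apply/negbTE/eqP => ij; move: jk; rewrite -ij /= ltnS ltn_ord.
  have jp : (j < p)%N by move: jk; rewrite ltnS.
  rewrite (bigD1 (Ordinal jp)) //= big1 => [|i ij].
    rewrite !mxE liftK (_ : (_ == j)) ?mul1r ?addr0; last exact/eqP/val_inj.
    by congr (v _ 0); apply: val_inj; rewrite kE.
  rewrite !mxE liftK (_ : (_ == j) = false) ?mul0r //.
  by apply/negbTE; apply: contra ij => /eqP ij; apply/eqP/val_inj; rewrite /= -ij.
have wS (j : 'I_p.+1) : w j.+1 = z * w j - ((th j 0)%:C)%C by rewrite -thc_ord.
have lastj (j : 'I_p.+1) : ~~ (j.+1 < p.+1)%N -> w j.+1 = 0.
  by move=> h; rewrite -w0; congr (w _); apply/eqP; rewrite eqn_leq ltn_ord leqNgt.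
have Aa : (compan th)^T *m a = x *: a + (- t) *: b.
  apply/matrixP => j k; rewrite ord1 Ac !mxE mul1r.
  have -> : (if insub j.+1 is Some k then a k 0 else 0) = complex.Re (w j.+1).
    by case: insubP => [k' _ <-|/lastj ->]; rewrite ?mxE.
  rewrite wS; case: (w j) => wa wb; rewrite /x /t; case: (z) => za zb /=; ring.
have Ab : (compan th)^T *m b = x *: b + t *: a.
  apply/matrixP => j k; rewrite ord1 Ac !mxE mul0r add0r.
  have -> : (if insub j.+1 is Some k then b k 0 else 0) = complex.Im (w j.+1).
    by case: insubP => [k' _ <-|/lastj ->]; rewrite ?mxE.
  rewrite wS; case: (w j) => wa wb; rewrite /x /t; case: (z) => za zb /=; ring.
have := lyapunov_form a; have := lyapunov_form b; rewrite Aa Ab.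
have exb u v (r q : R) : bform (toep y) (r *: u + q *: v) (r *: u + q *: v) =
   r ^+ 2 * bform (toep y) u u + 2 * r * q * bform (toep y) u v + q ^+ 2 * bform (toep y) v v.
  have -> : bform (toep y) (r *: u + q *: v) (r *: u + q *: v) = r ^+ 2 * bform (toep y) u u
    + r * q * bform (toep y) u v + r * q * bform (toep y) v u + q ^+ 2 * bform (toep y) v v.
    rewrite !bformE !mulr_sumr -!big_split /=; apply: eq_bigr => i _.
    by rewrite !mulr_sumr -!big_split /=; apply: eq_bigr => j _; rewrite !mxE; ring.
  by rewrite (bformC v u (toep_sym y)); ring.
rewrite !exb (bformC b a (toep_sym y)).
have -> : a ord0 0 = 1 by rewrite mxE.
have -> : b ord0 0 = 0 by rewrite mxE.
have pa : 0 <= bform (toep y) a a := posdef_psd.2 a.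
have pb : 0 <= bform (toep y) b b := posdef_psd.2 b.
have xt : x ^+ 2 + t ^+ 2 <= 1.
  move: zn; rewrite normc_def lecR -/x -/t => zn.
  by rewrite -[X in X <= _]sqr_sqrtr ?addr_ge0 ?sqr_ge0 // expr_le1 // sqrtr_ge0.
move: pa pb; set q1 := bform _ a a; set q2 := bform _ b b; set q3 := bform _ a b => pa pb h1 h2.
(* Adding the identities for [a] and [b] cancels the mixed terms; the first entries 1 and 0 leave
   the defect exactly once. *)
have : defect = (1 - (x ^+ 2 + t ^+ 2)) * (q1 + q2).
  move: h1 h2; rewrite !expr2 => h1 h2; nra.
by move=> ->; apply: mulr_ge0; [rewrite subr_ge0|apply: addr_ge0].
Qed.

Lemma compan_trexp_form k v :
  bform (toep y) ((compan th ^+ k)^T *m v) ((compan th ^+ k)^T *m v) <= bform (toep y) v v.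
Proof.
elim: k => [|k IH]; first by rewrite expr0 trmx1 mul1mx.
rewrite exprSr trmx_mul -mulmxA lyapunov_form.
by apply: le_trans IH; rewrite gerBl mulr_ge0 ?sqr_ge0 // defect_ge0.
Qed.

(** The transposed powers do not increase the [L]-norm, which lies between [c |u|^2] and
    [tr L |u|^2 = (p + 1) |u|^2]. Duality carries the Euclidean bound to the powers themselves. *)
Lemma compan_exp_enorm (c : R) k v : 0 < c -> (forall v, c * normsq v <= bform (toep y) v v) ->
  enorm (compan th ^+ k *m v) <= Num.sqrt (p.+1%:R / c) * enorm v.
Proof.
move=> c0 hc; set C := Num.sqrt _.
have trT : \tr (toep y) = p.+1%:R.
  rewrite /mxtrace (eq_bigr (fun=> 1)) ?sumr_const ?card_ord // => i _.
  by rewrite mxE distnn (_ : inord 0 = ord0) //; apply: val_inj; rewrite /= inordK.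
have adj u : enorm ((compan th ^+ k)^T *m u) <= C * enorm u.
  have C0 : 0 <= p.+1%:R / c by rewrite divr_ge0 // ltW.
  rewrite /C /enorm -sqrtrM //; apply: ler_wsqrtr.
  rewrite mulrAC ler_pdivlMr // mulrC; apply: le_trans (hc _) _.
  apply: le_trans (compan_trexp_form k u) _.
  by rewrite -trT; apply: psd_le_trace; exact: posdef_psd.
set w := _ *m v; have [->|w0] := eqVneq (enorm w) 0.
  by rewrite mulr_ge0 ?sqrtr_ge0.
have wp : 0 < enorm w by rewrite lt_def w0 enorm_ge0.
rewrite -(ler_pM2l wp) -expr2 enorm_sqr.
have -> : normsq w = \sum_i ((compan th ^+ k)^T *m w) i 0 * v i 0.
  transitivity ((w^T *m w) 0 0); first by rewrite normsq_mul.
  transitivity ((((compan th ^+ k)^T *m w)^T *m v) 0 0).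
    by rewrite [in RHS]trmx_mul trmxK -[in RHS]mulmxA.
  by rewrite dot_mul.
apply: le_trans (ler_norm _) _; apply: le_trans (dot_le_enorm _ _) _.
by rewrite mulrA (mulrC (enorm w)) ler_wpM2r ?enorm_ge0.
Qed.

End Lyapunov.
End Companion.

(** * Uniformity over compact parameter sets *)

Section Yule.
Variables (R : realType) (p : nat).
Implicit Types (th y v : 'cV[R]_p.+1).

Definition kvec (Y : nat -> R) : 'cV[R]_p.+1 := \col_i (if (i : nat) == 0%N then 1 else Y i).

Lemma kvec_lift Y (j : 'I_p) : kvec Y (lift ord0 j) 0 = Y j.+1.
Proof. by rewrite mxE. Qed.

Lemma Lmat_toep Y : Lmat p.+1 Y = toep (kvec Y).
Proof.
apply/matrixP => i j; rewrite !mxE inordK // ltnS.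
have := ltn_ord i; have := ltn_ord j; rewrite !ltnS; lia.
Qed.

(* Entry [0] of [y] stands for [kappa_0], so that the residual is linear in [y]; the Yule system says
   that it is the first basis vector. *)
Definition yule_res th y (j : 'I_p.+1) : R :=
  if unlift ord0 j is Some i then y j 0 - (toep y *m th) (widen_ord (leqnSn p) i) 0 else y ord0 0.

(** Row [j] of [L theta], cut at the diagonal, is equation [j + 1]: entries before it give the first
    sum reversed, the diagonal [kappa_0 = 1] gives the right-hand side, entries after it the second
    sum. *)
Lemma yule_systemE th Y : yule_system th Y <->
  forall j : 'I_p, kvec Y (lift ord0 j) 0 = (toep (kvec Y) *m th) (widen_ord (leqnSn p) j) 0.
Proof.
have E (j : 'I_p) : (toep (kvec Y) *m th) (widen_ord (leqnSn p) j) 0 =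
  \sum_(1 <= k < j.+1) thc th (j.+1 - k) * Y k +
  (thc th j.+1 + \sum_(1 <= k < (p.+1 - j.+1).+1) thc th (k + j.+1) * Y k).
  pose F l := thc th l.+1 * (if `|j - l|%N == 0%N then 1 else Y `|j - l|%N).
  transitivity (\sum_(0 <= l < p.+1) F l).
    rewrite big_mkord mxE; apply: eq_bigr => l _; rewrite /F thc_ord !mxE mulrC inordK //.
    by rewrite /=; have := ltn_ord l; have := ltn_ord j; lia.
  rewrite (@big_cat_nat _ _ _ j) //=; last by rewrite ltnW // ltnS ltnW.
  rewrite [X in _ + X]big_ltn; last by rewrite ltnS ltnW.
  congr (_ + (_ + _)).
  - rewrite [RHS]big_add1 /= [RHS]big_nat_rev /=; apply: eq_big_nat => k /andP[_ kj].
    rewrite /F (_ : `|j - k|%N = (j - k)%N); last by rewrite distnEl // ltnW.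
    rewrite (_ : (_ == 0)%N = false); last by lia.
    by congr (thc th _ * Y _); lia.
  - by rewrite /F distnn eqxx mulr1.
  - rewrite -[X in \sum_(X <= l < _) _]add1n big_addn.
    have -> : (p.+1 - j = (p.+1 - j.+1).+1)%N by have := ltn_ord j; lia.
    apply: eq_big_nat => k /andP[k1 _].
    rewrite /F (_ : `|j - (k + j)%N|%N = k); last by rewrite distnEr ?leq_addl // addnK.
    by rewrite (_ : (k == 0%N) = false) ?addnS //; apply/negbTE; rewrite -lt0n.
split=> [h j|h j /andP[j0 jp]].
  rewrite E.
  have /h <- : (0 < j.+1 <= p.+1.-1)%N by rewrite /= ltn_ord.
  by rewrite kvec_lift; ring.
have jj : (j.-1 < p)%N by move: jp; rewrite /= ; lia.
have Ej : (Ordinal jj : nat).+1 = j by rewrite /= prednK.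
have := h (Ordinal jj); rewrite E kvec_lift !Ej => ->.
ring.
Qed.

Lemma yule_resD th y v j : yule_res th (y + v) j = yule_res th y j + yule_res th v j.
Proof.
rewrite /yule_res; case: unlift => [i|]; last by rewrite mxE.
have -> : toep (y + v) = toep y + toep v by apply/matrixP => a b; rewrite !mxE.
have ad m (A B : 'cV[R]_m) k : (A + B) k 0 = A k 0 + B k 0 by rewrite mxE.
by rewrite mulmxDl !ad; ring.
Qed.

Lemma yule_resZ th a y j : yule_res th (a *: y) j = a * yule_res th y j.
Proof.
rewrite /yule_res; case: unlift => [i|]; last by rewrite mxE.
have -> : toep (a *: y) = a *: toep y by apply/matrixP => b c; rewrite !mxE.
have ad m (A : 'cV[R]_m) k : (a *: A) k 0 = a * A k 0 by rewrite mxE.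
by rewrite -scalemxAl !ad; ring.
Qed.

Lemma yule_res_kvec th Y : yule_system th Y <-> forall j, yule_res th (kvec Y) j = (j == ord0)%:R.
Proof.
rewrite yule_systemE; split=> h j.
  rewrite /yule_res; case: unliftP => [i ->|->]; first by rewrite -h subrr.
  by rewrite eqxx mxE.
by have := h (lift ord0 j); rewrite /yule_res liftK /= => /eqP; rewrite subr_eq0 => /eqP.
Qed.

(** Adding a kernel vector to the solution gives another solution, so unique solvability means a
    trivial kernel. *)
Lemma yule_res_inj th y : cond3 th -> (forall j, yule_res th y j = 0) -> y = 0.
Proof.
move=> [Y [sY uY _]] h.
pose Z k := Y k + (if insub k is Some i then y i 0 else 0).
have y0 : y ord0 0 = 0 by have := h ord0; rewrite /yule_res unlift_none.
have kE : kvec Z = kvec Y + y.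
  apply/matrixP => i j; rewrite ord1 !mxE /Z; case: eqP => [i0|_]; last by rewrite valK.
  by rewrite (_ : i = ord0) ?y0 ?addr0 //; exact: val_inj.
have sZ : yule_system th Z.
  by apply/yule_res_kvec => j; rewrite kE yule_resD h addr0; move/yule_res_kvec: sY.
apply/matrixP => i j; rewrite ord1 [RHS]mxE; case: (unliftP ord0 i) => [i' ->|-> //].
have := uY Z sZ (lift ord0 i').
rewrite /= /bump /= add1n ltn_ord => /(_ isT).
by rewrite /Z (_ : i'.+1 = lift ord0 i') // valK -[X in _ = X -> _]addr0 => /addrI ->.
Qed.

End Yule.

Lemma compact_pos_min (R : realType) (T : topologicalType) (C : set T) (f : T -> R) : compact C ->
  continuous f -> (forall x, C x -> 0 < f x) -> exists2 c, 0 < c & forall x, C x -> c <= f x.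
Proof.
move=> cC cf fp; have [C0|/set0P/negP/negPn/eqP C0] := pselect (C !=set0).
  have [x xC xm] := compact_EVT_min C0 cC (continuous_subspaceT cf).
  exists (f x); first by apply: fp; rewrite inE in xC.
  by move=> y Cy; apply: xm; rewrite inE.
by exists 1 => // x; rewrite C0.
Qed.

Lemma continuous_bigsum (R : realType) (T : topologicalType) (I : Type) (s : seq I) (f : I -> T -> R) :
  (forall i, continuous (f i)) -> continuous (fun x => \sum_(i <- s) f i x).
Proof. by move=> cf x; apply: cvg_bigsum => i; exact: cf. Qed.

Section Compactness.
Variables (R : realType) (p : nat).

Definition ccont (T : topologicalType) (a : T -> 'cV[R]_p) := forall i, continuous (fun x => a x i 0).

Lemma ccont_normsq (T : topologicalType) (a : T -> 'cV[R]_p) : ccont a ->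
  continuous (fun x => normsq (a x)).
Proof.
move=> ca; apply: continuous_bigsum => i x.
rewrite (_ : (fun x => _) = fun x => a x i 0 * a x i 0); first by apply: cvgM; exact: ca.
by apply/funext => z; rewrite expr2.
Qed.

Lemma ccont_bform (T : topologicalType) (M : T -> 'M[R]_p) (a : T -> 'cV[R]_p) :
  (forall i j, continuous (fun x => M x i j)) -> ccont a ->
  continuous (fun x => bform (M x) (a x) (a x)).
Proof.
move=> cM ca; rewrite (_ : (fun x => _) = fun x => \sum_i \sum_j a x i 0 * M x i j * a x j 0).
  apply: continuous_bigsum => i; apply: continuous_bigsum => j x.
  by apply: cvgM; [apply: cvgM; [exact: ca|exact: cM]|exact: ca].
by apply/funext => x; rewrite bformE.
Qed.

Lemma unit_box_compact : compact [set v : 'rV[R]_p | forall i, v ord0 i \in `[-1, 1]].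
Proof.
have := @rV_compact R p (fun=> [set` `[-1, 1]]) (fun=> @segment_compact R (-1) 1).
exact.
Qed.

Lemma sphere_compact : compact [set v : 'rV[R]_p | normsq v^T = 1].
Proof.
have cn : continuous (fun v : 'rV[R]_p => normsq v^T).
  apply: ccont_normsq => i; rewrite (_ : (fun v => _) = fun v : 'rV[R]_p => v 0 i).
    exact: coord_continuous.
  by apply/funext => v; rewrite mxE.
apply: (subclosed_compact _ unit_box_compact) => [|v /= nv i].
  rewrite (_ : mkset _ = (fun v : 'rV[R]_p => normsq v^T) @^-1` [set 1]) //.
  by apply: closed_comp => [x _|]; [exact: cn|exact: closed_eq].
have := entry_le_enorm v^T i; rewrite /enorm nv sqrtr1 mxE in_itv /=.
by rewrite ler_norml.
Qed.

End Compactness.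

Section Uniformity.
Variables (R : realType) (p : nat).
Variable K : set 'cV[R]_p.+1.
Hypothesis cK : compact K.

Lemma param_bound : exists2 B, 0 < B & forall th, K th -> normsq th <= B.
Proof.
have ca : ccont (fun x : 'cV[R]_p.+1 => x) by move=> i; exact: coord_continuous.
have cn := ccont_normsq ca.
have [K0|/set0P/negP/negPn/eqP K0] := pselect (K !=set0); last by exists 1 => // th; rewrite K0.
have [x xK xm] := compact_EVT_max K0 cK (continuous_subspaceT cn).
exists (1 + normsq x); first by rewrite ltr_wpDr ?normsq_ge0.
move=> th Kth; have := xm th; rewrite inE => /(_ Kth) h.
by apply: le_trans h _; rewrite lerDr.
Qed.

Lemma toep_continuous (T : topologicalType) (y : T -> 'cV[R]_p.+1) : ccont y ->
  forall i j, continuous (fun x => toep (y x) i j).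
Proof.
move=> cy i j; rewrite (_ : (fun x => _) = fun x => y x (inord `|i - j|%N) 0); first exact: cy.
by apply/funext => x; rewrite mxE.
Qed.

Lemma yule_res_continuous (T : topologicalType) (th y : T -> 'cV[R]_p.+1) j : ccont th -> ccont y ->
  continuous (fun x => yule_res (th x) (y x) j).
Proof.
move=> ct cy; rewrite /yule_res; case: unlift => [i|]; last exact: cy.
rewrite (_ : (fun x => _) = fun x =>
  y x j 0 - \sum_l toep (y x) (widen_ord (leqnSn p) i) l * th x l 0).
  move=> x; apply: cvgB; first exact: cy.
  apply: cvg_bigsum => l; apply: cvgM; [exact: toep_continuous|exact: ct].
by apply/funext => x; rewrite mxE.
Qed.

Hypothesis K3 : forall th, K th -> cond3 th.

(** The residual is continuous and nonzero on the compact set [K] times the unit sphere; homogeneity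
    in [y] extends its minimum to all vectors. *)
Lemma yule_coercive : exists2 c, 0 < c &
  forall th y, K th -> c * normsq y <= \sum_j yule_res th y j ^+ 2.
Proof.
have cS := compact_setX cK (@sphere_compact R p.+1).
have c1 : ccont (fun x : 'cV[R]_p.+1 * 'rV[R]_p.+1 => x.1).
  move=> i x; apply: (@continuous_comp _ _ _ fst (fun v : 'cV[R]_p.+1 => v i 0)); first exact: cvg_fst.
  exact: coord_continuous.
have c2 : ccont (fun x : 'cV[R]_p.+1 * 'rV[R]_p.+1 => x.2^T).
  move=> i; rewrite (_ : (fun x => _) = fun x : 'cV[R]_p.+1 * 'rV[R]_p.+1 => x.2 0 i).
    move=> x; apply: (@continuous_comp _ _ _ snd (fun v : 'rV[R]_p.+1 => v 0 i)); first exact: cvg_snd.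
    exact: coord_continuous.
  by apply/funext => x; rewrite mxE.
pose f (x : 'cV[R]_p.+1 * 'rV[R]_p.+1) := \sum_j yule_res x.1 x.2^T j ^+ 2.
have [|x [/= Kx nx]|c c0 h] := compact_pos_min (f := f) cS.
- apply: continuous_bigsum => j x.
  rewrite (_ : (fun x => _) = fun x : 'cV[R]_p.+1 * 'rV[R]_p.+1 =>
    yule_res x.1 x.2^T j * yule_res x.1 x.2^T j).
    by apply: cvgM; apply: yule_res_continuous.
  by apply/funext => z; rewrite expr2.
- rewrite lt_def sumr_ge0 ?andbT; last by move=> j _; exact: sqr_ge0.
  apply/eqP => /eqP; rewrite psumr_eq0 => [/allP z|j _]; last exact: sqr_ge0.
  have yz : x.2^T = 0.
    apply: (yule_res_inj (K3 Kx)) => j; have := z j (mem_index_enum _).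
    by rewrite /= sqrf_eq0 => /eqP.
  move: nx; rewrite yz /normsq big1 => [/eqP|i _]; last by rewrite mxE expr0n.
  by rewrite eq_sym oner_eq0.
exists c => // th y Kth; have [y0|y0] := eqVneq (enorm y) 0.
  rewrite -enorm_sqr y0 expr0n /= mulr0; apply: sumr_ge0 => j _; exact: sqr_ge0.
have yp : 0 < enorm y by rewrite lt_def y0 enorm_ge0.
have := h (th, ((enorm y)^-1 *: y)^T); rewrite /f /= trmxK => h2.
have : c <= \sum_j yule_res th ((enorm y)^-1 *: y) j ^+ 2.
  apply: h2; split => //=; rewrite -enorm_sqr enormZ ger0_norm ?invr_ge0 ?enorm_ge0 //.
  by rewrite mulVf // expr1n.
rewrite (eq_bigr (fun j => (enorm y ^+ 2)^-1 * yule_res th y j ^+ 2)); last first.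
  by move=> j _; rewrite yule_resZ exprMn exprVn.
rewrite -mulr_sumr mulrC ler_pdivlMr ?exprn_gt0 // enorm_sqr; exact.
Qed.

(** Instead of proving that the solution varies continuously with the parameter, the form is
    minimized over triples (parameter, solution, unit vector). These form a compact set: the
    residual equation is closed, and positivity with unit diagonal keeps solutions in the unit
    box. *)
Lemma toep_coercive : exists2 c, 0 < c & forall th, K th -> exists y : 'cV[R]_p.+1,
  [/\ forall j, yule_res th y j = (j == ord0)%:R, posdef (toep y),
     forall i, `|y i 0| <= 1 & forall v, c * normsq v <= bform (toep y) v v].
Proof.
have yE (th : 'cV[R]_p.+1) (Y : nat -> R) : yule_system th Y -> posdef (Lmat p.+1 Y) ->
    [/\ forall j, yule_res th (kvec p Y) j = (j == ord0)%:R, posdef (toep (kvec p Y)) &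
      forall i, `|kvec p Y i 0| <= 1].
  rewrite Lmat_toep => sY pY; split => // [|i]; first exact/yule_res_kvec.
  have ps := posdef_psd pY.
  have := psd_cauchy (delta_mx i 0) (delta_mx ord0 0) ps; rewrite !bform_delta toep_col0.
  have d j : toep (kvec p Y) j j = 1.
    by rewrite mxE distnn mxE inordK.
  by rewrite !d mulr1 -normr_sqr -[X in _ <= X -> _](expr1n _ 2) ler_sqr ?nnegrE.
pose A : topologicalType := ('cV[R]_p.+1 * ('rV[R]_p.+1 * 'rV[R]_p.+1))%type.
have c1 : ccont (fun x : A => x.1).
  move=> i x; apply: (@continuous_comp _ _ _ fst (fun v : 'cV[R]_p.+1 => v i 0)); first exact: cvg_fst.
  exact: coord_continuous.
have c2 : ccont (fun x : A => x.2.1^T).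
  move=> i; rewrite (_ : (fun x => _) = fun x : A => x.2.1 0 i).
    move=> x; apply: (@continuous_comp _ _ _ snd (fun v : 'rV[R]_p.+1 * 'rV[R]_p.+1 => v.1 0 i)); first exact: cvg_snd.
    apply: (@continuous_comp _ _ _ fst (fun v : 'rV[R]_p.+1 => v 0 i)); first exact: cvg_fst.
    exact: coord_continuous.
  by apply/funext => x; rewrite mxE.
have c3 : ccont (fun x : A => x.2.2^T).
  move=> i; rewrite (_ : (fun x => _) = fun x : A => x.2.2 0 i).
    move=> x; apply: (@continuous_comp _ _ _ snd (fun v : 'rV[R]_p.+1 * 'rV[R]_p.+1 => v.2 0 i)); first exact: cvg_snd.
    apply: (@continuous_comp _ _ _ snd (fun v : 'rV[R]_p.+1 => v 0 i)); first exact: cvg_snd.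
    exact: coord_continuous.
  by apply/funext => x; rewrite mxE.
pose C : set A := (K `*` ([set v : 'rV[R]_p.+1 | forall i, v ord0 i \in `[-1, 1]] `*`
   [set v : 'rV[R]_p.+1 | normsq v^T = 1])).
have cC : compact C.
  exact: (compact_setX cK (compact_setX (@unit_box_compact R p.+1) (@sphere_compact R p.+1))).
pose r (x : A) := \sum_j (yule_res x.1 x.2.1^T j - (j == ord0)%:R) ^+ 2.
have cr : continuous r.
  apply: continuous_bigsum => j x.
  rewrite (_ : (fun x => _) = fun x : A =>
    (yule_res x.1 x.2.1^T j - (j == ord0)%:R) * (yule_res x.1 x.2.1^T j - (j == ord0)%:R)).
    by apply: cvgM; (apply: cvgB; [apply: yule_res_continuous|exact: cvg_cst]).
  by apply/funext => z; rewrite expr2.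
have r0 x : r x = 0 -> forall j, yule_res x.1 x.2.1^T j = (j == ord0)%:R.
  move/eqP; rewrite psumr_eq0 => [/allP z j|j _]; last exact: sqr_ge0.
  by have := z j (mem_index_enum _); rewrite /= sqrf_eq0 subr_eq0 => /eqP.
have cD : compact (C `&` r @^-1` [set 0]).
  by apply: compact_closedI => //; apply: closed_comp => [x _|]; [exact: cr|exact: closed_eq].
have pos x : (C `&` r @^-1` [set 0]) x -> posdef (toep x.2.1^T).
  move=> [[/= Kx _] /r0 rx]; have [Y [sY uY pY]] := K3 Kx.
  have [rY pkY _] := yE _ _ sY pY.
  suff -> : x.2.1^T = kvec p Y by [].
  apply/eqP; rewrite -subr_eq0; apply/eqP; apply: (yule_res_inj (K3 Kx)) => j.
  by rewrite -scaleN1r yule_resD yule_resZ rx rY mulN1r subrr.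
have [||c c0 h] := compact_pos_min (f := fun x : A => bform (toep x.2.1^T) x.2.2^T x.2.2^T) cD.
- by apply: ccont_bform => //; exact: toep_continuous.
- move=> x xC; apply: (pos x xC); apply/eqP => v0; have [[_ [_ /=]]] := xC.
  rewrite v0 /normsq big1 => [/eqP|i _]; last by rewrite mxE expr0n.
  by rewrite eq_sym oner_eq0.
exists c => // th Kth; have [Y [sY uY pY]] := K3 Kth.
have [rY pkY bY] := yE _ _ sY pY.
exists (kvec p Y); split => // v.
have [v0|v0] := eqVneq (enorm v) 0.
  rewrite -enorm_sqr v0 expr0n /= mulr0; exact: (posdef_psd pkY).2.
have vp : 0 < enorm v by rewrite lt_def v0 enorm_ge0.
have := h (th, ((kvec p Y)^T, ((enorm v)^-1 *: v)^T)); rewrite /= !trmxK => h2.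
have : c <= bform (toep (kvec p Y)) ((enorm v)^-1 *: v) ((enorm v)^-1 *: v).
  apply: h2; split; first split => //=.
  - split => /= [i|]; first by rewrite mxE in_itv /= -ler_norml.
    rewrite trmxK -enorm_sqr enormZ ger0_norm ?invr_ge0 ?enorm_ge0 //.
    by rewrite mulVf // expr1n.
  - by rewrite /r /= trmxK big1 // => j _; rewrite rY subrr expr0n.
have -> : bform (toep (kvec p Y)) ((enorm v)^-1 *: v) ((enorm v)^-1 *: v) =
   (enorm v ^+ 2)^-1 * bform (toep (kvec p Y)) v v.
  rewrite !bformE mulr_sumr; apply: eq_bigr => i _; rewrite mulr_sumr; apply: eq_bigr => j _.
  by rewrite !mxE -exprVn; ring.
by rewrite mulrC ler_pdivlMr ?exprn_gt0 // enorm_sqr.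
Qed.

End Uniformity.

(** * Autoregressive paths *)

Section Path.
Variables (R : realType) (p : nat) (th : 'cV[R]_p.+1) (e : nat -> R).
Local Notation X := (ar_X th e).
Local Notation M := (ar_M th e).

Definition ar_S n : 'cV[R]_p.+1 := \sum_(k < n) e k *: X k.

Lemma ar_ME n i j : M n i j = \sum_(k < n) X k i 0 * X k j 0.
Proof.
rewrite /ar_M summxE; apply: eq_bigr => k _.
by rewrite mxE big_ord1 [X in _ * X]mxE.
Qed.

Lemma ar_MS n i j : M n.+1 i j = M n i j + X n i 0 * X n j 0.
Proof. by rewrite !ar_ME big_ord_recr. Qed.

Lemma ar_MC n i j : M n i j = M n j i.
Proof. by rewrite !ar_ME; apply: eq_bigr => k _; rewrite mulrC. Qed.

Lemma ar_SE n i : ar_S n i 0 = \sum_(k < n) X k i 0 * e k.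
Proof. by rewrite /ar_S summxE; apply: eq_bigr => k _; rewrite mxE mulrC. Qed.

Lemma trace_ar_M n : \tr (M n) = \sum_(k < n) normsq (X k).
Proof.
rewrite /mxtrace [RHS]exchange_big; apply: eq_bigr => i _ /=.
by rewrite ar_ME; apply: eq_bigr => k _; rewrite expr2.
Qed.

Lemma ar_M_psd n : psd (M n).
Proof.
split; first by apply/matrixP => i j; rewrite mxE ar_MC.
move=> v; rewrite -/(bform (M n) v v).
have -> : bform (M n) v v = \sum_(k < n) (\sum_i v i 0 * X k i 0) ^+ 2.
  rewrite bformE; under [RHS]eq_bigr => k _ do rewrite expr2 mulr_suml.
  rewrite [RHS]exchange_big; apply: eq_bigr => i _ /=.
  under [RHS]eq_bigr => k _ do rewrite mulr_sumr.
  rewrite [RHS]exchange_big; apply: eq_bigr => j _ /=.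
  rewrite ar_ME mulr_sumr mulr_suml; apply: eq_bigr => k _; ring.
by apply: sumr_ge0 => k _; exact: sqr_ge0.
Qed.

Lemma ar_X_lift n (i : 'I_p) : X n.+1 (lift ord0 i) 0 = X n (widen_ord (leqnSn p) i) 0.
Proof. by rewrite ar_XS [LHS]mxE compan_mulS !mxE mulr0 addr0. Qed.

Lemma ar_X_ord0 n : X n.+1 ord0 0 = \sum_l th l 0 * X n l 0 + e n.
Proof. by rewrite ar_XS [LHS]mxE compan_mul0 !mxE mulr1. Qed.

Lemma ls_num n : \sum_(k < n) ar_x th e k.+1 *: X k = M n *m th + ar_S n.
Proof.
apply/matrixP => i j; rewrite ord1 summxE [RHS]mxE ar_SE mxE.
under [X in _ = X + _]eq_bigr => l _ do rewrite ar_ME mulr_suml.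
rewrite exchange_big -big_split /=; apply: eq_bigr => k _.
rewrite mxE ar_xE ar_X_ord0 mulrDl mulr_suml; congr (_ + _); last by rewrite mulrC.
by apply: eq_bigr => l _; ring.
Qed.

Lemma ls_est_error n : 0 < \det (M n) -> ls_est th e n - th = invmx (M n) *m ar_S n.
Proof.
move=> d0; have u : M n \in unitmx by rewrite unitmxE unitfE gt_eqF.
by rewrite /ls_est /gen_inv d0 ls_num mulmxDr mulKmx // addrC addKr.
Qed.

(** Shifting both indices shifts time by one; because [X_0 = 0] the only boundary term is the one at
    time [n]. *)
Lemma ar_M_shift n (i j : 'I_p) : M n (lift ord0 i) (lift ord0 j) =
  M n (widen_ord (leqnSn p) i) (widen_ord (leqnSn p) j) - X n (lift ord0 i) 0 * X n (lift ord0 j) 0.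
Proof.
apply/eqP; rewrite eq_sym subr_eq eq_sym -ar_MS !ar_ME big_ord_recl ar_X0 !mxE mul0r add0r.
by apply/eqP; apply: eq_bigr => k _; rewrite !lift0 !ar_X_lift.
Qed.

(** The same time shift with the autoregression substituted for the newest coordinate: this is the
    empirical Yule equation, with [S_n] and a boundary product as errors. *)
Lemma ar_M_row0 n (j : 'I_p) : M n ord0 (lift ord0 j) =
  \sum_l th l 0 * M n l (widen_ord (leqnSn p) j) + ar_S n (widen_ord (leqnSn p) j) 0
  - X n ord0 0 * X n (lift ord0 j) 0.
Proof.
apply/eqP; rewrite eq_sym subr_eq eq_sym -ar_MS !ar_ME big_ord_recl ar_X0 !mxE mul0r add0r.
rewrite ar_SE; apply/eqP; under [X in _ = X + _]eq_bigr => l _ do rewrite ar_ME mulr_sumr.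
rewrite exchange_big -big_split /=; apply: eq_bigr => k _.
rewrite (_ : bump 0 k = k.+1) // ar_X_lift ar_X_ord0 mulrDl mulr_suml; congr (_ + _); last by rewrite mulrC.
by apply: eq_bigr => l _; ring.
Qed.

Lemma innovation_sqr n : e n ^+ 2 <= 2 * normsq (X n.+1) + 2 * (normsq th * normsq (X n)).
Proof.
have := ar_X_ord0 n; set q := \sum_l _ => h.
have q2 : q ^+ 2 <= normsq th * normsq (X n) by apply: sum_cauchy.
have x2 : X n.+1 ord0 0 ^+ 2 <= normsq (X n.+1).
  by rewrite /normsq (bigD1 ord0) //= lerDl; apply: sumr_ge0 => i _; exact: sqr_ge0.
have : 0 <= (X n.+1 ord0 0 + q) ^+ 2 by exact: sqr_ge0.
rewrite h in x2 *; move: x2 q2; set N := normsq (X n.+1); nra.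
Qed.

(** Each noise is the new coordinate minus a linear form in the old state. Hence linear growth of
    the sum of squared noises forces linear growth of the trace, uniformly over bounded
    parameters. *)
Lemma innovation_sum n : \sum_(k < n) e k ^+ 2 <= (2 + 2 * normsq th) * \tr (M n.+1).
Proof.
have N0 k : 0 <= normsq (X k) by exact: normsq_ge0.
have T1 : \sum_(k < n) normsq (X k.+1) <= \tr (M n.+1).
  by rewrite trace_ar_M big_ord_recl lerDr.
have T2 : \sum_(k < n) normsq (X k) <= \tr (M n.+1).
  by rewrite trace_ar_M big_ord_recr /= lerDl.
apply: (@le_trans _ _ (\sum_(k < n) (2 * normsq (X k.+1) + 2 * (normsq th * normsq (X k))))).
  by apply: ler_sum => k _; exact: innovation_sqr.
have -> : \sum_(k < n) (2 * normsq (X k.+1) + 2 * (normsq th * normsq (X k))) =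
    2 * \sum_(k < n) normsq (X k.+1) + 2 * (normsq th * \sum_(k < n) normsq (X k)).
  by rewrite big_split /= !mulr_sumr.
rewrite [X in _ <= X]mulrDl; apply: lerD; first by rewrite ler_wpM2l.
by rewrite mulrA; apply: ler_wpM2l => //; apply: mulr_ge0 => //; exact: normsq_ge0.
Qed.

Section Stability.
Variables C r : R.
Hypothesis hC : forall k v, enorm (compan th ^+ k *m v) <= C * enorm v.

(** Carrying an arbitrary power in the induction applies the stability bound once per noise term, so
    the constant stays [C] and does not become [C^j]. *)
Lemma history_bound m j k : (forall i, (i < m + j)%N -> `|e i| <= r) ->
  enorm (compan th ^+ k *m X (m + j)) <= C * (enorm (X m) + j%:R * r).
Proof.
elim: j k => [|j IH] k he; first by rewrite addn0 mul0r addr0.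
rewrite addnS ar_XS mulmxDr mulmxA -scalemxAr.
apply: le_trans (enormD _ _) _.
have -> : compan th ^+ k *m compan th = compan th ^+ k.+1 by rewrite exprSr.
have h1 := IH k.+1 (fun i ij => he i (ltn_trans ij (eq_leq (esym (addnS m j))))).
have h2 : enorm (e (m + j)%N *: (compan th ^+ k *m delta_mx ord0 0)) <= C * r.
  rewrite enormZ mulrC; apply: ler_pM; rewrite ?enorm_ge0 //.
    by apply: le_trans (hC _ _) _; rewrite /enorm normsq_delta sqrtr1 mulr1.
  by apply: he; rewrite addnS.
apply: le_trans (lerD h1 h2) _; by rewrite -mulrDr -addrA -{2}[r]mul1r -mulrDl natr1.
Qed.

End Stability.
End Path.

(* If [|X_m|^2 > delta h], stability run backwards from [m] shows that the [J] states preceding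
   [X_(m-1)] all have norm at least [sqrt (delta h) / (2 C)], which overshoots the stopping level. *)
Lemma path_increment_bound (R : realType) (p J n : nat) (th : 'cV[R]_p.+1) (e : nat -> R) (C h s2 delta rho : R) :
  0 < C -> (forall k v, enorm (compan th ^+ k *m v) <= C * enorm v) ->
  0 < h -> 0 < delta -> 4 * C ^+ 2 * s2 <= J%:R * delta -> 0 <= rho ->
  2 * C * J.+1%:R * rho <= Num.sqrt delta ->
  \tr (ar_M th e n.-1) < h * s2 -> (forall i, (i < n)%N -> `|e i| <= rho * Num.sqrt h) ->
  forall m, (m <= n)%N -> normsq (ar_X th e m) <= delta * h.
Proof.
move=> C0 hC h0 d0 hJ r0 hr htr he m mn; rewrite leNgt; apply/negP => big.
set X := ar_X th e; set q := Num.sqrt delta * Num.sqrt h.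
have q0 : 0 < q by rewrite mulr_gt0 // sqrtr_gt0.
have q2 : q ^+ 2 = delta * h by rewrite exprMn !sqr_sqrtr // ltW.
have low j : (j <= m)%N -> (j <= J.+1)%N -> q <= 2 * C * enorm (X (m - j)%N).
  move=> jm jJ; have he' i : (i < m - j + j)%N -> `|e i| <= rho * Num.sqrt h.
    by rewrite subnK // => im; apply: he; apply: leq_trans mn.
  have := history_bound hC 0 he'; rewrite expr0 mul1mx subnK // => hb.
  have qm : q < enorm (X m).
    by rewrite -ltr_sqr ?nnegrE ?enorm_ge0 ?(ltW q0) // enorm_sqr q2.
  have jr : 2 * C * (j%:R * (rho * Num.sqrt h)) <= q.
    apply: (@le_trans _ _ (2 * C * J.+1%:R * rho * Num.sqrt h)).
      have -> : 2 * C * (j%:R * (rho * Num.sqrt h)) = (2 * C * (rho * Num.sqrt h)) * j%:R by ring.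
      have -> : 2 * C * J.+1%:R * rho * Num.sqrt h = (2 * C * (rho * Num.sqrt h)) * J.+1%:R by ring.
      apply: ler_wpM2l; last by rewrite ler_nat.
      by rewrite !mulr_ge0 ?sqrtr_ge0 // ltW.
    by rewrite /q ler_wpM2r ?sqrtr_ge0.
  move: hb qm jr; rewrite -/X; set u := enorm (X m); set v := enorm _; set w := j%:R * _.
  by rewrite !mulrDr => *; lra.
(* If the backward run reaches time 0 it contradicts [X_0 = 0]. *)
have [mJ|mJ] := leqP m J.+1.
  have := low m (leqnn _) mJ; rewrite subnn /X ar_X0 enorm0 mulr0 leNgt q0 //.
(* The state at [m - 1] is left out: for [m = n] it is not counted in the trace at [n - 1]. Exactly
   [J] states remain. *)
have lowq k : (m - J.+1 <= k < m.-1)%N -> delta * h <= 4 * C ^+ 2 * normsq (X k).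
  move=> /andP[k1 k2]; have := low (m - k)%N; rewrite subKn; last by lia.
  move=> /(_ _ _)/[!leq_subr]-/(_ isT) hk; rewrite -q2 -enorm_sqr.
  have -> : 4 * C ^+ 2 * enorm (X k) ^+ 2 = (2 * C * enorm (X k)) ^+ 2 by ring.
  have hq : q <= 2 * C * enorm (X k) by apply: hk; lia.
  by rewrite ler_sqr ?nnegrE ?(ltW q0) // (le_trans (ltW q0)).
have : J%:R * (delta * h) <= 4 * C ^+ 2 * \tr (ar_M th e n.-1).
  rewrite trace_ar_M -(big_mkord xpredT (fun k => normsq (X k))).
  have N0 a b : 0 <= \sum_(a <= k < b) normsq (X k).
    by rewrite big_nat; apply: sumr_ge0 => k _; exact: normsq_ge0.
  rewrite (@big_cat_nat _ _ _ (m - J.+1)) //=; last by lia.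
  rewrite (@big_cat_nat _ _ _ m.-1 (m - J.+1)) //=; [|by lia|by lia].
  apply: (@le_trans _ _ (4 * C ^+ 2 * (\sum_(m - J.+1 <= k < m.-1) normsq (X k)))).
    rewrite mulr_sumr; apply: (@le_trans _ _ (\sum_(m - J.+1 <= k < m.-1) delta * h)).
      by rewrite sumr_const_nat (_ : (m.-1 - (m - J.+1))%N = J) ?mulr_natl //; lia.
    by rewrite !big_nat; apply: ler_sum => k kk; exact: lowq.
  apply: ler_wpM2l; first by apply: mulr_ge0 => //; exact: sqr_ge0.
  by have := N0 0%N (m - J.+1)%N; have := N0 m.-1 n.-1; lra.
have C2 : 0 < 4 * C ^+ 2 by rewrite mulr_gt0 // exprn_gt0.
have : 4 * C ^+ 2 * \tr (ar_M th e n.-1) < 4 * C ^+ 2 * (h * s2) by rewrite ltr_pM2l.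
have : 4 * C ^+ 2 * s2 * h <= J%:R * delta * h by rewrite ler_pM2r.
set t := \tr _; set D := 4 * C ^+ 2; set E := J%:R * delta.
have -> : D * (h * s2) = D * s2 * h by ring.
have -> : J%:R * (delta * h) = E * h by rewrite /E mulrA.
move: (_ * h) (_ * h) => a b; lra.
Qed.

Section Gram.
Variables (R : realType) (p : nat).
Local Notation N := (p.+1%:R : R).
Local Notation P := (p%:R : R).

(** An entry slides down its diagonal to the first column in at most [p] shifts, each costing one
    product of coordinates of [X_n]. *)
Lemma gram_toeplitz (th : 'cV[R]_p.+1) (e : nat -> R) n (d : R) i j :
  normsq (ar_X th e n) <= d ->
  `|ar_M th e n i j - toep (\col_k ar_M th e n k ord0) i j| <= P * d.
Proof.
move=> Xd; set X := ar_X th e n; set M := ar_M th e n.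
have d0 : 0 <= d by apply: le_trans Xd; exact: normsq_ge0.
have XX a b : `|X a 0 * X b 0| <= d.
  rewrite normrM; apply: le_trans Xd; rewrite -enorm_sqr expr2.
  by apply: ler_pM => //; exact: entry_le_enorm.
suff low (a b : 'I_p.+1) : (b <= a)%N -> `|M a b - M (inord (a - b)) ord0| <= b%:R * d.
  have low' (a b : 'I_p.+1) : (b <= a)%N -> `|M a b - M (inord (a - b)) ord0| <= P * d.
    by move=> /low h; apply: le_trans h _; rewrite ler_wpM2r // ler_nat -ltnS.
  rewrite !mxE; have [ji|/ltnW ij] := leqP j i.
    by rewrite distnEl //; exact: low'.
  by rewrite distnEr // /M ar_MC -/M; exact: low'.
move: {-2}(b : nat) (erefl (b : nat)) => k; elim: k a b => [|k IH] a b kb ba.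
  have -> : b = ord0 by apply: val_inj.
  by rewrite subn0 inord_val subrr normr0 mul0r.
case: (unliftP ord0 b) kb ba => [b' ->|-> //]; rewrite lift0 => -[kb].
case: (unliftP ord0 a) => [a' ->|-> //]; rewrite lift0 ltnS => ba.
rewrite /M ar_M_shift -/M -/X subSS.
have := IH (widen_ord (leqnSn p) a') (widen_ord (leqnSn p) b') kb ba; rewrite /= => h.
rewrite addrAC; apply: le_trans (ler_normB _ _) _; rewrite -natr1 mulrDl mul1r.
exact: lerD.
Qed.

(** The residual consists of one entry of [S_n], one boundary product, and the [p + 1] deviations
    from the Toeplitz form weighted by the parameter, whence the constant. *)
Lemma gram_yule (th : 'cV[R]_p.+1) (e : nat -> R) n (d B : R) (j : 'I_p) :
  normsq (ar_X th e n) <= d -> (forall i, `|ar_S th e n i 0| <= d) -> (forall i, `|th i 0| <= B) ->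
  `|yule_res th (\col_k ar_M th e n k ord0) (lift ord0 j)| <= (2 + P * N * B) * d.
Proof.
move=> Xd Sd tB; set m := \col_k _; set X := ar_X th e n; set M := ar_M th e n.
have d0 : 0 <= d by apply: le_trans Xd; exact: normsq_ge0.
have XX a b : `|X a 0 * X b 0| <= d.
  rewrite normrM; apply: le_trans Xd; rewrite -enorm_sqr expr2.
  by apply: ler_pM => //; exact: entry_le_enorm.
have -> : yule_res th m (lift ord0 j) = ar_S th e n (widen_ord (leqnSn p) j) 0
  - X ord0 0 * X (lift ord0 j) 0 + \sum_l (M (widen_ord (leqnSn p) j) l - toep m (widen_ord (leqnSn p) j) l) * th l 0.
  rewrite /yule_res liftK (_ : m (lift ord0 j) 0 = M ord0 (lift ord0 j)); last by rewrite mxE /M ar_MC.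
  rewrite ar_M_row0 -/X [(toep m *m th) _ _]mxE.
  under [X in _ = _ + X]eq_bigr => l _ do rewrite mulrBl.
  rewrite sumrB /M.
  under [X in _ = _ + (X - _)]eq_bigr => l _ do rewrite mulrC ar_MC.
  ring.
apply: le_trans (ler_normD _ _) _.
have h1 : `|ar_S th e n (widen_ord (leqnSn p) j) 0 - X ord0 0 * X (lift ord0 j) 0| <= 2 * d.
  by apply: le_trans (ler_normB _ _) _; rewrite mulrDl mul1r; apply: lerD.
rewrite mulrDl; apply: lerD => //; apply: le_trans (ler_norm_sum _ _ _) _.
have -> : P * N * B * d = \sum_(l < p.+1) (P * d) * B.
  by rewrite sumr_const card_ord -mulr_natr; ring.
apply: ler_sum => l _; rewrite normrM; apply: ler_pM => //.
exact: gram_toeplitz.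
Qed.

(* The Gram matrix is Toeplitz up to [|X_n|^2], and its first column solves the Yule system up to
   [S_n] and [|X_n|^2]; coercivity of the residual then identifies it. *)
Lemma gram_close (c B s2 xi : R) : 0 < c -> 0 < s2 -> 0 < xi -> 0 <= B ->
  exists2 delta, 0 < delta & forall (th y : 'cV[R]_p.+1) (e : nat -> R) (n : nat) (h : R),
    0 < h -> (forall z, c * normsq z <= \sum_j yule_res th z j ^+ 2) ->
    (forall i, `|th i 0| <= B) -> (forall j, yule_res th y j = (j == ord0)%:R) ->
    normsq (ar_X th e n) <= delta * h -> (forall i, `|ar_S th e n i 0| <= delta * h) ->
    `|\tr (ar_M th e n) - h * s2| <= delta * h ->
    forall i j, `|ar_M th e n i j - h * (s2 / N * toep y i j)| <= xi * h.
Proof.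
(* [K1] adds the error of entry 0, read off the trace, to that of the Yule equations; [q] is the
   loss in coercivity, and [Tt] the total factor by which [delta] must undercut [xi]. *)
move=> c0 s0 xi0 B0; pose K1 : R := (1 + N * P) + N * (2 + P * N * B).
have K10 : 0 <= K1 by rewrite /K1 !addr_ge0 ?mulr_ge0 ?addr_ge0 ?mulr_ge0.
pose q := Num.sqrt (N / c); pose Tt := 1 + P + q * K1 / N.
have q0 : 0 <= q by exact: sqrtr_ge0.
have T0 : 0 < Tt by rewrite /Tt -addrA ltr_wpDr // addr_ge0 // divr_ge0 // mulr_ge0.
have N0 : 0 < N by rewrite ltr0n.
exists (xi / Tt); first exact: divr_gt0.
move=> th y e n h h0 hc tB ry Xd Sd trd i j.
set d := xi / Tt * h in Xd Sd trd.
have d0 : 0 <= d by rewrite mulr_ge0 ?divr_ge0 ?ltW.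
set M := ar_M th e n in trd *; pose m : 'cV[R]_p.+1 := \col_k M k ord0.
have hm a b : `|M a b - toep m a b| <= P * d by exact: gram_toeplitz.
have toepE (v : 'cV[R]_p.+1) a : toep v a a = v ord0 0.
  by rewrite mxE distnn; congr (v _ 0); apply: val_inj; rewrite /= inordK.
have hm0 : `|N * m ord0 0 - h * s2| <= (1 + N * P) * d.
  have -> : N * m ord0 0 - h * s2 = (\tr M - h * s2) - \sum_a (M a a - toep m a a).
    have -> : N * m ord0 0 = \sum_a toep m a a.
      by rewrite (eq_bigr (fun=> m ord0 0)) ?sumr_const ?card_ord ?mulr_natl.
    by rewrite sumrB -/(mxtrace M); ring.
  apply: le_trans (ler_normB _ _) _; rewrite mulrDl mul1r; apply: lerD => //.
  apply: le_trans (ler_norm_sum _ _ _) _; rewrite -mulrA.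
  have -> : N * (P * d) = \sum_(a < p.+1) P * d by rewrite sumr_const card_ord mulr_natl.
  by apply: ler_sum => a _; exact: hm.
(* The trace makes the diagonal about [h s2 / N]; after this normalization the first column is
   compared with [y], and the difference has a small residual. *)
pose z : 'cV[R]_p.+1 := (N / (h * s2)) *: m + (-1) *: y.
have hs0 : 0 < h * s2 by exact: mulr_gt0.
have rz a : `|yule_res th z a| <= K1 * d / (h * s2).
  rewrite /z yule_resD !yule_resZ ry; case: (unliftP ord0 a) => [b ->|->].
    rewrite (_ : (_ == _) = false) // mulr0 addr0 normrM ger0_norm; last by rewrite divr_ge0 ?ltW.
    have := gram_yule b Xd Sd tB; rewrite -/m => hb.
    rewrite mulrAC ler_wpM2r ?invr_ge0 ?(ltW hs0) //.
    apply: (@le_trans _ _ (N * ((2 + P * N * B) * d))); first by rewrite ler_wpM2l ?(ltW N0).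
    by rewrite mulrA ler_wpM2r // /K1 lerDr addr_ge0 // mulr_ge0.
  rewrite eqxx /yule_res unlift_none.
  have -> : N / (h * s2) * m ord0 0 + -1 * true%:R = (N * m ord0 0 - h * s2) / (h * s2).
    by rewrite /=; field; rewrite !gt_eqF.
  rewrite normrM [X in _ * X]ger0_norm ?invr_ge0 ?(ltW hs0) // ler_wpM2r ?invr_ge0 ?(ltW hs0) //.
  apply: le_trans hm0 _; rewrite ler_wpM2r // /K1 lerDl mulr_ge0 ?addr_ge0 ?mulr_ge0 //.
have K2 : 0 <= K1 * d / (h * s2) by apply: divr_ge0; [exact: mulr_ge0|exact: ltW].
have hz a : `|z a 0| <= q * (K1 * d / (h * s2)).
  apply: le_trans (entry_le_enorm _ _) _.
  have qK : 0 <= q * (K1 * d / (h * s2)) by exact: mulr_ge0.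
  have q2 : q ^+ 2 = N / c by rewrite sqr_sqrtr // divr_ge0 // ltW.
  rewrite -ler_sqr ?nnegrE ?enorm_ge0 // enorm_sqr exprMn q2.
  rewrite mulrAC ler_pdivlMr // mulrC; apply: le_trans (hc z) _.
  have -> : N * (K1 * d / (h * s2)) ^+ 2 = \sum_(a < p.+1) (K1 * d / (h * s2)) ^+ 2.
    by rewrite sumr_const card_ord mulr_natl.
  apply: ler_sum => b _; rewrite -normr_sqr ler_sqr ?nnegrE //.
have -> : M i j - h * (s2 / N * toep y i j) = (M i j - toep m i j) + h * s2 / N * toep z i j.
  rewrite ![toep _ _ _]mxE /z [X in _ = _ + _ * X]mxE [X in _ = _ + _ * (X + _)]mxE.
  rewrite [X in _ = _ + _ * (_ + X)]mxE; field.
  by rewrite !gt_eqF.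
apply: le_trans (ler_normD _ _) _.
have h2 : `|h * s2 / N * toep z i j| <= q * K1 / N * d.
  have hN : 0 <= h * s2 / N by apply: divr_ge0; exact: ltW.
  rewrite normrM ger0_norm // [toep _ _ _]mxE.
  apply: (@le_trans _ _ (h * s2 / N * (q * (K1 * d / (h * s2))))).
    by rewrite ler_wpM2l.
  by rewrite le_eqVlt; apply/orP; left; apply/eqP; field; rewrite !gt_eqF.
apply: le_trans (lerD (hm i j) h2) _; rewrite -mulrDl.
apply: (@le_trans _ _ (Tt * d)); first by rewrite ler_wpM2r // /Tt -addrA lerDr.
by rewrite /d mulrA mulrCA divff ?mulr1 // gt_eqF.
Qed.

End Gram.

(** * Measurability of the studentized error *)

Section MatrixMeasurability.
Context d (T : measurableType d) (R : realType).

Definition mmeas m n (A : T -> 'M[R]_(m, n)) := forall i j, measurable_fun setT (fun w => A w i j).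

Lemma mmeasM m n q (A : T -> 'M[R]_(m, n)) (B : T -> 'M[R]_(n, q)) : mmeas A -> mmeas B ->
  mmeas (fun w => A w *m B w).
Proof.
move=> mA mB i j; under eq_fun do rewrite mxE.
by apply: measurable_fun_bigsum => k; exact: measurable_funM.
Qed.

Lemma mmeasD m n (A B : T -> 'M[R]_(m, n)) : mmeas A -> mmeas B -> mmeas (fun w => A w + B w).
Proof. by move=> mA mB i j; under eq_fun do rewrite mxE; exact: measurable_funD. Qed.

Lemma mmeasZ m n (a : T -> R) (A : T -> 'M[R]_(m, n)) : measurable_fun setT a -> mmeas A ->
  mmeas (fun w => a w *: A w).
Proof. by move=> ma mA i j; under eq_fun do rewrite mxE; exact: measurable_funM. Qed.

Lemma mmeas_cst m n (A : 'M[R]_(m, n)) : mmeas (fun=> A).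
Proof. by move=> i j; exact: measurable_cst. Qed.

Lemma mmeas_sum m n (I : Type) (s : seq I) (A : I -> T -> 'M[R]_(m, n)) : (forall i, mmeas (A i)) ->
  mmeas (fun w => \sum_(i <- s) A i w).
Proof.
move=> mA i j; under eq_fun do rewrite summxE.
by apply: measurable_fun_bigsum => k; exact: mA.
Qed.

Lemma mmeas_tr m n (A : T -> 'M[R]_(m, n)) : mmeas A -> mmeas (fun w => (A w)^T).
Proof. by move=> mA i j; under eq_fun do rewrite mxE; exact: mA. Qed.

Lemma mmeas_trace n (A : T -> 'M[R]_n) : mmeas A -> measurable_fun setT (fun w => \tr (A w)).
Proof. by move=> mA; apply: measurable_fun_bigsum => i; exact: mA. Qed.

Lemma mmeas_normsq n (A : T -> 'cV[R]_n) : mmeas A -> measurable_fun setT (fun w => normsq (A w)).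
Proof. by move=> mA; apply: measurable_fun_bigsum => i; apply: measurable_funX; exact: mA. Qed.

Lemma mmeas_det n (A : T -> 'M[R]_n) : mmeas A -> measurable_fun setT (fun w => \det (A w)).
Proof.
move=> mA; apply: measurable_fun_bigsum => s; apply: measurable_funM => //.
by apply: measurable_fun_bigprod => i; exact: mA.
Qed.

Lemma mmeas_adj n (A : T -> 'M[R]_n) : mmeas A -> mmeas (fun w => \adj (A w)).
Proof.
move=> mA i j; under eq_fun do rewrite mxE.
apply: measurable_funM => //; apply: mmeas_det => k l.
by under eq_fun do rewrite !mxE; exact: mA.
Qed.

Lemma measurable_fun_pos_inv (f : T -> R) : measurable_fun setT f -> (forall w, 0 <= f w) ->
  measurable_fun setT (fun w => (f w)^-1).
Proof.
move=> mf f0; rewrite (_ : (fun w => _) = fun w => f w `^ (-1)).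
  exact: (measurableT_comp (measurable_powR _) mf).
by apply/funext => w; rewrite powR_inv1.
Qed.

Lemma measurable_fun_sqrtr (f : T -> R) : measurable_fun setT f -> (forall w, 0 <= f w) ->
  measurable_fun setT (fun w => Num.sqrt (f w)).
Proof.
move=> mf f0; rewrite (_ : (fun w => _) = fun w => f w `^ (2^-1)).
  exact: (measurableT_comp (measurable_powR _) mf).
by apply/funext => w; rewrite powR12_sqrt.
Qed.

(** Cramer's formula on the event of positive determinant. The maximum with 0 keeps the denominator
    nonnegative, where inversion is a measurable power. *)
Lemma mmeas_gen_inv n (A : T -> 'M[R]_n) : mmeas A -> mmeas (fun w => gen_inv (A w)).
Proof.
move=> mA i j; pose D := [set w | 0 < \det (A w)].
have mD : measurable D by apply: measurable_set_lt => //; exact: mmeas_det.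
rewrite (_ : (fun w => _) = fun w => (w \in D)%:R * ((Num.max 0 (\det (A w)))^-1 * \adj (A w) i j)).
  apply: measurable_funM; first exact: measurable_fun_ind.
  apply: measurable_funM; last exact: mmeas_adj.
  apply: measurable_fun_pos_inv => [|w]; last by rewrite le_max lexx.
  by apply: measurable_maxr => //; exact: mmeas_det.
apply/funext => w; rewrite /gen_inv.
have -> : (w \in D) = (0 < \det (A w)) by apply/idP/idP => [/set_mem|/mem_set].
case: ifPn => h /=; last by rewrite mxE mul0r.
rewrite mul1r max_r ?ltW // /invmx unitmxE unitfE gt_eqF // mxE //.
Qed.

Lemma mmeas_psd_sqrt n (A : T -> 'M[R]_n) : mmeas A -> (forall w, psd (A w)) ->
  mmeas (fun w => psd_sqrt (A w)).
Proof.
move=> mA pA.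
pose B w : 'M[R]_n := 1%:M + (- (\tr (A w))^-1) *: A w.
have BE w : B w = 1%:M - (\tr (A w))^-1 *: A w by rewrite /B scaleNr.
have t0 w : 0 <= \tr (A w) by exact: psd_trace_ge0.
have mB : mmeas B.
  apply: mmeasD; first exact: mmeas_cst.
  apply: mmeasZ => //; apply: measurableT_comp => //.
  by apply: measurable_fun_pos_inv => //; exact: mmeas_trace.
have mY k : mmeas (fun w => sqrt_iter (B w) k).
  elim: k => [|k IH] /=; first exact: mmeas_cst.
  apply: mmeasZ => //; apply: mmeasD => //; exact: mmeasM.
have mL : mmeas (fun w => sqrt_lim (B w)).
  move=> i j; apply: (measurable_fun_cvg (h := fun k w => sqrt_iter (B w) k i j)) => [k|w _].
    exact: mY.
  have [pB B1] := residual_psd (pA w); rewrite BE; exact: sqrt_iter_cvg.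
apply: mmeasZ; first by apply: measurable_fun_sqrtr => //; exact: mmeas_trace.
rewrite (_ : (fun w => _) = fun w => 1%:M + (-1) *: sqrt_lim (B w)); last first.
  by apply/funext => w; rewrite BE scaleN1r.
apply: mmeasD; first exact: mmeas_cst.
by apply: mmeasZ.
Qed.

Variables (p : nat) (e : nat -> T -> R) (th : 'cV[R]_p.+1).

Lemma mmeas_ar_X n : (forall k, (k < n)%N -> measurable_fun setT (e k)) ->
  mmeas (fun w => ar_X th (fun k => e k w) n).
Proof.
elim: n => [|n IH] me.
  under [X in mmeas X]eq_fun do rewrite ar_X0; exact: mmeas_cst.
under [X in mmeas X]eq_fun do rewrite ar_XS.
apply: mmeasD; last by apply: mmeasZ; [exact: me|exact: mmeas_cst].
by apply: mmeasM; [exact: mmeas_cst|apply: IH => k kn; apply: me; exact: ltnW].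
Qed.

(** The bound [n.-1] reflects the delay: [M_n] stops at [X_(n-1)], which involves the first [n - 1]
    noises only. *)
Lemma mmeas_ar_M n : (forall k, (k < n.-1)%N -> measurable_fun setT (e k)) ->
  mmeas (fun w => ar_M th (fun k => e k w) n).
Proof.
move=> me; have -> : (fun w => ar_M th (fun k => e k w) n) = fun w => \sum_(k < n)
    (ar_X th (fun k => e k w) k *m (ar_X th (fun k => e k w) k)^T) by [].
apply: mmeas_sum => k; have mX : mmeas (fun w => ar_X th (fun k => e k w) k).
  by apply: mmeas_ar_X => l lk; apply: me; have := ltn_ord k; lia.
by apply: mmeasM => //; exact: mmeas_tr.
Qed.

Hypothesis me : forall k, measurable_fun setT (e k).

Lemma mmeas_statistic n : mmeas (fun w => sqrtmx (ar_M th (fun k => e k w) n)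
  *m (ls_est th (fun k => e k w) n - th)).
Proof.
have mM : mmeas (fun w => ar_M th (fun k => e k w) n) by apply: mmeas_ar_M => k _.
apply: mmeasM.
  under [X in mmeas X]eq_fun do rewrite (sqrtmxE (ar_M_psd _ _ _)).
  by apply: mmeas_psd_sqrt => // w; exact: ar_M_psd.
apply: mmeasD; last exact: mmeas_cst.
apply: mmeasM; first exact: mmeas_gen_inv.
apply: mmeas_sum => k; apply: mmeasZ; last by apply: mmeas_ar_X.
under eq_fun do rewrite ar_xE; exact: mmeas_ar_X.
Qed.

Lemma measurable_event (sigma h : R) (t : 'cV[R]_p.+1) : measurable [set w | exists n : nat,
    is_tau th (fun k => e k w) sigma h n /\
    forall i, (sqrtmx (ar_M th (fun k => e k w) n) *m (ls_est th (fun k => e k w) n - th)) i 0 <= t i 0].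
Proof.
rewrite (_ : mkset _ = \bigcup_n ([set w | is_tau th (fun k => e k w) sigma h n] `&`
  [set w | forall i, (sqrtmx (ar_M th (fun k => e k w) n) *m (ls_est th (fun k => e k w) n - th)) i 0 <= t i 0])).
  apply: bigcupT_measurable => n; apply: measurableI; last first.
    apply: measurable_set_forall => i; apply: measurable_set_le => //.
    exact: mmeas_statistic.
  have mt k : measurable_fun setT (fun w => \tr (ar_M th (fun k => e k w) k)).
    by apply: mmeas_trace; apply: mmeas_ar_M => l _.
  have [n1|n1] := boolP (1 <= n)%N; last first.
    by rewrite (_ : mkset _ = set0) //; apply/seteqP; split => // w [] h1; rewrite h1 in n1.
  (* The finite range includes [m = 0], which [is_tau] leaves unconstrained; a filler below the
     level makes that case vacuous. *)
  rewrite (_ : mkset _ = [set w | h * sigma ^+ 2 <= \tr (ar_M th (fun k => e k w) n)] `&`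
    [set w | forall m : 'I_n, (if (1 <= m)%N then \tr (ar_M th (fun k => e k w) m) else h * sigma ^+ 2 - 1) < h * sigma ^+ 2]).
    apply: measurableI; first exact: measurable_set_le.
    apply: measurable_set_forall => m; apply: measurable_set_lt => //.
    by case: (0 < m)%N.
  apply/seteqP; split => [w [_ a b]|w [a b]].
    split=> // m; case: ifP => [m1|_]; first by apply: b; rewrite m1 /=.
    by rewrite ltrBlDr ltrDl.
  split => // m /andP[m1 mn]; have := b (Ordinal mn); by rewrite /= m1.
apply/seteqP; split => [w [n [a b]]|w [n _ [a b]]]; first by exists n.
by exists n.
Qed.

End MatrixMeasurability.

(** * Whitening and stopping *)

Section Whitening.
Variables (R : realType) (p : nat).
Implicit Types (v u : 'cV[R]_p) (E M : 'M[R]_p).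

Lemma bformD E M u v : bform (E + M) u v = bform E u v + bform M u v.
Proof. by rewrite /bform mulmxDr mulmxDl mxE. Qed.

Lemma frob_mul E v : normsq (E *m v) <= frob E * normsq v.
Proof.
rewrite /normsq /frob mulr_suml; apply: ler_sum => i _; rewrite mxE; exact: sum_cauchy.
Qed.

Lemma frob_entry_le E (xi : R) : (forall i j, `|E i j| <= xi) -> frob E <= (p%:R * xi) ^+ 2.
Proof.
move=> hE; have -> : (p%:R * xi) ^+ 2 = \sum_(i < p) \sum_(j < p) xi ^+ 2.
  by rewrite !sumr_const card_ord -mulrnA -[RHS]mulr_natl natrM; ring.
apply: ler_sum => i _; apply: ler_sum => j _.
have x0 : 0 <= xi by apply: le_trans (hE i j).
by rewrite -normr_sqr ler_sqr ?nnegrE.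
Qed.

Lemma entry_mul_le E (xi : R) v : 0 <= xi -> (forall i j, `|E i j| <= xi) ->
  enorm (E *m v) <= p%:R * xi * enorm v.
Proof.
move=> x0 hE; have q0 : 0 <= p%:R * xi by rewrite mulr_ge0.
rewrite -ler_sqr ?nnegrE ?enorm_ge0 //; last by rewrite mulr_ge0 ?enorm_ge0.
rewrite exprMn !enorm_sqr; apply: le_trans (frob_mul _ _) _.
by rewrite ler_wpM2r ?normsq_ge0 // frob_entry_le.
Qed.

Lemma entry_form_le E (xi : R) u v : 0 <= xi -> (forall i j, `|E i j| <= xi) ->
  `|bform E u v| <= p%:R * xi * (enorm u * enorm v).
Proof.
move=> x0 hE; rewrite bform_mulr; apply: le_trans (dot_le_enorm _ _) _.
by rewrite mulrCA ler_wpM2l ?enorm_ge0 // entry_mul_le.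
Qed.

Lemma enorm_le_sum v (a : R) : 0 <= a -> (forall i, `|v i 0| <= a) -> enorm v <= p%:R * a.
Proof.
move=> a0 hv; rewrite -ler_sqr ?nnegrE ?enorm_ge0 ?mulr_ge0 // enorm_sqr.
apply: (@le_trans _ _ (\sum_(i < p) a ^+ 2)).
  by apply: ler_sum => i _; rewrite -normr_sqr ler_sqr ?nnegrE.
rewrite sumr_const card_ord exprMn -[X in X <= _]mulr_natl ler_wpM2r ?sqr_ge0 // -natrX ler_nat.
by case: (p) => // q; rewrite -mulnn leq_pmulr.
Qed.

Lemma psd_enorm_le G v : psd G -> enorm (G *m v) <= \tr G * enorm v.
Proof.
move=> pG; have t0 := psd_trace_ge0 pG.
rewrite -ler_sqr ?nnegrE ?enorm_ge0 ?mulr_ge0 ?enorm_ge0 // exprMn !enorm_sqr expr2 -mulrA.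
apply: le_trans (psd_mul_le_trace _ pG) _; apply: ler_wpM2l => //; exact: psd_le_trace.
Qed.

Variables (G : 'M[R]_p) (g : R).
Hypotheses (pG : psd G) (g0 : 0 < g) (hG : forall v, g * normsq v <= bform G v v).

Lemma coercive_enorm v : g * enorm v <= enorm (G *m v).
Proof.
have [->|v0] := eqVneq (enorm v) 0; first by rewrite mulr0 enorm_ge0.
have vp : 0 < enorm v by rewrite lt_def v0 enorm_ge0.
rewrite -(ler_pM2l vp) mulrCA -expr2 enorm_sqr; apply: le_trans (hG v) _.
rewrite bform_mulr; apply: le_trans (ler_norm _) _; exact: dot_le_enorm.
Qed.

Lemma coercive_unit : G \in unitmx.
Proof.
rewrite -row_free_unit -kermx_eq0; apply/eqP/row_matrixP => i; rewrite row0.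
set r := row i _; have rG : G *m r^T = 0.
  by rewrite -[G]pG.1 -trmx_mul /r -row_mul mulmx_ker row0 trmx0.
have := coercive_enorm r^T; rewrite rG enorm0 => h.
have r0 : enorm r^T = 0.
  by apply/eqP; rewrite eq_le enorm_ge0 andbT -(ler_pM2l g0) mulr0.
by apply: trmx_inj; rewrite (enorm_eq0 r0) trmx0.
Qed.

Lemma enorm_invmx v : enorm (invmx G *m v) <= enorm v / g.
Proof.
rewrite ler_pdivlMr // mulrC; apply: le_trans (coercive_enorm _) _.
by rewrite mulKVmx ?coercive_unit.
Qed.

Lemma invmx_sym : (invmx G)^T = invmx G.
Proof. by rewrite trmx_inv pG.1. Qed.

Variables (M : 'M[R]_p) (h xi : R).
Hypotheses (pM : psd M) (h0 : 0 < h) (x0 : 0 <= xi).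
Hypothesis hM : forall i j, `|M i j - h * (G *m G) i j| <= xi * h.

(** The deviation is [M / h - G^2] conjugated by [G^-1], whose norm is at most [1 / g]. *)
Lemma whitened_gram i j :
  `|h^-1 * (invmx G *m M *m (invmx G)^T) i j - (i == j)%:R| <= p%:R * xi / g ^+ 2.
Proof.
pose E := h^-1 *: M - G *m G.
have hE a b : `|E a b| <= xi.
  have -> : E a b = h^-1 * (M a b - h * (G *m G) a b).
    by rewrite 3!mxE; field; rewrite gt_eqF.
  rewrite normrM gtr0_norm ?invr_gt0 // ler_pdivrMl //; apply: le_trans (hM a b) _.
  by rewrite mulrC.
have -> : h^-1 * (invmx G *m M *m (invmx G)^T) i j - (i == j)%:R =
   (invmx G *m E *m (invmx G)^T) i j.
  rewrite /E mulmxBr mulmxBl -scalemxAr -scalemxAl [RHS]mxE [X in _ = X + _]mxE [X in _ = _ + X]mxE.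
  by rewrite mulKmx ?coercive_unit // invmx_sym mulmxV ?coercive_unit // [1%:M _ _]mxE.
have -> : (invmx G *m E *m (invmx G)^T) i j =
   bform E (invmx G *m delta_mx i 0) (invmx G *m delta_mx j 0).
  rewrite -bform_delta /bform trmx_mul -!mulmxA; congr (fun_of_matrix _ 0 0).
  by rewrite !invmx_sym.
apply: le_trans (entry_form_le _ _ x0 hE) _; apply: ler_wpM2l; first exact: mulr_ge0.
have hd k : enorm (invmx G *m delta_mx k 0) <= g^-1.
  by apply: le_trans (enorm_invmx _) _; rewrite /enorm normsq_delta sqrtr1 mul1r.
by rewrite expr2 invfM; apply: ler_pM; rewrite ?enorm_ge0.
Qed.

Hypothesis small : p%:R * xi <= g ^+ 2 / 2.

Lemma perturbed_lower v : h * (g ^+ 2 / 2) * normsq v <= bform M v v.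
Proof.
pose E := M - h *: (G *m G).
have hE i j : `|E i j| <= xi * h by rewrite 3!mxE; exact: hM.
have -> : bform M v v = h * normsq (G *m v) + bform E v v.
  by rewrite normsq_mul_sqr ?pG.1 // -bformZ -bformD addrC subrK.
have xh : 0 <= xi * h by rewrite mulr_ge0 // ltW.
have := entry_form_le v v xh hE; rewrite -expr2 enorm_sqr ler_norml => /andP[lo _].
have g2 : g ^+ 2 * normsq v <= normsq (G *m v).
  rewrite -!enorm_sqr -exprMn ler_sqr ?nnegrE ?enorm_ge0 ?coercive_enorm //.
  by rewrite mulr_ge0 ?enorm_ge0 // ltW.
have N0 := normsq_ge0 v.
have a1 : p%:R * (xi * h) * normsq v <= g ^+ 2 / 2 * h * normsq v.
  by rewrite mulrA ler_wpM2r // ler_wpM2r // ltW.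
have a2 : h * (g ^+ 2 * normsq v) <= h * normsq (G *m v) by rewrite ler_pM2l.
have e1 : h * (g ^+ 2 / 2) * normsq v = h * (g ^+ 2 * normsq v) - g ^+ 2 / 2 * h * normsq v by field.
rewrite e1; lra.
Qed.

(** The determinant is a square, that of the square root, and it is nonzero by coercivity; so the
    generalized inverse is the true inverse. *)
Lemma perturbed_det : 0 < \det M.
Proof.
have [p1 e1] := sqrtmxP pM.
rewrite -e1 det_mulmx -expr2 lt_def sqr_ge0 andbT sqrf_eq0 -unitfE -unitmxE.
have u : M \in unitmx.
  have gg : 0 < h * (g ^+ 2 / 2) by rewrite mulr_gt0 // divr_gt0 // exprn_gt0.
  rewrite -row_free_unit -kermx_eq0; apply/eqP/row_matrixP => i; rewrite row0.
  set r := row i _; have rG : M *m r^T = 0.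
    by rewrite -[M]pM.1 -trmx_mul /r -row_mul mulmx_ker row0 trmx0.
  have := perturbed_lower r^T; rewrite bform_mulr rG big1 => [hh|k _]; last by rewrite [X in _ * X]mxE mulr0.
  have /normsq_eq0 r0 : normsq r^T = 0.
    by apply/eqP; rewrite eq_le normsq_ge0 andbT -(ler_pM2l gg) mulr0.
  by apply: trmx_inj; rewrite r0 trmx0.
by move: u; rewrite -{1}e1 unitmx_mul => /andP[].
Qed.

(** With [R1 = sqrt M] and [R2 = sqrt h G], both [R1 Z] and [R2 U] equal [S], so
    [R2 (Z - U) = (R2 - R1) Z]. The Lipschitz bound on roots controls the right side, and smallness
    of [xi] gives [|Z| <= 2 |U|]. *)
Lemma whitened_close (S Z U : 'cV[R]_p) :
  Z = sqrtmx M *m (invmx M *m S) -> U = (Num.sqrt h)^-1 *: (invmx G *m S) ->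
  enorm (Z - U) <= 2 * (p%:R * xi) / g ^+ 2 * enorm U.
Proof.
move=> ZE UE; have [p1 e1] := sqrtmxP pM; set R1 := sqrtmx M in p1 e1 ZE.
have uM : M \in unitmx by rewrite unitmxE unitfE gt_eqF ?perturbed_det.
pose s := Num.sqrt h; have s0 : 0 < s by rewrite sqrtr_gt0.
have s2 : s ^+ 2 = h by rewrite sqr_sqrtr // ltW.
pose R2 := s *: G.
have p2 : psd R2.
  split; first by rewrite linearZ /= pG.1.
  by move=> v; rewrite -/(bform R2 v v) bformZ; apply: mulr_ge0; [exact: ltW|exact: pG.2].
have c2 v : s * g * normsq v <= bform R2 v v by rewrite bformZ -mulrA ler_pM2l.
have R1Z : R1 *m Z = S by rewrite ZE mulmxA e1 mulKVmx.
have R2U : R2 *m U = S.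
  by rewrite /R2 UE -scalemxAl -scalemxAr mulKVmx ?coercive_unit // scalerA divff ?scale1r // gt_eqF.
have D : R2 *m (Z - U) = (R2 - R1) *m Z by rewrite mulmxBr mulmxBl R2U R1Z.
have f1 : (s * g) ^+ 2 * frob (R1 - R2) <= (p%:R * (xi * h)) ^+ 2.
  apply: le_trans (psd_sqrt_perturb p1 p2 (mulr_gt0 s0 g0) c2) _.
  apply: frob_entry_le => i j; rewrite e1 /R2 -scalemxAl -scalemxAr scalerA -expr2 s2.
  by rewrite 3!mxE; exact: hM.
have f2 : (s * g) ^+ 2 * normsq (Z - U) <= frob (R1 - R2) * normsq Z.
  have : normsq (R2 *m (Z - U)) <= frob (R1 - R2) * normsq Z.
    by rewrite D -opprB mulNmx -[normsq _]enorm_sqr -scaleN1r enormZ normrN1 mul1r enorm_sqr frob_mul.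
  apply: le_trans; rewrite -!enorm_sqr -exprMn.
  rewrite ler_sqr ?nnegrE ?enorm_ge0 //; last by rewrite mulr_ge0 ?enorm_ge0 // mulr_ge0 // ltW.
  by rewrite /R2 -scalemxAl enormZ gtr0_norm // -mulrA ler_pM2l // coercive_enorm.
have f3 : g ^+ 2 * enorm (Z - U) <= p%:R * xi * enorm Z.
  have px : 0 <= p%:R * xi * enorm Z by rewrite !mulr_ge0 ?enorm_ge0.
  have gz : 0 <= g ^+ 2 * enorm (Z - U) by apply: mulr_ge0; [exact: sqr_ge0|exact: enorm_ge0].
  rewrite -ler_sqr ?nnegrE // !exprMn !enorm_sqr.
  have h20 : 0 < h ^+ 2 by exact: exprn_gt0.
  rewrite -(ler_pM2l h20).
  have -> : h ^+ 2 * ((g ^+ 2) ^+ 2 * normsq (Z - U)) = (s * g) ^+ 2 * ((s * g) ^+ 2 * normsq (Z - U)).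
    by rewrite -s2; ring.
  apply: (@le_trans _ _ ((s * g) ^+ 2 * (frob (R1 - R2) * normsq Z))).
    by rewrite ler_wpM2l ?sqr_ge0.
  rewrite mulrA; have -> : h ^+ 2 * (p%:R ^+ 2 * xi ^+ 2 * normsq Z) = (p%:R * (xi * h)) ^+ 2 * normsq Z by ring.
  by rewrite ler_wpM2r ?normsq_ge0.
have g20 : 0 < g ^+ 2 by exact: exprn_gt0.
have ZU : enorm Z <= 2 * enorm U.
  have := enormD (Z - U) U; rewrite subrK => h1.
  have h2 : g ^+ 2 * enorm (Z - U) <= g ^+ 2 * (enorm Z / 2).
    apply: le_trans f3 _; have -> : g ^+ 2 * (enorm Z / 2) = g ^+ 2 / 2 * enorm Z by ring.
    by rewrite ler_wpM2r ?enorm_ge0.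
  move: h2; rewrite ler_pM2l // => h2; lra.
rewrite mulrAC ler_pdivlMr // mulrC; apply: le_trans f3 _.
have -> : 2 * (p%:R * xi) * enorm U = p%:R * xi * (2 * enorm U) by ring.
by rewrite ler_wpM2l // mulr_ge0.
Qed.

End Whitening.

Section Stopping.
Variables (R : realType) (p : nat) (th : 'cV[R]_p.+1) (e : nat -> R).
Local Notation X := (ar_X th e).
Local Notation M := (ar_M th e).

Lemma trace_ar_M_mono m n : (m <= n)%N -> \tr (M m) <= \tr (M n).
Proof.
move=> mn; rewrite !trace_ar_M -!(big_mkord xpredT (fun k => normsq (X k))).
rewrite [X in _ <= X](@big_cat_nat _ _ _ m) //= lerDl big_nat; apply: sumr_ge0 => k _; exact: normsq_ge0.
Qed.

Lemma trace_ar_MS n : \tr (M n.+1) = \tr (M n) + normsq (X n).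
Proof. by rewrite !trace_ar_M big_ord_recr. Qed.

Lemma trace_ar_M0 : \tr (M 0) = 0.
Proof. by rewrite trace_ar_M big_ord0. Qed.

(* Dropping the large states as well makes the whitened increments small on the whole space, while
   nothing is dropped on the good event. *)
Definition running (a d : R) k : R := ((\tr (M k) < a) && (normsq (X k) <= d))%:R.

Lemma running_bound a d n : 0 <= a -> 0 <= d ->
  \sum_(k < n) running a d k * normsq (X k) <= a + d.
Proof.
move=> a0 d0.
suff : \sum_(k < n) running a d k * normsq (X k) <= a + d /\
    \sum_(k < n) running a d k * normsq (X k) <= \tr (M n) by case.
have N0 k : 0 <= normsq (X k) by exact: normsq_ge0.
elim: n => [|n [IH1 IH2]]; first by rewrite !big_ord0 trace_ar_M0 addr_ge0.
rewrite !big_ord_recr /= trace_ar_MS /running; split.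
  case: andP => [[ta qd]|_] /=; last by rewrite mul0r addr0.
  rewrite mul1r; apply: lerD => //; apply: le_trans IH2 _; exact: ltW.
apply: lerD => //; rewrite -[X in _ <= X]mul1r; apply: ler_wpM2r => //.
by case: (_ && _).
Qed.

Variables sigma h : R.
Hypotheses (sg0 : 0 < sigma) (h0 : 0 < h).
Local Notation a := (h * sigma ^+ 2).

Lemma tau_exists n : a <= \tr (M n) -> exists2 t, is_tau th e sigma h t & (t <= n)%N.
Proof.
move=> an; have ex : exists t, a <= \tr (M t) by exists n.
have a0 : 0 < a by rewrite mulr_gt0 // exprn_gt0.
have [t ta tmin] := ex_minnP ex; exists t; last exact: tmin.
split=> //; first by case: t ta {tmin} => // ; rewrite trace_ar_M0 leNgt a0.
by move=> m /andP[_ mt]; rewrite ltNge; apply/negP => /tmin; rewrite leqNgt mt.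
Qed.

Lemma tau_unique m n : is_tau th e sigma h m -> is_tau th e sigma h n -> m = n.
Proof.
move=> [m1 ma mm] [n1 na nn]; apply/eqP; rewrite eqn_leq; apply/andP; split; rewrite leqNgt; apply/negP => lt.
  by have := mm n; rewrite n1 lt => /(_ isT); rewrite ltNge na.
by have := nn m; rewrite m1 lt => /(_ isT); rewrite ltNge ma.
Qed.

(** As the trace never decreases, not having stopped by time [k] can be read off [M_k], hence off
    the past; [M_0 = 0] settles [k = 0]. *)
Lemma before_tau t k : is_tau th e sigma h t -> (\tr (M k) < a) = (k < t)%N.
Proof.
move=> [t1 ta tt]; apply/idP/idP => [|kt].
  by rewrite [(k < t)%N]ltnNge; apply: contraL => tk; rewrite -leNgt (le_trans ta) // trace_ar_M_mono.
case: k kt => [|k] kt; last exact: tt.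
by rewrite trace_ar_M0 mulr_gt0 // exprn_gt0.
Qed.

Lemma running_sum t d n (F : nat -> R) : is_tau th e sigma h t -> (t <= n)%N ->
  (forall k, (k < t)%N -> normsq (X k) <= d) ->
  \sum_(k < n) running a d k * F k = \sum_(k < t) F k.
Proof.
move=> ht tn hX; rewrite (big_ord_widen n F tn) [RHS]big_mkcond /=; apply: eq_bigr => k _.
rewrite /running (before_tau _ ht); case: ifP => [kt|_] /=; last by rewrite mul0r.
by rewrite hX // mul1r.
Qed.

Variables (d d1 r lam g xi : R) (G : 'M[R]_p.+1) (n : nat).

Definition whitened k : 'cV[R]_p.+1 :=
  (running a d k / (sigma * Num.sqrt h)) *: (invmx G *m X k).

Definition wsum : 'cV[R]_p.+1 := \col_i \sum_(k < n) whitened k i 0 * e k.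

Hypotheses (pG : psd G) (g0 : 0 < g) (hG : forall v, g * normsq v <= bform G v v).

Lemma whitened_enorm k : d <= (d1 * sigma * g) ^+ 2 * h -> 0 <= d1 -> enorm (whitened k) <= d1.
Proof.
move=> hd d10; have s0 : 0 < sigma * Num.sqrt h by rewrite mulr_gt0 // sqrtr_gt0.
rewrite /whitened /running; case: andP => [[_ qd]|_] /=; last by rewrite mul0r scale0r enorm0.
rewrite enormZ mul1r gtr0_norm ?invr_gt0 // mulrC ler_pdivrMr //.
apply: le_trans (enorm_invmx pG g0 hG _) _; rewrite ler_pdivrMr //.
have q0 : 0 <= d1 * (sigma * Num.sqrt h) * g by rewrite mulr_ge0 ?(ltW g0) // mulr_ge0 ?(ltW s0).
rewrite -ler_sqr ?nnegrE ?enorm_ge0 // enorm_sqr; apply: le_trans qd _; apply: le_trans hd _.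
have s2 : Num.sqrt h ^+ 2 = h by rewrite sqr_sqrtr // ltW.
by rewrite le_eqVlt; apply/orP; left; apply/eqP; rewrite -[in LHS]s2; ring.
Qed.

Lemma whitened_sqr_sum i : 0 <= d ->
  \sum_(k < n) whitened k i 0 ^+ 2 <= (a + d) / (sigma ^+ 2 * h * g ^+ 2).
Proof.
move=> d0; have s2 : Num.sqrt h ^+ 2 = h by rewrite sqr_sqrtr // ltW.
have sg : 0 < sigma ^+ 2 * h by rewrite mulr_gt0 // exprn_gt0.
have g2 : 0 < g ^+ 2 by rewrite exprn_gt0.
have a0 : 0 <= a by rewrite mulr_ge0 ?sqr_ge0 // ltW.
apply: (@le_trans _ _ (\sum_(k < n) (running a d k * normsq (X k)) / (sigma ^+ 2 * h * g ^+ 2))); last first.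
  rewrite -mulr_suml; apply: ler_wpM2r; last exact: running_bound.
  by rewrite invr_ge0 mulr_ge0 // ltW.
apply: ler_sum => k _; rewrite mxE exprMn /running; case: (_ && _) => /=; last first.
  by rewrite !mul0r expr0n /= mul0r.
have hn := le_trans (entry_le_enorm _ i) (enorm_invmx pG g0 hG (X k)).
have q0 : 0 <= enorm (X k) / g by apply: divr_ge0; [exact: enorm_ge0|exact: ltW].
have hh : (invmx G *m X k) i 0 ^+ 2 <= normsq (X k) / g ^+ 2.
  by rewrite -[X in X <= _]normr_sqr -enorm_sqr -expr_div_n ler_sqr ?nnegrE.
have -> : 1 * normsq (X k) / (sigma ^+ 2 * h * g ^+ 2) = (sigma ^+ 2 * h)^-1 * (normsq (X k) / g ^+ 2).
  by field; rewrite !gt_eqF.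
have -> : (1 / (sigma * Num.sqrt h)) ^+ 2 = (sigma ^+ 2 * h)^-1.
  by rewrite mul1r exprVn exprMn s2.
by rewrite ler_wpM2l // invr_ge0 ltW.
Qed.

Hypotheses (x0 : 0 <= xi) (small : p.+1%:R * xi <= g ^+ 2 / 2) (lam0 : 0 <= lam) (dd1 : d <= d1).
Hypothesis Hgram : forall m, normsq (X m) <= d1 -> (forall i, `|ar_S th e m i 0| <= d1) ->
  `|\tr (M m) - a| <= d1 -> forall i j, `|M m i j - h * (G *m G) i j| <= xi * h.
Hypothesis Hinc : forall m, \tr (M m.-1) < a -> (forall i, (i < m)%N -> `|e i| <= r) ->
  forall k, (k <= m)%N -> normsq (X k) <= d.
Hypothesis Htau : a <= \tr (M n).
Hypothesis He : forall k, (k < n)%N -> `|e k| <= r.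
Hypothesis HW : forall i, `|wsum i 0| <= lam.
Hypothesis HS : sigma * Num.sqrt h * \tr G * (p.+1%:R * lam) <= d1.

(** All that happens on one noise path outside the rare events, without probability: states are
    bounded, then [S_tau], then the Gram matrix is identified, and finally the studentized error is
    compared with the martingale. *)
Lemma path_conclusion : exists t, [/\ is_tau th e sigma h t,
  forall i j, `|sigma ^+ 2 * (\sum_(k < n) whitened k i 0 * whitened k j 0) - (i == j)%:R|
     <= p.+1%:R * xi / g ^+ 2 &
  forall i, `|(sqrtmx (M t) *m (ls_est th e t - th)) i 0 - sigma * wsum i 0|
     <= 2 * (p.+1%:R * xi) / g ^+ 2 * (sigma * (p.+1%:R * lam))].
Proof.
have [t ht tn] := tau_exists Htau; exists t.
have [t1 ta tt] := ht.
have tpred : \tr (M t.-1) < a by rewrite (before_tau _ ht) prednK.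
have hX k : (k <= t)%N -> normsq (X k) <= d.
  by apply: Hinc tpred _ _ => i it; apply: He; apply: leq_trans tn.
have hX' k : (k < t)%N -> normsq (X k) <= d by move=> kt; apply/hX/ltnW.
pose s := Num.sqrt h; have s0 : 0 < s by rewrite sqrtr_gt0.
have s2 : s ^+ 2 = h by rewrite sqr_sqrtr // ltW.
have uG := coercive_unit pG g0 hG.
have WE : wsum = (sigma * s)^-1 *: (invmx G *m ar_S th e t).
  apply/matrixP => i j; rewrite ord1 [LHS]mxE [RHS]mxE.
  have -> : (invmx G *m ar_S th e t) i 0 = \sum_(k < t) (invmx G *m X k) i 0 * e k.
    rewrite /ar_S mulmx_sumr summxE; apply: eq_bigr => k _.
    by rewrite -scalemxAr mxE mulrC.
  rewrite -(@running_sum t d n (fun k => (invmx G *m X k) i 0 * e k) ht tn hX') mulr_sumr.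
  by apply: eq_bigr => k _; rewrite mxE; ring.
have Wn : enorm wsum <= p.+1%:R * lam by exact: enorm_le_sum.
(* [S_tau] is recovered from the bounded martingale value, which shows that it is of order
   [sqrt h]. *)
have SE : ar_S th e t = (sigma * s) *: (G *m wsum).
  by rewrite WE -scalemxAr scalerA divff ?scale1r ?mulKVmx // mulf_neq0 // gt_eqF.
have hS i : `|ar_S th e t i 0| <= d1.
  apply: le_trans (entry_le_enorm _ i) _; apply: le_trans HS.
  rewrite SE enormZ gtr0_norm ?mulr_gt0 // -[X in _ <= X]mulrA.
  apply: ler_wpM2l; first by apply: mulr_ge0; exact: ltW.
  apply: le_trans (psd_enorm_le _ pG) _.
  by rewrite ler_wpM2l // psd_trace_ge0.
(* Just before stopping the trace is below the level, so the overshoot is at most the last squared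
   state. *)
have htr : `|\tr (M t) - a| <= d1.
  rewrite ger0_norm ?subr_ge0 //; apply: le_trans dd1.
  have -> : \tr (M t) = \tr (M t.-1) + normsq (X t.-1).
    by rewrite -trace_ar_MS prednK.
  have := hX t.-1 (leq_pred t); move: tpred; set q := normsq _; set tr := \tr _; lra.
have hM := Hgram (le_trans (hX t (leqnn _)) dd1) hS htr.
have pM := ar_M_psd th e t.
split=> // [i j|i].
  have := whitened_gram pG g0 hG h0 x0 hM i j.
  suff -> : sigma ^+ 2 * (\sum_(k < n) whitened k i 0 * whitened k j 0) =
     h^-1 * (invmx G *m M t *m (invmx G)^T) i j by [].
  have -> : (invmx G *m M t *m (invmx G)^T) i j =
      \sum_(k < t) (invmx G *m X k) i 0 * (invmx G *m X k) j 0.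
    rewrite /ar_M mulmx_sumr mulmx_suml summxE; apply: eq_bigr => k _.
    by rewrite mulmxA -mulmxA -trmx_mul mxE big_ord1 [X in _ * X]mxE.
  rewrite -(@running_sum t d n (fun k => (invmx G *m X k) i 0 * (invmx G *m X k) j 0) ht tn hX').
  rewrite !mulr_sumr; apply: eq_bigr => k _.
  rewrite [whitened k i 0]mxE [whitened k j 0]mxE -/s -s2 /running.
  by case: (_ && _) => /=; field; rewrite ?gt_eqF.
pose Z := sqrtmx (M t) *m (ls_est th e t - th).
pose U : 'cV[R]_p.+1 := s^-1 *: (invmx G *m ar_S th e t).
have ZE : Z = sqrtmx (M t) *m (invmx (M t) *m ar_S th e t).
  by rewrite /Z ls_est_error //; exact: (perturbed_det pG g0 hG pM h0 x0 hM small).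
have UW : U = sigma *: wsum.
  by rewrite WE scalerA invfM mulrA divff ?mul1r // gt_eqF.
have sub (A B : 'cV[R]_p.+1) : (A - sigma *: B) i 0 = A i 0 - sigma * B i 0 by rewrite !mxE.
rewrite -/Z -sub -UW.
apply: le_trans (entry_le_enorm _ i) _.
apply: le_trans (whitened_close pG g0 hG pM h0 x0 hM small ZE erefl) _.
rewrite -/s -/U UW enormZ gtr0_norm //; apply: ler_wpM2l.
  by apply: divr_ge0; [apply: mulr_ge0 => //; exact: mulr_ge0|exact: sqr_ge0].
by rewrite ler_wpM2l // ltW.
Qed.

End Stopping.

(** * Rare events for the noise *)

Section NoiseEvents.
Context d (T : measurableType d) (R : realType) (P : probability T R).
Variables (e : nat -> T -> R) (s2 : R).
Hypothesis me : forall n, measurable_fun setT (e n).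
Hypothesis ie : mutually_independent P e.
Hypothesis ide : identically_distributed P e.
Hypothesis h1 : has_mean P (e 0%N).
Hypothesis m1 : mean P (e 0%N) = 0.
Hypothesis h2 : has_mean P (fun w => e 0%N w ^+ 2).
Hypothesis m2 : mean P (fun w => e 0%N w ^+ 2) = s2.
Hypothesis s20 : 0 < s2.

(** A union bound over [O(h)] variables: each exceeds [a = rho sqrt h] with probability at most
    [tail_mean a / a^2], and the Lindeberg tail makes the sum small with only two moments. *)
Lemma large_noise (rho C b : R) : 0 < rho -> 0 < C -> 0 < b ->
  exists H : R, forall (h : R) n, H <= h -> 0 < h -> n%:R <= C * h ->
   Pr P (\big[setU/set0]_(k < n) [set w | rho * Num.sqrt h < `|e k w|]) <= b.
Proof.
move=> r0 C0 b0.
have eta0 : 0 < b * rho ^+ 2 / C by rewrite divr_gt0 // mulr_gt0 // exprn_gt0.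
have [A A0 hA] := tail_mean_small me ide h2 m2 eta0.
exists ((A / rho) ^+ 2) => h n Hh h0 nh.
have Ar : A <= rho * Num.sqrt h.
  rewrite mulrC -ler_pdivrMr //; have Ar0 : 0 <= A / rho by rewrite ltW // divr_gt0.
  by rewrite -[leLHS]ger0_norm // -sqrtr_sqr ler_wsqrtr.
set a := rho * Num.sqrt h; have a0 : 0 < a by rewrite mulr_gt0 // sqrtr_gt0.
have a2 : a ^+ 2 = rho ^+ 2 * h by rewrite exprMn sqr_sqrtr // ltW.
have mF k : measurable [set w | a < `|e k w|].
  by apply: measurable_set_lt => //; apply: measurableT_comp.
apply: le_trans (Pr_bigcup P (index_enum 'I_n) (fun k : 'I_n => mF k)) _.
apply: (@le_trans _ _ (\sum_(k < n) b * rho ^+ 2 / C / a ^+ 2)).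
  apply: ler_sum => k _; apply: (@le_trans _ _ (tail_mean P e a / a ^+ 2)).
    rewrite -(tail_noise me ide h2 m2 a k); apply: markov_mean.
    - exact: exprn_gt0.
    - exact: has_mean_tail ide h2 m2 _ _.
    - by move=> w; exact: tail_fun_ge0.
    - exact: mF.
    - move=> w /= aw; rewrite /tail_fun aw mulr1 -[X in _ <= X]normr_sqr ler_sqr ?nnegrE //; exact: ltW.
  by rewrite ler_wpM2r ?invr_ge0 ?sqr_ge0 // hA.
rewrite sumr_const card_ord -[X in X <= _]mulr_natl a2.
have -> : n%:R * (b * rho ^+ 2 / C / (rho ^+ 2 * h)) = b * (n%:R / (C * h)).
  by field; rewrite !gt_eqF.
by rewrite ger_pMr // ler_pdivrMr ?mul1r // mulr_gt0.
Qed.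

(* Squares of truncated noise have a finite variance. *)
Lemma few_squares (b : R) : 0 < b -> exists H : R, forall n, H <= n%:R -> (0 < n)%N ->
   Pr P [set w | \sum_(k < n) e k w ^+ 2 <= n%:R * s2 / 4] <= b.
Proof.
move=> b0.
have gap (x y q c : R) : x <= q * c / 4 - y -> q * (c / 2) <= y -> q * c / 4 <= - x by lra.
have [A A0 hA] := tail_mean_small me ide h2 m2 (divr_gt0 s20 (ltr0n R 2)).
pose f x := x ^+ 2 - tail_fun A x; pose mu := s2 - tail_mean P e A.
pose g x := f x - mu.
have mf : measurable_fun setT f by apply: measurable_funB; [exact: sqr_meas|exact: tail_fun_meas].
have mg : measurable_fun setT g by exact: measurable_funB.
have fA x : 0 <= f x <= A ^+ 2.
  rewrite /f subr_ge0 tail_fun_le /tail_fun /=.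
  have [Ax|xA] := ltP A `|x|; rewrite ?mulr1 ?subrr ?sqr_ge0 //= mulr0 subr0.
  by rewrite -normr_sqr ler_sqr ?nnegrE // ltW.
have hf : has_mean P (f \o e 0%N).
  by apply: has_meanB => //; exact: has_mean_tail me ide h2 m2 A 0.
have mfE : mean P (f \o e 0%N) = mu.
  rewrite (meanB (P := P) h2 (has_mean_tail me ide h2 m2 A 0)) m2.
  by rewrite (tail_noise me ide h2 m2).
have hg : has_mean P (g \o e 0%N) by apply: has_meanB => //; exact: has_mean_cst.
have mgE : mean P (g \o e 0%N) = 0.
  by rewrite (meanB (P := P) hf (has_mean_cst P mu)) mfE mean_cst subrr.
have hg2 : has_mean P (fun w => g (e 0%N w) ^+ 2).
  apply: (@has_mean_bounded _ _ _ _ _ ((A ^+ 2 + `|mu|) ^+ 2)).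
    by apply: measurable_funX; apply: measurableT_comp.
  move=> w; rewrite normrX ler_sqr ?nnegrE ?addr_ge0 ?sqr_ge0 //.
  apply: le_trans (ler_normB _ _) _; apply: lerD => //.
  by have /andP[q1 q2] := fA (e 0%N w); rewrite ger0_norm.
pose v := mean P (fun w => g (e 0%N w) ^+ 2).
have v0 : 0 <= v by apply: mean_ge0 => w; exact: sqr_ge0.
(* The truncated mean keeps half the variance, so an average at most [s2 / 4] is a deviation of at
   least [s2 / 4], to which Chebyshev applies. *)
have mu2 : s2 / 2 <= mu by have := hA A (lexx _); rewrite /mu; lra.
exists (16 * v / (b * s2 ^+ 2)) => n Hn n0.
have U1 k : past_meas e k (fun=> 1 : R) by exact: measurable_cst.
have Ub (k : nat) (w : T) : `|1 : R| <= 1 by rewrite normr1.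
have [pS hS mS] := mg_var me ie ide n U1 Ub mg hg mgE hg2 erefl.
set S := (fun w : T => \sum_(k < n) 1 * g (e k w)) in pS hS mS.
have nR : 0 < n%:R :> R by rewrite ltr0n.
have mSm : measurable_fun setT S by exact: (past_measurable_fun me pS).
have a0 : 0 < n%:R * s2 / 4 by rewrite divr_gt0 // mulr_gt0.
apply: (@le_trans _ _ (Pr P [set w | n%:R * s2 / 4 <= `|S w|])).
  apply: Pr_le.
  - by apply: measurable_set_le => //; apply: measurable_fun_bigsum => k; apply: measurable_funX.
  - by apply: measurable_set_le => //; apply: measurableT_comp.
  - move=> w /= hw; have hS' : S w <= n%:R * s2 / 4 - n%:R * mu.
      have -> : S w = \sum_(k < n) f (e k w) - n%:R * mu.
        rewrite /S; under eq_bigr do rewrite mul1r /g.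
        by rewrite sumrB sumr_const card_ord mulr_natl.
      apply: lerB => //; apply: le_trans hw; apply: ler_sum => k _.
      by rewrite /f gerBl tail_fun_ge0.
    have n2 : n%:R * (s2 / 2) <= n%:R * mu by rewrite ler_wpM2l.
    rewrite -normrN; apply: le_trans (ler_norm _); exact: gap hS' n2.
apply: le_trans (chebyshev_mean a0 mSm hS) _; rewrite mS.
have -> : \sum_(k < n) mean P (fun=> 1 ^+ 2) = n%:R :> R.
  rewrite (eq_bigr (fun=> 1)) ?sumr_const ?card_ord // => k _.
  by rewrite mean_cst expr1n.
rewrite -/v; have -> : v * n%:R / (n%:R * s2 / 4) ^+ 2 = 16 * v / s2 ^+ 2 / n%:R.
  by field; rewrite !gt_eqF.
rewrite ler_pdivrMr //; move: Hn; rewrite ler_pdivrMr ?mulr_gt0 ?exprn_gt0 // => Hn.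
by rewrite ler_pdivrMr ?exprn_gt0 // [b * _]mulrC -mulrA.
Qed.

End NoiseEvents.

(** * The uniform limit theorem *)

Lemma Phi_prod_shift (R : realType) (p : nat) (u : 'I_p -> R) (eta : R) : 0 <= eta ->
  \prod_i Phi (u i + eta) <= \prod_i Phi (u i) + p%:R * eta.
Proof.
move=> e0; have := @prod_le_add R 'I_p (index_enum 'I_p) (fun i => Phi (u i + eta)) (fun i => Phi (u i)) eta e0.
rewrite size_index_ord; apply=> i; rewrite ?Phi_ge0 ?Phi_le1 //.
have : Phi (u i + eta) - Phi (u i) <= u i + eta - u i by apply: Phi_lip; rewrite lerDl.
move: (Phi _) (Phi _) => a b; lra.
Qed.

(** Predictability: applied with [past e k] as the measurable space, it shows that the increment at
    [k] is determined by the earlier noises. *)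
Lemma mmeas_whitened d (T : measurableType d) (R : realType) (p : nat) (e : nat -> T -> R)
  (th : 'cV[R]_p.+1) (sigma h dl : R) (G : 'M[R]_p.+1) k :
  (forall l, (l < k)%N -> measurable_fun setT (e l)) ->
  mmeas (fun w => whitened th (fun l => e l w) sigma h dl G k).
Proof.
move=> me; have mX := mmeas_ar_X th me.
have mM : mmeas (fun w => ar_M th (fun l => e l w) k).
  by apply: mmeas_ar_M => l lk; apply: me; apply: leq_trans lk (leq_pred k).
apply: mmeasZ; last by apply: mmeasM => //; exact: mmeas_cst.
apply: measurable_funM => //.
rewrite (_ : (fun w => _) = fun w => (w \in [set w | \tr (ar_M th (fun l => e l w) k) < h * sigma ^+ 2]
   `&` [set w | normsq (ar_X th (fun l => e l w) k) <= dl])%:R).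
  apply: measurable_fun_ind; apply: measurableI.
    by apply: measurable_set_lt => //; exact: mmeas_trace.
  by apply: measurable_set_le => //; exact: mmeas_normsq.
apply/funext => w; rewrite /running; congr (_%:R).
by congr nat_of_bool; apply/idP/idP => [/andP[a b]|/set_mem[a b]]; [apply/mem_set; split|apply/andP; split].
Qed.

Section Level.
Context d (T : measurableType d) (R : realType) (P : probability T R).
Variables (p : nat) (e : nat -> T -> R) (sigma : R).
Local Notation N := (p.+1%:R : R).
Hypothesis me : forall n, measurable_fun setT (e n).
Hypothesis ie : mutually_independent P e.
Hypothesis ide : identically_distributed P e.
Hypothesis h1 : has_mean P (e 0%N).
Hypothesis m1 : mean P (e 0%N) = 0.
Hypothesis h2 : has_mean P (fun w => e 0%N w ^+ 2).
Hypothesis m2 : mean P (fun w => e 0%N w ^+ 2) = sigma ^+ 2.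
Hypothesis sg0 : 0 < sigma.

Variables (th : 'cV[R]_p.+1) (h dl z g xi lam r d1 eta eta1 b : R) (G : 'M[R]_p.+1) (n0 : nat).
Local Notation C := ((sigma ^+ 2 + 1) / (sigma ^+ 2 * g ^+ 2)).
Hypotheses (h0 : 0 < h) (dl0 : 0 <= dl) (dlh : dl <= h) (pG : psd G) (g0 : 0 < g).
Hypothesis hG : forall v, g * normsq v <= bform G v v.
Hypotheses (z0 : 0 <= z) (dz : dl <= (z * sigma * g) ^+ 2 * h) (xi0 : 0 <= xi).
Hypotheses (small : N * xi <= g ^+ 2 / 2) (xiz : N * xi / g ^+ 2 <= z) (lam0 : 0 < lam).
Hypothesis xil : 2 * (N * xi) / g ^+ 2 * (N * lam) <= eta1.
Hypotheses (dd1 : dl <= d1) (HS : sigma * Num.sqrt h * \tr G * (N * lam) <= d1).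
Hypothesis Hgram : forall (e : nat -> R) m, normsq (ar_X th e m) <= d1 ->
  (forall i, `|ar_S th e m i 0| <= d1) -> `|\tr (ar_M th e m) - h * sigma ^+ 2| <= d1 ->
  forall i j, `|ar_M th e m i j - h * (G *m G) i j| <= xi * h.
Hypothesis Hinc : forall (e : nat -> R) m, \tr (ar_M th e m.-1) < h * sigma ^+ 2 ->
  (forall i, (i < m)%N -> `|e i| <= r) -> forall k, (k <= m)%N -> normsq (ar_X th e k) <= dl.
Hypothesis Htau : forall e : nat -> R, n0%:R * sigma ^+ 2 / 4 < \sum_(k < n0) e k ^+ 2 ->
  h * sigma ^+ 2 <= \tr (ar_M th e n0.+1).
Hypothesis Hbig : Pr P (\big[setU/set0]_(k < n0.+1) [set w | r < `|e k w|]) <= b / 3.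
Hypothesis Hfew : Pr P [set w | \sum_(k < n0) e k w ^+ 2 <= n0%:R * sigma ^+ 2 / 4] <= b / 3.
Hypothesis Htight : N * (sigma ^+ 2 * C / lam ^+ 2) <= b / 3.
Hypotheses (bz : b <= z) (beta : b <= eta / 3) (eta10 : 0 <= eta1) (Neta : N * eta1 <= eta / 3).
Hypothesis clt : forall n (D : nat -> T -> 'I_p.+1 -> R) (B : set T),
    (forall k i, past_meas e k (fun w => D k w i)) -> (forall k w i, `|D k w i| <= z) ->
    (forall w i, \sum_(k < n) D k w i ^+ 2 <= C) ->
    measurable B -> Pr P B <= z ->
    (forall w, ~ B w -> forall i j,
       `|sigma ^+ 2 * (\sum_(k < n) D k w i * D k w j) - (i == j)%:R| <= z) ->
    forall s : 'I_p.+1 -> R,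
      `|Pr P [set w | forall i, \sum_(k < n) D k w i * e k w <= s i]
        - \prod_i Phi (s i)| <= eta / 3.

(** One parameter and one level. The rare event joins a large noise, too few squared innovations,
    and a large martingale value, each of probability at most [b / 3]; a third of [eta] each goes to
    the limit theorem, the rare event and the shift of the orthant. *)
Lemma level_bound (t : 'cV[R]_p.+1) :
  `|Pr P [set w | exists n : nat, is_tau th (fun k => e k w) sigma h n /\
      forall i, (sqrtmx (ar_M th (fun k => e k w) n) *m (ls_est th (fun k => e k w) n - th)) i 0 <= t i 0]
    - Phi_p t sigma| <= eta.
Proof.
have arith_end (q1 q2 q3 q4 q5 q6 q7 q8 : R) : q2 <= q4 + q5 -> q4 <= q1 + q5 ->
    q7 <= q6 + q3 -> q6 <= q8 + q3 -> q5 <= b -> b <= eta / 3 -> q3 <= eta / 3 ->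
    - (eta / 3) <= q2 - q8 <= eta / 3 -> - (eta / 3) <= q1 - q7 <= eta / 3 -> - eta <= q4 - q6 <= eta.
  by move=> a1 a2 a3 a4 a5 a6 a7 /andP[a8 a9] /andP[a10 a11]; apply/andP; split; lra.
have arith_up (q1 q2 q3 q4 : R) : - q3 <= q1 - q2 -> q1 <= q4 -> q2 <= q4 + q3 by lra.
have arith_lo (q1 q2 q3 q4 : R) : q1 - q2 <= q3 -> q2 <= q4 - q3 -> q1 <= q4 by lra.
set E := [set w | exists n : nat, _]; have mE : measurable E := measurable_event th me sigma h t.
have s20 : 0 < sigma ^+ 2 by exact: exprn_gt0.
have sh0 : 0 < sigma ^+ 2 * h by exact: mulr_gt0.
have g20 : 0 < g ^+ 2 by exact: exprn_gt0.
pose D k w i := whitened th (fun l => e l w) sigma h dl G k i 0.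
have pD k i : past_meas e k (fun w => D k w i).
  exact: (@mmeas_whitened _ (past e k) R p e th sigma h dl G k (fun l lk => past_meas_noise lk) i 0).
have bD k w i : `|D k w i| <= z.
  apply: le_trans (entry_le_enorm _ i) _; exact: (whitened_enorm _ _ sg0 h0 pG g0 hG).
have sD w i n : \sum_(k < n) D k w i ^+ 2 <= C.
  apply: le_trans (whitened_sqr_sum _ _ sg0 h0 _ pG g0 hG _ dl0) _.
  have -> : C = (h * sigma ^+ 2 + h) / (sigma ^+ 2 * h * g ^+ 2) by field; rewrite !gt_eqF.
  by rewrite ler_wpM2r ?lerD2l // invr_ge0 mulr_ge0 // ltW.
pose W i w := \sum_(k < n0.+1) D k w i * e k w.
have tightW i := martingale_tight me ie ide h1 m1 h2 m2 (n := n0.+1) (fun k => pD k i)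
  (fun k w => bD k w i) (fun w => sD w i n0.+1) lam0.
pose B1 := \big[setU/set0]_(k < n0.+1) [set w | r < `|e k w|].
pose B2 := [set w | \sum_(k < n0) e k w ^+ 2 <= n0%:R * sigma ^+ 2 / 4].
pose B3 := \big[setU/set0]_(i < p.+1) [set w | lam <= `|W i w|].
have mB1 : measurable B1.
  by apply: bigsetU_measurable => k _; apply: measurable_set_lt => //; apply: measurableT_comp.
have mB2 : measurable B2.
  by apply: measurable_set_le => //; apply: measurable_fun_bigsum => k; apply: measurable_funX.
have mB3 : measurable B3 by apply: bigsetU_measurable => i _; have [] := tightW i.
have PB3 : Pr P B3 <= b / 3.
  apply: le_trans (Pr_bigcup P (index_enum 'I_p.+1) (fun i => (tightW i).1)) _.
  apply: le_trans Htight; rewrite mulr_natl -[X in _ *+ X]card_ord -sumr_const.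
  by apply: ler_sum => i _; have [] := tightW i.
pose B := B1 `|` B2 `|` B3.
have mB12 : measurable (B1 `|` B2) by exact: measurableU.
have mB : measurable B by exact: measurableU.
have PB : Pr P B <= b.
  apply: le_trans (PrU P mB12 mB3) _.
  have := PrU P mB1 mB2; move: Hbig Hfew PB3; rewrite -/B1 -/B2.
  by move: (Pr P _) (Pr P _) (Pr P _) (Pr P _) => q1 q2 q3 q4; lra.
have path w : ~ B w -> exists tt, [/\ is_tau th (fun k => e k w) sigma h tt,
   forall i j, `|sigma ^+ 2 * (\sum_(k < n0.+1) D k w i * D k w j) - (i == j)%:R| <= z &
   forall i, `|(sqrtmx (ar_M th (fun k => e k w) tt) *m (ls_est th (fun k => e k w) tt - th)) i 0
      - sigma * W i w| <= sigma * eta1].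
  move=> /not_orP[/not_orP[nB1 nB2] nB3].
  have He k : (k < n0.+1)%N -> `|e k w| <= r.
    move=> kn; rewrite leNgt; apply/negP => ke; apply: nB1.
    by rewrite /B1 -(bigcup_mkord n0.+1 (fun k => [set w | r < `|e k w|])); exists k.
  have Ht : h * sigma ^+ 2 <= \tr (ar_M th (fun k => e k w) n0.+1).
    by apply: Htau; rewrite ltNge; apply/negP.
  have HW i : `|wsum th (fun k => e k w) sigma h dl G n0.+1 i 0| <= lam.
    rewrite leNgt; apply/negP => ke; apply: nB3; rewrite /B3.
    rewrite -bigcup_seq; exists i; first by rewrite /= mem_index_enum.
    by move: ke; rewrite mxE => /ltW.
  have [tt [ht hg hZ]] := path_conclusion sg0 h0 pG g0 hG xi0 small (ltW lam0) dd1
    (@Hgram (fun k => e k w)) (@Hinc (fun k => e k w)) Ht He HW HS.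
  exists tt; split=> // [i j|i]; first exact: le_trans (hg i j) xiz.
  have := hZ i; rewrite [wsum _ _ _ _ _ _ _ i 0]mxE => hi; apply: le_trans hi _.
  by rewrite mulrCA ler_wpM2l // ltW.
have cltD := @clt n0.+1 D B pD bD (fun w i => sD w i n0.+1) mB (le_trans PB bz)
   (fun w nB => let: ex_intro _ (And3 _ hg _) := path w nB in hg).
have mWle (s : 'I_p.+1 -> R) : measurable [set w | forall i, W i w <= s i].
  apply: measurable_set_forall => i; apply: measurable_set_le => //.
  apply: measurable_fun_bigsum => k; apply: measurable_funM => //.
  exact: (past_measurable_fun me (pD k i)).
pose u i := t i 0 / sigma.
have su i : sigma * u i = t i 0 by rewrite /u mulrCA divff ?mulr1 // gt_eqF.
(* Off the rare event the studentized error is within [sigma eta1] of [sigma W], so the event lies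
   between orthants of [W] shifted by [eta1]. *)
have up : Pr P E <= Pr P [set w | forall i, W i w <= u i + eta1] + Pr P B.
  apply: le_trans (PrU P (mWle _) mB); apply: Pr_le => //; first exact: measurableU.
  move=> w [n [hn hE]]; have [Bw|nB] := pselect (B w); [by right|left=> i].
  have [tt [ht _ hZ]] := path w nB.
  have := hZ i; rewrite (tau_unique ht hn) ler_norml => /andP[lo _].
  have hEi := hE i; rewrite -(ler_pM2l sg0) mulrDr su.
  by move: lo hEi; move: (_ i 0) (sigma * W i w) (sigma * eta1) (t i 0); exact: arith_up.
have lo : Pr P [set w | forall i, W i w <= u i - eta1] <= Pr P E + Pr P B.
  apply: le_trans (PrU P mE mB); apply: Pr_le => //; first exact: measurableU.
  move=> w hw; have [Bw|nB] := pselect (B w); [by right|left].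
  have [tt [ht _ hZ]] := path w nB; exists tt; split=> // i.
  have := hZ i; rewrite ler_norml => /andP[_ hi].
  have := hw i; rewrite -(ler_pM2l sg0) mulrBr su.
  by move: hi; move: (_ i 0) (sigma * W i w) (sigma * eta1) (t i 0); exact: arith_lo.
have s1 := Phi_prod_shift u eta10.
have s2 := Phi_prod_shift (fun i => u i - eta1) eta10.
have E2 : \prod_i Phi (u i - eta1 + eta1) = \prod_i Phi (u i).
  by apply: eq_bigr => i _; rewrite subrK.
rewrite {}E2 in s2.
have := cltD (fun i => u i + eta1); have := cltD (fun i => u i - eta1).
rewrite -/(Phi_p t sigma) in s1 s2 *.
move: lo up s1 s2 PB beta Neta; rewrite !ler_norml.
move: (Pr P E) (Pr P B) (Phi_p t sigma) (\prod_i Phi (u i + eta1)) (\prod_i Phi (u i - eta1)).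
move: (Pr P [set w | forall i, W i w <= u i + eta1]) (Pr P [set w | forall i, W i w <= u i - eta1]) (N * eta1).
exact: arith_end.
Qed.

End Level.

(** Collects the constants valid on all of [K]. [G] is the square root of the limit matrix, and [g]
    comes from [psd_sqrt_lower] with the trace bound of [G]. *)
Lemma uniform_setup (R : realType) (p : nat) (K : set 'cV[R]_p.+1) (s2 : R) : 0 < s2 ->
  compact K -> K `<=` @tLambda R p.+1 -> exists B c1 C g : R, [/\ 0 < B, 0 < c1, 0 < C, 0 < g &
  forall th, K th -> exists (y : 'cV[R]_p.+1) (G : 'M[R]_p.+1),
   [/\ normsq th <= B, forall z, c1 * normsq z <= \sum_j yule_res th z j ^+ 2,
     forall k v, enorm (compan th ^+ k *m v) <= C * enorm v,
     forall j, yule_res th y j = (j == ord0)%:R &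
     [/\ psd G, G *m G = (s2 / p.+1%:R) *: toep y, \tr G <= 1 + p.+1%:R * s2 &
      forall v, g * normsq v <= bform G v v]]].
Proof.
move=> s20 cK KL.
have K1 th : K th -> cond1 th by case/KL.
have K3 th : K th -> cond3 th by case/KL => _ [].
have [B B0 hB] := param_bound cK.
have [c1 c10 hc1] := yule_coercive cK K3.
have [c2 c20 hc2] := toep_coercive cK K3.
have N0 : 0 < p.+1%:R :> R by rewrite ltr0n.
have t0 : 0 < 1 + p.+1%:R * s2 by rewrite ltr_wpDr // mulr_ge0 // ltW.
exists B, c1, (Num.sqrt (p.+1%:R / c2)), (s2 / p.+1%:R * c2 / (1 + p.+1%:R * s2)).
split=> //; [by rewrite sqrtr_gt0 divr_gt0|by rewrite !(divr_gt0, mulr_gt0)|].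
move=> th Kth; have [y [ry py _ cy]] := hc2 th Kth.
have y0 : y ord0 0 = 1 by have := ry ord0; rewrite /yule_res unlift_none eqxx.
have yule (j : 'I_p) : y (lift ord0 j) 0 = (toep y *m th) (widen_ord (leqnSn p) j) 0.
  by have := ry (lift ord0 j); rewrite /yule_res liftK /= => /eqP; rewrite subr_eq0 => /eqP.
have sN : 0 < s2 / p.+1%:R by exact: divr_gt0.
pose Gam := (s2 / p.+1%:R) *: toep y.
have pGam : psd Gam.
  have [Lt Lp] := posdef_psd py; split; first by rewrite linearZ /= Lt.
  by move=> v; rewrite -/(bform Gam v v) bformZ; apply: mulr_ge0; [exact: ltW|exact: Lp].
have [] := psd_sqrtP pGam; move: (psd_sqrt Gam) => G pG GG.
(* Cauchy-Schwarz gives [(tr G)^2 <= (p + 1) s2], and [a^2 <= b] implies [a <= 1 + b]. *)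
have trG : \tr G <= 1 + p.+1%:R * s2.
  have := trace_sqr_le pG.1; rewrite GG /Gam mxtraceZ.
  have -> : \tr (toep y) = p.+1%:R.
    rewrite /mxtrace (eq_bigr (fun=> 1)) ?sumr_const ?card_ord // => i _.
    by rewrite mxE distnn (_ : inord 0 = ord0) //; apply: val_inj; rewrite /= inordK.
  rewrite divfK ?gt_eqF //; have := mulr_ge0 (ltW N0) (ltW s20).
  by move: (\tr G) (_ * s2) => a b b0 ab; rewrite leNgt; apply/negP => ba; nra.
exists y, G; split=> //; first exact: hB.
- by move=> z; exact: hc1.
- by move=> k v; exact: (compan_exp_enorm y0 yule py (K1 _ Kth) k v c20 cy).
split=> // v; apply: psd_sqrt_lower pG trG t0 _.
by rewrite GG bformZ -mulrA ler_pM2l.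
Qed.

Section Final.
Context d (T : measurableType d) (R : realType) (P : probability T R).
Variables (p : nat) (e : nat -> T -> R) (sigma : R).
Local Notation N := (p.+1%:R : R).
Hypothesis me : forall n, measurable_fun setT (e n).
Hypothesis ie : mutually_independent P e.
Hypothesis ide : identically_distributed P e.
Hypothesis h1 : has_mean P (e 0%N).
Hypothesis m1 : mean P (e 0%N) = 0.
Hypothesis h2 : has_mean P (fun w => e 0%N w ^+ 2).
Hypothesis m2 : mean P (fun w => e 0%N w ^+ 2) = sigma ^+ 2.
Hypothesis sg0 : 0 < sigma.
Variable K : set 'cV[R]_p.+1.
Hypotheses (cK : compact K) (KL : K `<=` @tLambda R p.+1).

Lemma uniform_clt (eta : R) : 0 < eta -> exists H : R, forall h : R, 0 < h -> H <= h ->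
  forall th, K th -> forall t : 'cV[R]_p.+1,
  `|Pr P [set w | exists n : nat, is_tau th (fun k => e k w) sigma h n /\
      forall i, (sqrtmx (ar_M th (fun k => e k w) n) *m (ls_est th (fun k => e k w) n - th)) i 0 <= t i 0]
    - Phi_p t sigma| <= eta.
Proof.
move=> eta0; have s20 : 0 < sigma ^+ 2 by exact: exprn_gt0.
have [B [c1 [C [g [B0 c10 C0 g0 hK]]]]] := uniform_setup s20 cK KL.
have N0 : 0 < N by rewrite ltr0n.
have g20 : 0 < g ^+ 2 by exact: exprn_gt0.
pose Cc := (sigma ^+ 2 + 1) / (sigma ^+ 2 * g ^+ 2).
have Cc0 : 0 < Cc by rewrite divr_gt0 ?mulr_gt0 // addr_gt0.
have eta3 : 0 < eta / 3 by rewrite divr_gt0.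
have [z z0 clt] := martingale_clt me ie ide h1 m1 h2 m2 p.+1 (ltW Cc0) eta3.
pose b := Num.min z (eta / 3).
have b0 : 0 < b by rewrite lt_min z0.
have bz : b <= z by rewrite ge_min lexx.
have beta : b <= eta / 3 by rewrite ge_min lexx orbT.
have b3 : 0 < b / 3 by rewrite divr_gt0.
(* Chosen for Chebyshev over all coordinates; the 1 ensures [lam <= lam^2]. *)
pose lam := 1 + N * (sigma ^+ 2 * Cc) / (b / 3).
have q0 : 0 < N * (sigma ^+ 2 * Cc) by rewrite mulr_gt0 // mulr_gt0.
have lam1 : 1 <= lam by rewrite lerDl divr_ge0 // ltW.
have lam0 : 0 < lam by exact: lt_le_trans ltr01 lam1.
have Htight : N * (sigma ^+ 2 * Cc / lam ^+ 2) <= b / 3.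
  rewrite mulrA ler_pdivrMr ?exprn_gt0 //.
  have : N * (sigma ^+ 2 * Cc) / (b / 3) <= lam by rewrite /lam lerDr.
  rewrite ler_pdivrMr // => hl; apply: le_trans hl _.
  by rewrite mulrC ler_pM2l // expr2 ler_peMl // ltW.
pose eta1 := eta / 3 / N.
have eta10 : 0 < eta1 by rewrite divr_gt0.
(* The relative error of the Gram matrix: below [z] for the bracket, below 1/2 for invertibility,
   and small against [lam] so that the studentized error moves by at most [sigma eta1]. *)
pose mu := Num.min z (Num.min (1 / 2) (eta1 / (2 * (N * lam)))).
have Nl : 0 < 2 * (N * lam) by rewrite !mulr_gt0.
have mu0 : 0 < mu by rewrite !lt_min z0 !divr_gt0.
pose xi := g ^+ 2 / N * mu.
have xi0 : 0 < xi by rewrite mulr_gt0 // divr_gt0.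
have Nxi : N * xi = g ^+ 2 * mu by rewrite /xi; field; rewrite gt_eqF.
have mu2 : N * xi / g ^+ 2 = mu by rewrite Nxi; field; rewrite gt_eqF.
have [d1 d10 gram] := gram_close p c10 s20 xi0 (addr_ge0 ler01 (ltW B0)).
(* The bound on squared states over [h]: at most 1 for the bracket bound [Cc], at most [d1] for the
   Gram matrix, and small enough for increments below [z]. *)
pose dl := Num.min 1 (Num.min d1 ((z * sigma * g) ^+ 2)).
have dl0 : 0 < dl by rewrite !lt_min ltr01 d10 exprn_gt0 // !mulr_gt0.
pose J := Num.bound (4 * C ^+ 2 * sigma ^+ 2 / dl).
have hJ : 4 * C ^+ 2 * sigma ^+ 2 <= J%:R * dl.
  by rewrite -ler_pdivrMr //; apply/ltW/archi_boundP; rewrite divr_ge0 ?mulr_ge0 ?sqr_ge0 // ltW.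
pose rho := Num.sqrt dl / (2 * C * J.+1%:R).
have CJ : 0 < 2 * C * J.+1%:R by rewrite !mulr_gt0.
have rho0 : 0 < rho by rewrite divr_gt0 // sqrtr_gt0.
have hr : 2 * C * J.+1%:R * rho <= Num.sqrt dl by rewrite /rho mulrC divfK ?gt_eqF.
(* By [innovation_sum], [C1 h] squared innovations averaging [sigma^2 / 4] push the trace to the
   level [h sigma^2]. *)
pose C1 := 8 * (1 + B); have C10 : 0 < C1 by rewrite mulr_gt0 // addr_gt0.
have [H1 hH1] := large_noise me ide h2 m2 rho0 (addr_gt0 C10 (ltr0n R 2)) b3.
have [H2 hH2] := few_squares me ie ide h2 m2 s20 b3.
(* Once [sqrt h >= q], the bound of order [sqrt h] on [S_tau] falls below [d1 h]. *)
pose q := sigma * (1 + N * sigma ^+ 2) * (N * lam) / d1.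
exists (Num.max 1 (Num.max H1 (Num.max H2 (q ^+ 2)))) => h h0.
rewrite !ge_max => /and4P[h1' hH1' hH2' hq] th Kth t.
have [y [G [thB hc1 hC ry [pG GG trG hG]]]] := hK th Kth.
pose n0 := (Num.truncn (C1 * h)).+1.
have Ch : 0 <= C1 * h by rewrite mulr_ge0 // ltW.
have n0l : C1 * h <= n0%:R by exact/ltW/truncnS_gt.
have n0u : n0.+1%:R <= (C1 + 2) * h.
  rewrite /n0 -!natr1; have a1 : (Num.truncn (C1 * h))%:R <= C1 * h by rewrite truncn_le.
  by rewrite mulrDl; move: a1 h1'; move: (C1 * h) => a; move: (_%:R) => c; lra.
have n0h : h <= n0%:R.
  apply: le_trans n0l; rewrite ler_peMl ?(ltW h0) //; rewrite /C1; move: B0; lra.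
apply: (level_bound me ie ide h1 m1 h2 m2 sg0 (h := h) (dl := dl * h) (z := z) (g := g)
  (xi := xi) (lam := lam) (r := rho * Num.sqrt h) (d1 := d1 * h) (eta1 := eta1) (b := b)
  (G := G) (n0 := n0)) => //.
- by rewrite mulr_ge0 // ltW.
- by rewrite ger_pMl // ge_min lexx.
- exact: ltW.
- by rewrite ler_pM2r // !ge_min lexx !orbT.
- exact: ltW.
- by rewrite Nxi ler_pM2l // -[2^-1]mul1r !ge_min lexx !orbT.
- by rewrite mu2 ge_min lexx.
- have -> : 2 * (N * xi) / g ^+ 2 * (N * lam) = mu * (2 * (N * lam)).
    by rewrite -mu2; ring.
  by rewrite -ler_pdivlMr // !ge_min lexx !orbT.
- by rewrite ler_pM2r // !ge_min lexx orbT.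
- have T0 : 0 < 1 + N * sigma ^+ 2 by rewrite ltr_wpDr // mulr_ge0 // ltW.
  have qs : q <= Num.sqrt h.
    have q00 : 0 <= q by rewrite ltW // divr_gt0 // !mulr_gt0.
    by rewrite -[leLHS]ger0_norm // -sqrtr_sqr ler_wsqrtr.
  have ss : Num.sqrt h ^+ 2 = h by rewrite sqr_sqrtr // ltW.
  have s0 : 0 < Num.sqrt h by rewrite sqrtr_gt0.
  apply: (@le_trans _ _ (Num.sqrt h * (sigma * (1 + N * sigma ^+ 2) * (N * lam)))).
    have -> : sigma * Num.sqrt h * \tr G * (N * lam) = Num.sqrt h * (sigma * \tr G * (N * lam)) by ring.
    by rewrite ler_pM2l // ler_pM2r ?mulr_gt0 // ler_pM2l.
  have -> : d1 * h = Num.sqrt h * (Num.sqrt h * d1) by rewrite -[in LHS]ss; ring.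
  by rewrite ler_pM2l // -ler_pdivrMr.
- move=> e' m Xm Sm trm i j; have := gram th y e' m h h0 hc1 _ ry Xm Sm trm i j.
  have -> : (G *m G) i j = sigma ^+ 2 / N * toep y i j by rewrite GG mxE.
  apply => k; apply: le_trans (entry_le_enorm _ k) _.
  rewrite -ler_sqr ?nnegrE ?enorm_ge0 ?addr_ge0 // ?(ltW B0) // enorm_sqr; apply: le_trans thB _.
  by move: B0; nra.
- by move=> e' m htr he; apply: (path_increment_bound C0 hC h0 dl0 hJ (ltW rho0) hr htr he).
- move=> e' he'; have := innovation_sum th e' n0; have := normsq_ge0 th.
  have : C1 * h * sigma ^+ 2 <= n0%:R * sigma ^+ 2 by rewrite ler_pM2r.
  have : 0 <= \tr (ar_M th e' n0.+1) by exact/psd_trace_ge0/ar_M_psd.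
  move: he' thB; rewrite /C1; move: (\sum_(k < n0) _) (\tr _) (n0%:R * _) (normsq th) => a c f k a1 a2 a3 a4 a5 a6.
  have a7 : (2 + 2 * k) * c <= (2 + 2 * B) * c by rewrite ler_wpM2r // lerD2l ler_pM2l.
  have a8 : (2 + 2 * B) * (h * sigma ^+ 2) <= (2 + 2 * B) * c.
    apply: le_trans a7; apply: le_trans a6; have -> : (2 + 2 * B) * (h * sigma ^+ 2) = 8 * (1 + B) * h * sigma ^+ 2 / 4 by field.
    by apply: le_trans (ltW a1); rewrite ler_pM2r.
  by rewrite ler_pM2l in a8 => //; rewrite addr_gt0 // mulr_gt0.
- exact: hH1.
- by apply: hH2 => //; exact: le_trans n0h.
- exact: ltW.
- by rewrite /eta1 mulrC divfK // gt_eqF.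
Qed.

End Final.

Unset Implicit Arguments.

Theorem theorem2p1 (R : realType) (d : measure_display) (T : measurableType d)
  (P : probability T R) (p : nat) (eps : nat -> T -> R) (sigma : R) :
  (0 < p)%N ->
  (forall n, measurable_fun setT (eps n)) ->
  mutually_independent P eps ->
  identically_distributed P eps ->
  P.-integrable setT (EFin \o eps 0%N) ->
  (\int[P]_x (eps 0%N x)%:E = 0)%E ->
  P.-integrable setT (EFin \o (fun x => eps 0%N x ^+ 2)) ->
  (\int[P]_x (eps 0%N x ^+ 2)%:E = (sigma ^+ 2)%:E)%E ->
  0 < sigma ->
  forall K : set 'cV[R]_p, compact K -> K `<=` @tLambda R p ->
  forall eta : R, 0 < eta ->
  exists H : R, forall h : R, 0 < h -> H <= h ->
  forall th : 'cV[R]_p, K th -> forall t : 'cV[R]_p,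
    `| fine (P [set w | exists n : nat,
                 is_tau th (fun k => eps k w) sigma h n /\
                 forall i : 'I_p,
                   (sqrtmx (ar_M th (fun k => eps k w) n)
                      *m (ls_est th (fun k => eps k w) n - th)) i 0 <= t i 0])
       - Phi_p t sigma | <= eta.
Proof.
(* The companion and Toeplitz constructions use dimension [p.+1], which [0 < p] provides. *)
case: p => // p _ me ie ide h1 m1 h2 m2 sg0 K cK KL eta eta0.
by apply: (uniform_clt me ie ide h1 _ h2 _ sg0 cK KL eta0); rewrite /mean ?m1 ?m2.
Qed.
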